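(* Let $E$ be the figure-eight knot in $S^3$, and put \[\alpha_0=\sup\left\{\alpha\in\left[0,\frac{2\pi}{3}\right)\,\middle|\,2\,\mathrm{Im}\left(\Phi_E\left(\alpha;\frac{\alpha}{2}\right)\right)<\mathrm{Vol}(M_\alpha(E))\right\}=1.7647826174\ldots.\] Let $\alpha$ be a real number with $0\leq\alpha<\alpha_0$. For each integer $n\geq1$ let $j=j^{(n)}$ be a weight in $\{i/2\mid i\in\mathbb{Z},\ 0\leq i\leq (2n+1)-2\}$ such that the limit $\lim_{n\to\infty}\frac{j^{(n)}}{2n+1}$ exists and \[\left|8\pi\lim_{n\to\infty}\frac{j^{(n)}}{2n+1}-2\pi\right|=\alpha.\] Then \[\lim_{n\to\infty}\frac{4\pi}{2n+1}\log\left|V_{j^{(n)}}^{(2n+1)}(E)\right|=\mathrm{Vol}(M_\alpha(E)).\]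
   Context: Let $r=2n+1\geq 3$ be odd and $s=\exp(2\pi\sqrt{-1}/r)$. Put $\{m\}=s^m-s^{-m}$, $\{m;k\}=\prod_{i=0}^{k-1}\{m-i\}$ and $\{m\}!=\{m;m\}$ (so $\{0\}!=1$). For a weight $j\in\{i/2\mid i\in\mathbb{Z},0\leq i\leq r-2\}$, the colored Jones invariant of the figure-eight knot $E$ with color $j$, at parameter $q=s^2=\exp(4\pi\sqrt{-1}/r)$, is given by \[V_j^{(r)}(E)=\sum_{k=0}^{\min\{2j,\,r-(2j+1)-1\}}\frac{1}{\{1\}}\frac{\{2j+1+k\}!}{\{2j-k\}!}.\] The potential function is \[\Phi_E(\alpha;z)=-\tfrac12\mathrm{Li}_2\big(e^{2\sqrt{-1}(\alpha/2+z)}\big)+\tfrac12\mathrm{Li}_2\big(e^{2\sqrt{-1}(\alpha/2-z)}\big)+\alpha z,\] where $\mathrm{Li}_2(w)=-\int_0^w\frac{\log(1-u)}{u}du$ is the dilogarithm, analytically continued to the complex plane cut along $[1,\infty)$ (and extended continuously to $w=1$). For real $x$ one has $\mathrm{Im}\,\Phi_E(\alpha;x)=-\{\Lambda(x+\frac{\alpha}{2})+\Lambda(x-\frac{\alpha}{2})\}$ with $\Lambda(t)=-\int_0^t\log|2\sin u|\,du$ the Lobachevsky function. $M_\alpha(E)$ denotes the hyperbolic cone manifold with underlying space $S^3$ and singular set $E$ with cone angle $\alpha$ (for $\alpha=0$: the complete hyperbolic structure on $S^3\setminus E$); it is hyperbolic for $0\leq\alpha<\frac{2\pi}{3}$. $\mathrm{Vol}(M_\alpha(E))$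 is its hyperbolic volume. It is known (Abrosimov--Mednykh) that \[\mathrm{Vol}(M_\alpha(E))=2\left\{\Lambda\left(\theta_E+\tfrac{\alpha}{2}\right)+\Lambda\left(\theta_E-\tfrac{\alpha}{2}\right)\right\},\qquad \theta_E=\tfrac12\arccos\left(\cos\alpha-\tfrac12\right).\] *)

(* Defs.v *)
From HB Require Import structures.
From mathcomp Require Import all_boot all_order all_algebra.
From mathcomp Require Import all_classical all_reals all_analysis.
Set Implicit Arguments.
Unset Strict Implicit.
Unset Printing Implicit Defensive.
Import Order.TTheory GRing.Theory Num.Theory.
Import numFieldNormedType.Exports.
From mathcomp Require Import complex.
Local Open Scope classical_set_scope.
Local Open Scope complex_scope.
Local Open Scope ring_scope.

Section complex_functions.
Context {R : realType}.
Implicit Types z w : R[i].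

Definition cmod z : R := Re `|z|.

Definition cexp z : R[i] :=
  (expR (Re z) * cos (Im z)) +i* (expR (Re z) * sin (Im z)).

(* Values in ]-pi, pi]. *)
Definition carg z : R :=
  if 0 <= Im z then acos (Re z / cmod z) else - acos (Re z / cmod z).

Definition clog z : R[i] := ln (cmod z) +i* carg z.

(* Integration along the segment u = t w, 0 < t < 1, which avoids the cut
   [1, +oo[ when w is off ]1, +oo[.  The Lebesgue integral also converges at
   w = 1 and gives there the continuous extension. *)
Definition dilog w : R[i] :=
  let F (t : R) := clog (1 - t%:C * w) / (t%:C * w) * w in
  - (Rintegral lebesgue_measure `]0, 1[ (fun t => Re (F t))
     +i* Rintegral lebesgue_measure `]0, 1[ (fun t => Im (F t))).

Definition potential (a : R) z : R[i] :=
  let I : R[i] := 0 +i* 1 in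
  let h : R[i] := (a / 2)%:C in
  - (1 / 2) * dilog (cexp (2 * I * (h + z)))
  + 1 / 2 * dilog (cexp (2 * I * (h - z)))
  + a%:C * z.

End complex_functions.

Definition lobachevsky {R : realType} (t : R) : R :=
  let f (u : R) := ln `|2 * sin u| in
  if 0 <= t then - Rintegral lebesgue_measure `[0, t] f
  else Rintegral lebesgue_measure `[t, 0] f.

Section colored_jones.
Variable R : realType.
Implicit Types (r : nat) (m : int).

Definition jones_root r : R[i] := cexp (0 +i* (2 * pi / r%:R)).

Definition brace r m : R[i] := jones_root r ^ m - jones_root r ^ (- m).

Definition brace_fall r m (k : nat) : R[i] :=
  \prod_(0 <= i < k) brace r (m - i%:Z).

Definition brace_fact r (m : nat) : R[i] := brace_fall r m%:Z m.

(* The color is the weight j = c / 2 with 0 <= c <= r - 2, encoded by the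
   natural number c = 2j. *)
Definition colored_jones_fig8 r (c : nat) : R[i] :=
  \sum_(0 <= k < (minn c (r - (c + 1) - 1)).+1)
     1 / brace r 1 * (brace_fact r (c + 1 + k) / brace_fact r (c - k)).

End colored_jones.

Section figure_eight.
Variable R : realType.

Definition sphere3 : set 'rV[R]_4 := [set v | \sum_(k < 4) v 0 k ^+ 2 = 1].

(* Inverse of the stereographic projection from the point (0, 0, 0, 1). *)
Definition inv_stereo (x y z : R) : 'rV[R]_4 :=
  let N := x ^+ 2 + y ^+ 2 + z ^+ 2 in
  (N + 1)^-1 *: \row_(k < 4) [:: 2 * x; 2 * y; 2 * z; N - 1]`_k.

Definition figure_eight : set 'rV[R]_4 :=
  [set inv_stereo ((2 + cos (2 * t)) * cos (3 * t))
                  ((2 + cos (2 * t)) * sin (3 * t))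
                  (sin (4 * t)) | t in `[0, 2 * pi]].

End figure_eight.

Section cone_manifolds.
Variable R : realType.

Definition cosh (x : R) : R := (expR x + expR (- x)) / 2.
Definition sinh (x : R) : R := (expR x - expR (- x)) / 2.

(* The model of cone angle b <= 2 pi: H^3 cut open along a half-plane bounded
   by a geodesic, reglued into total angle b around that axis.  Its points
   (rho, phi, h) are cylindrical coordinates: distance to the axis, angle,
   position along the axis; the metric is
   drho^2 + sinh^2 rho dphi^2 + cosh^2 rho dh^2.  For b = 2 pi this is H^3. *)
Definition cone_model (b : R) : set (R * R * R) :=
  [set c | 0 <= c.1.1 /\ 0 <= c.1.2 < b].

Definition angular_dist (b x y : R) : R := Num.min `|x - y| (b - `|x - y|).

(* The hyperbolic cosine of the distance (angular_dist <= b / 2 <= pi, so the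
   hyperbolic law of cosines applies). *)
Definition cone_cosh_dist (b : R) (c c' : R * R * R) : R :=
  cosh c.1.1 * cosh c'.1.1 * cosh (c.2 - c'.2)
  - sinh c.1.1 * sinh c'.1.1 * cos (angular_dist b c.1.2 c'.1.2).

Section metric_on_subset.
Variables (V : normedModType R) (X S : set V) (d : V -> V -> R).

(* A ball around p is isometric to a ball around a point of the axis of the
   model of cone angle b; when p lies on the singular set S, S corresponds to
   the axis.  Coordinates on the axis are not unique, hence "at distance 0" in
   the surjectivity clause. *)
Definition cone_chart (b : R) (p : V) : Prop :=
  exists (e : R) (phi : V -> R * R * R),
    let B := [set x | X x /\ d p x < e] in
    [/\ 0 < e /\ phi p = (0, 0, 0),
        forall x, B x -> cone_model b (phi x),
        forall x y, B x -> B y ->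
          cosh (d x y) = cone_cosh_dist b (phi x) (phi y),
        forall c, cone_model b c -> cone_cosh_dist b (0, 0, 0) c < cosh e ->
          exists2 x, B x & cone_cosh_dist b (phi x) c = 1
      & S p -> forall x, B x -> (S x <-> (phi x).1.1 = 0)].

(* A complete length metric on X inducing the topology of X, hyperbolic away
   from S and with cone angle a along S. *)
Record hyperbolic_cone_metric (a : R) : Prop := HyperbolicConeMetric {
  hcm_separated : forall x y, X x -> X y -> (d x y = 0 <-> x = y);
  hcm_sym : forall x y, X x -> X y -> d x y = d y x;
  hcm_triangle : forall x y z, X x -> X y -> X z -> d x z <= d x y + d y z;
  hcm_topology : forall x, X x -> forall e, 0 < e ->
    (exists2 r, 0 < r & forall y, X y -> `|x - y| < r -> d x y < e) /\
    (exists2 r, 0 < r & forall y, X y -> d x y < r -> `|x - y| < e);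
  hcm_length : forall x y, X x -> X y -> forall e, 0 < e ->
    exists z, [/\ X z, d x z < d x y / 2 + e & d z y < d x y / 2 + e];
  hcm_complete : forall u : nat -> V, (forall n, X (u n)) ->
    (forall e, 0 < e -> exists N, forall m n,
       (N <= m)%N -> (N <= n)%N -> d (u m) (u n) < e) ->
    exists2 l, X l & forall e, 0 < e ->
      exists N, forall n, (N <= n)%N -> d (u n) l < e;
  hcm_regular : forall p, X p -> ~ S p -> cone_chart (2 * pi) p;
  hcm_singular : forall p, X p -> S p -> cone_chart a p }.

(* Riemannian volume, as the 3-dimensional Hausdorff measure of (X, d); with
   the factor pi / 6 (volume of a Euclidean ball of diameter 1) it restricts
   to Lebesgue measure on Euclidean 3-space.  rho k bounds the diameter of the
   k-th set of the cover. *)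
Definition metric_volume : \bar R :=
  ereal_sup [set ereal_inf [set v |
      exists (A : nat -> set V) (rho : nat -> R),
        [/\ X `<=` \bigcup_k A k,
            forall k, 0 <= rho k <= delta,
            forall k x y, (X `&` A k) x -> (X `&` A k) y -> d x y <= rho k
          & v = (\sum_(0 <= k <oo) (pi / 6 * rho k ^+ 3)%:E)%E]]
    | delta in [set delta : R | 0 < delta]].

End metric_on_subset.

(* For a = 0: the complete hyperbolic structure on the knot complement. *)
Definition fig8_cone_space (a : R) : set 'rV[R]_4 :=
  if a == 0 then @sphere3 R `\` @figure_eight R else @sphere3 R.

(* The cone structure is unique up to isometry where it exists, so the choice
   made by [xget] is immaterial there. *)
Definition vol_fig8_cone (a : R) : R :=
  xget 0 [set v : R | exists d : 'rV[R]_4 -> 'rV[R]_4 -> R,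
    hyperbolic_cone_metric (fig8_cone_space a) (@figure_eight R) d a /\
    metric_volume (fig8_cone_space a) d = v%:E].

Definition theta_fig8 (a : R) : R := acos (cos a - 1 / 2) / 2.

Definition alpha0 : R :=
  sup [set a : R | 0 <= a < 2 * pi / 3 /\
    2 * Im (potential a (a / 2)%:C) < vol_fig8_cone a].

End cone_manifolds.

(* Main.v *)
(* Write [d = 4 pi / r] and [P_k = prod_(1 <= i <= k) (2 cos (N d) - 2 cos (i d))] with [N = 2j + 1].
   Then [V = {N}/{1} sum_k P_k].  The factors are at least [1] in absolute value and positive
   exactly when [i d] is in an arc around [pi] bounded by [2 theta] and [2 pi - 2 theta]; past
   [2 theta] all [P_k] have the same sign, the largest one is the last of the arc, and its
   logarithm is a Riemann sum for the volume.

   The terms before the arc alternate in sign and may be exponentially larger than the main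
   term, so that their sum has to be shown to cancel.  Let [T] and [M] be the two blocks of
   terms.  Their moments [sum P_k e^(i n (k+1) d)] satisfy, up to boundary terms, one and the
   same three term recurrence in [n], whose coefficients [Y - e^(-i n d)] have positive
   imaginary parts.  Its backward solution therefore grows exponentially, which forces the two
   moment sequences to be nearly proportional.  Testing this with the trigonometric polynomial
   [((1 - sin) / 2)^m], which is small on [T] and not on [M], shows that [sum T] is small
   compared with [sum M].

   By differentiation under the integral sign, [Im Phi (a; a/2) = - Lambda a], so that [alpha0] is the
   zero of the decreasing function [Vol + 2 Lambda].  It is located by evaluating [Lambda]
   with a power series in fixed point arithmetic. *)
Require Import Defs.
From Stdlib Require BinInt.
Import Corelib.Numbers.BinNums(Z, Zpos, Zneg, Z0, positive, xH, xO, xI).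
From mathcomp Require Import all_boot all_order all_algebra cyclotomic.
From mathcomp Require Import all_classical all_reals all_analysis.
From mathcomp Require Import measurable_realfun.
Import Order.TTheory GRing.Theory Num.Theory.
Import numFieldNormedType.Exports.
From mathcomp Require Import complex ring lra zify ssrZ.
Set Implicit Arguments.
Unset Strict Implicit.
Unset Printing Implicit Defensive.
Local Open Scope classical_set_scope.
Local Open Scope complex_scope.
Local Open Scope ring_scope.

(** * Derivatives *)

Section calculus.
Variable R : realType.
Implicit Types (f g : R -> R) (x a b c : R).

(** The obstacle is quantitative. In exponents counted in units of [1 / d], the terms of [T] may
    reach [21/25], while the main term is only known to exceed [1/4]: from [a < alpha0] come
    [a < 177/100] and a volume of at least [26/100]. For the backward solution [c] the flux
    [Im (conj c_(n+1) * c_n)] increases at each backward step because the imaginary parts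
    [sin (n d)] are positive, by a factor of at least about [exp (2 arsinh (sin (n d)))] per two
    steps. Over the angles from [2/5] to [pi] this makes the moment sequences proportional up to
    [exp (- (4/5) / d)]. The power [m] is about [(2/5) / d]: it lowers [T] to
    [(85/100)^m * exp ((6/25) / d)] and keeps at least [(85/100)^m] of the main term, with
    [(85/100)^(-m) <= exp ((7/100) / d)]. The critical errors then have exponents
    [21/25 - 4/5 + 7/100 = 11/100] and [6/25], both below [1/4]. The size of the main term [P_l] is
    explicit: the product of all [|2 sin (2 pi k / r)|] is [r], so that [|{N}| |P_l|] is [r] divided
    by two products of sines over initial ranges. *)

Lemma is_derive1_cst c x : is_derive x 1 (fun _ : R => c) 0.
Proof. exact: is_derive_cst. Qed.

Lemma is_derive1_id x : is_derive x 1 (fun t : R => t) 1.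
Proof. exact: is_derive_id. Qed.

Lemma is_derive1_add f g x a b : is_derive x 1 f a -> is_derive x 1 g b ->
  is_derive x 1 (fun t => f t + g t) (a + b).
Proof. exact: is_deriveD. Qed.

Lemma is_derive1_opp f x a : is_derive x 1 f a ->
  is_derive x 1 (fun t => - f t) (- a).
Proof. exact: is_deriveN. Qed.

Lemma is_derive1_mul f g x a b : is_derive x 1 f a -> is_derive x 1 g b ->
  is_derive x 1 (fun t => f t * g t) (a * g x + f x * b).
Proof.
move=> fa gb; have h := is_deriveM fa gb.
by apply: is_derive_eq h _; rewrite addrC /GRing.scale /= [g x * a]mulrC.
Qed.

Lemma is_derive1_comp_cst (F : R -> R) (F' : R) f x a :
  is_derive (f x) 1 F F' -> is_derive x 1 f a ->
  is_derive x 1 (fun t => F (f t)) (F' * a).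
Proof. by move=> hF hf; have := is_derive1_comp hF hf; rewrite mulrC. Qed.

Lemma is_derive1_inv f x a : is_derive x 1 f a -> f x != 0 ->
  is_derive x 1 (fun t => (f t)^-1) (- a / (f x) ^+ 2).
Proof.
move=> fa f0; have h := is_deriveV f0 fa.
by apply: is_derive_eq h _; rewrite /GRing.scale /= mulrC mulrN mulNr.
Qed.

Lemma is_derive1_exprn f n x a : is_derive x 1 f a ->
  is_derive x 1 (fun t => f t ^+ n) (n%:R * f x ^+ n.-1 * a).
Proof.
move=> fa; elim: n => [|n IH].
  by under eq_fun do rewrite expr0; rewrite !mul0r; exact: is_derive1_cst.
under eq_fun do rewrite exprS.
apply: is_derive_eq (is_derive1_mul fa IH) _ => /=.
by case: n {IH} => [|n] /=; rewrite ?expr0 ?exprS -?natr1; ring.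
Qed.

Lemma is_derive1_expR f x a : is_derive x 1 f a ->
  is_derive x 1 (fun t => expR (f t)) (expR (f x) * a).
Proof. by move=> fa; apply: is_derive1_comp_cst. Qed.

Lemma is_derive1_sin f x a : is_derive x 1 f a ->
  is_derive x 1 (fun t => sin (f t)) (cos (f x) * a).
Proof. by move=> fa; apply: is_derive1_comp_cst. Qed.

Lemma is_derive1_cos f x a : is_derive x 1 f a ->
  is_derive x 1 (fun t => cos (f t)) (- sin (f x) * a).
Proof. by move=> fa; apply: is_derive1_comp_cst. Qed.

Lemma is_derive1_lnc f x a : is_derive x 1 f a -> 0 < f x ->
  is_derive x 1 (fun t => ln (f t)) ((f x)^-1 * a).
Proof. by move=> fa f0; apply: is_derive1_comp_cst => //; exact: is_derive1_ln. Qed.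

Lemma is_derive1_continuous f x a : is_derive x 1 f a -> {for x, continuous f}.
Proof.
by move=> [d _]; apply: differentiable_continuous; apply/derivable1_diffP.
Qed.

Lemma is_derive1_eq f x a b : is_derive x 1 f a -> a = b -> is_derive x 1 f b.
Proof. by move=> ? <-. Qed.

Lemma mvt f (df : R -> R) a b : a < b ->
  (forall x, a <= x <= b -> is_derive x 1 f (df x)) ->
  exists2 c, a < c < b & f b - f a = df c * (b - a).
Proof.
move=> ab hd; have [|| c cab ->] := MVT (f := f) (df := df) ab; last by exists c.
- by move=> x; rewrite in_itv /= => /andP[? ?]; apply: hd; rewrite !ltW.
- apply: derivable_within_continuous => x; rewrite in_itv /= => xab.
  by have [] := hd x xab.
Qed.

Lemma derive_ge0_le f (df : R -> R) a b : a <= b ->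
  (forall x, a <= x <= b -> is_derive x 1 f (df x)) ->
  (forall x, a <= x <= b -> 0 <= df x) -> f a <= f b.
Proof.
rewrite le_eqVlt => /predU1P[->//|ab] hd h0.
have [c /andP[ac cb] e] := mvt ab hd.
by rewrite -subr_ge0 e mulr_ge0 ?subr_ge0 ?(ltW ab)// h0// !ltW.
Qed.

Lemma derive_le f g (df dg : R -> R) a b : a <= b ->
  (forall x, a <= x <= b -> is_derive x 1 f (df x)) ->
  (forall x, a <= x <= b -> is_derive x 1 g (dg x)) ->
  (forall x, a <= x <= b -> df x <= dg x) -> f b - f a <= g b - g a.
Proof.
move=> ab hf hg hfg.
have : g a + - f a <= g b + - f b.
  apply: (@derive_ge0_le (fun x => g x + - f x) (fun x => dg x + - df x)) => //.
  - by move=> x xab; apply: is_derive1_add; [exact: hg|apply: is_derive1_opp; exact: hf].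
  - by move=> x xab; rewrite subr_ge0 hfg.
lra.
Qed.

Lemma derive_lipschitz f (df : R -> R) M a b : a <= b ->
  (forall x, a <= x <= b -> is_derive x 1 f (df x)) ->
  (forall x, a <= x <= b -> `|df x| <= M) -> `|f b - f a| <= M * (b - a).
Proof.
rewrite le_eqVlt => /predU1P[->|ab hd hM]; first by rewrite !subrr normr0 mulr0.
have [c /andP[ac cb] ->] := mvt ab hd.
rewrite normrM ler_pM// ?hM ?(ltW ac) ?(ltW cb)//.
by rewrite ger0_norm// subr_ge0 ltW.
Qed.

End calculus.

(** Syntax-directed computation of a derivative into an existential variable, identified afterwards
    with the wanted value by [is_derive1_eq]. The point-free patterns catch functions that appear
    eta-reduced. *)
Ltac der1 :=
  lazymatch goal with
  | |- is_derive _ _ (fun t => t) _ => eapply is_derive1_id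
  | |- is_derive _ _ id _ => eapply is_derive1_id
  | |- is_derive _ _ -%R _ => eapply is_deriveNid
  | |- is_derive _ _ ( *%R _) _ => eapply is_derive1_mul
  | |- is_derive _ _ ( +%R _) _ => eapply is_derive1_add
  | |- is_derive _ _ expR _ => eapply is_derive_expR
  | |- is_derive _ _ sin _ => eapply is_derive_sin
  | |- is_derive _ _ cos _ => eapply is_derive_cos
  | |- is_derive _ _ (fun _ => ?c) _ => eapply is_derive1_cst
  | |- is_derive _ _ (fun t => _ + _) _ => eapply is_derive1_add
  | |- is_derive _ _ (fun t => - _) _ => eapply is_derive1_opp
  | |- is_derive _ _ (fun t => _ * _) _ => eapply is_derive1_mul
  | |- is_derive _ _ (fun t => _ ^+ _) _ => eapply is_derive1_exprn
  | |- is_derive _ _ (fun t => _ ^-1) _ => eapply is_derive1_inv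
  | |- is_derive _ _ (fun t => expR _) _ => eapply is_derive1_expR
  | |- is_derive _ _ (fun t => sin _) _ => eapply is_derive1_sin
  | |- is_derive _ _ (fun t => cos _) _ => eapply is_derive1_cos
  | |- is_derive _ _ (fun t => ln _) _ => eapply is_derive1_lnc
  end.
Ltac der := repeat der1.

(** * Elementary inequalities for sine, cosine and hyperbolic sine *)

Section trigonometric_inequalities.
Variable R : realType.
Implicit Types x y : R.

Lemma sin_lipschitz x y : `|sin x - sin y| <= `|x - y|.
Proof.
wlog xy : x y / y <= x => [h|].
  by have [/h//|/ltW/h] := leP y x; rewrite distrC (distrC y).
rewrite (ger0_norm (x := x - y)) ?subr_ge0// -[x - y]mul1r.
apply: (derive_lipschitz (df := cos)) => // z _.
exact: cos_max.
Qed.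

Lemma cos_lipschitz x y : `|cos x - cos y| <= `|x - y|.
Proof. by rewrite -!sinDpihalf (le_trans (sin_lipschitz _ _))// opprD addrACA subrr addr0. Qed.

Lemma sin_le x : 0 <= x -> sin x <= x.
Proof.
move=> x0; have := sin_lipschitz x 0; rewrite sin0 !subr0 (ger0_norm x0).
exact/le_trans/ler_norm.
Qed.

Lemma cos_sub x y : cos x - cos y = 2 * sin ((x + y) / 2) * sin ((y - x) / 2).
Proof.
have -> : cos x = cos ((x + y) / 2 - (y - x) / 2) by congr cos; field.
have -> : cos y = cos ((x + y) / 2 + (y - x) / 2) by congr cos; field.
by rewrite cosB cosD; ring.
Qed.

Lemma expR_le_inv x : x < 1 -> expR x <= (1 - x)^-1.
Proof.
move=> x1; rewrite -[leLHS]invrK -expRN lef_pV2 ?posrE ?expR_gt0 ?subr_gt0//.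
exact: expR_ge1Dx.
Qed.

(* [sinh] is convex on the positive axis and [2 sinh (17/20) <= 2]. *)
Lemma sinh_le (s : R) : 0 <= s <= 1 -> expR (17 / 20 * s) - expR (- (17 / 20 * s)) <= 2 * s.
Proof.
move=> /andP[s0 s1].
pose f (t : R) := expR t + - expR (- t); pose f' (t : R) := expR t + expR (- t).
have fd (t : R) : is_derive t 1 f (f' t).
  by eapply is_derive1_eq; [rewrite /f; der|rewrite /f'; ring].
have f'mono (x y : R) : 0 <= x -> x <= y -> f' x <= f' y.
  move=> x0 xy; rewrite /f' !expRN -subr_ge0.
  have ex := expR_gt0 x; have ey := expR_gt0 y.
  have -> : expR y + (expR y)^-1 - (expR x + (expR x)^-1) =
    (expR y - expR x) * (1 - (expR x * expR y)^-1).
    by field; rewrite !gt_eqF.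
  rewrite mulr_ge0 ?subr_ge0 ?ler_expR// invf_le1 ?mulr_gt0//.
  by rewrite -expRD -expR0 ler_expR; lra.
have key : f (17 / 20) <= 2.
  rewrite /f; set v := expR (- (17 / 20)).
  have v0 : 0 < v by exact: expR_gt0.
  have -> : expR (17 / 20) = v^-1 by rewrite /v expRN invrK.
  (* [v^-1 - v <= 2] holds from [v = sqrt 2 - 1] on, and [415 / 1000] is just above. The bound on
     [v] starts from [1 - x <= exp (- x)] at [x = 17/320] and is squared four times. *)
  have hv : 415 / 1000 <= v.
    have dbl (a b x : R) : 0 <= a -> b <= a * a -> a <= expR (- (x / 2)) -> b <= expR (- x).
      move=> a0 ab ax; rewrite [x in expR (- x)]splitr opprD expRD.
      by apply: le_trans ab _; apply: ler_pM.
    have h0 : 303 / 320 <= expR (- (17 / 20 / 2 / 2 / 2 / 2)) :> R.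
      by have := expR_ge1Dx (- (17 / 20 / 2 / 2 / 2 / 2) : R); lra.
    have h1 : 26 / 29 <= expR (- (17 / 20 / 2 / 2 / 2)) :> R by apply: dbl h0; lra.
    have h2 : 45 / 56 <= expR (- (17 / 20 / 2 / 2)) :> R by apply: dbl h1; lra.
    have h3 : 20 / 31 <= expR (- (17 / 20 / 2)) :> R by apply: dbl h2; lra.
    by apply: dbl h3; lra.
  rewrite -(ler_pM2r v0) mulrDl mulVf ?gt_eqF//; nra.
move: s0; rewrite le_eqVlt => /predU1P[<-|s0].
  by rewrite !mulr0 oppr0 subrr.
move: s1; rewrite le_eqVlt => /predU1P[->|s1].
  by rewrite !mulr1.
pose c := 17 / 20 * s.
have c0 : 0 < c by rewrite /c; lra.
have cd : c < 17 / 20 by rewrite /c; lra.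
(* Convexity: the chord of [f] from [0] to [c] is at most as steep as the chord from [c] to
   [17 / 20]. *)
have [x /andP[x0 x1] e1] := mvt c0 (fun t _ => fd t).
have [y /andP[y0 y1] e2] := mvt cd (fun t _ => fd t).
have := f'mono x y (ltW x0) (ltW (lt_trans x1 y0)).
have f0 : f 0 = 0 by rewrite /f oppr0 subrr.
rewrite f0 !subr0 in e1.
move=> fxy; rewrite -/c -/(f c).
have : f c * (17 / 20 - c) <= (f (17 / 20) - f c) * c.
  have cc : 0 <= c * (17 / 20 - c) by apply: mulr_ge0; lra.
  by have := ler_wpM2r cc fxy; rewrite e2 e1; lra.
rewrite /c; nra.
Qed.

End trigonometric_inequalities.

(** * Cancellation in the alternating block *)

Section modulus.
Variable R : realType.
Implicit Types z w : R[i].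

Lemma cmodE z : cmod z = Num.sqrt (Re z ^+ 2 + Im z ^+ 2).
Proof. by rewrite /cmod normc_def. Qed.

Lemma cmod_ge0 z : 0 <= cmod z.
Proof. by rewrite cmodE sqrtr_ge0. Qed.

Lemma sqr_cmod z : cmod z ^+ 2 = Re z ^+ 2 + Im z ^+ 2.
Proof. by rewrite cmodE sqr_sqrtr// addr_ge0// sqr_ge0. Qed.

Lemma cmodM z w : cmod (z * w) = cmod z * cmod w.
Proof. by rewrite /cmod normrM !normc_def /= mul0r subr0. Qed.

Lemma cmodD z w : cmod (z + w) <= cmod z + cmod w.
Proof. by have := ler_normD z w; rewrite /cmod !normc_def lecE /= => /andP[]. Qed.

Lemma cmodN z : cmod (- z) = cmod z.
Proof. by rewrite /cmod normrN. Qed.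

Lemma cmodB z w : cmod (z - w) <= cmod z + cmod w.
Proof. by rewrite (le_trans (cmodD _ _))// cmodN. Qed.

Lemma cmodJ z : cmod z^* = cmod z.
Proof. by case: z => a b; rewrite !cmodE /= sqrrN. Qed.

Lemma cmod0 : cmod (0 : R[i]) = 0.
Proof. by rewrite /cmod normr0. Qed.

Lemma cmod1 : cmod (1 : R[i]) = 1.
Proof. by rewrite /cmod normr1. Qed.

Lemma cmodX z n : cmod (z ^+ n) = cmod z ^+ n.
Proof. by elim: n => [|n IH]; rewrite ?expr0 ?cmod1// !exprS cmodM IH. Qed.

Lemma cmod_real (a : R) : cmod a%:C = `|a|.
Proof. by rewrite cmodE /= expr0n addr0 sqrtr_sqr. Qed.

Lemma cmod_eq0 z : (cmod z == 0) = (z == 0).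
Proof.
apply/eqP/eqP => [h|->]; last exact: cmod0.
by apply/normr0_eq0; rewrite normc_def; move: h; rewrite /cmod normc_def /= => ->.
Qed.

Lemma cmodV z : cmod z^-1 = (cmod z)^-1.
Proof.
have [->|z0] := eqVneq z 0; first by rewrite invr0 cmod0 invr0.
have c0 : cmod z != 0 by rewrite cmod_eq0.
by apply: (mulIf c0); rewrite -cmodM !mulVf// cmod1.
Qed.

Lemma cmod_sum (I : Type) (s : seq I) (P : pred I) (F : I -> R[i]) :
  cmod (\sum_(i <- s | P i) F i) <= \sum_(i <- s | P i) cmod (F i).
Proof.
elim/big_ind2 : _ => [|x a y b xa yb|//]; first by rewrite cmod0.
by rewrite (le_trans (cmodD _ _))// lerD.
Qed.

Lemma Im_le_cmod z : `|Im z| <= cmod z.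
Proof. by rewrite cmodE -sqrtr_sqr ler_wsqrtr// lerDr sqr_ge0. Qed.

End modulus.

(** * The backward solution of the recurrence and its flux *)

Section backward_solution.
Variables (R : realType) (L : nat) (y : nat -> R[i]).
Hypothesis y_im : forall n, (n < L)%N -> 0 < Im (y n.+1).

(** Indexed by the distance from the top: [backward_pair k] holds the values at [L.+1 - k] and
    [L - k] of the solution that vanishes at [L.+1] and equals [1] at [L]. Carrying a pair makes the
    three term recurrence structural. *)
Fixpoint backward_pair (k : nat) : R[i] * R[i] :=
  if k is k'.+1 then
    let: (p, q) := backward_pair k' in (q, y (L - k') * q - p)
  else (0, 1).

Definition backward n := (backward_pair (L.+1 - n)).1.

Lemma backward_top : backward L.+1 = 0.
Proof. by rewrite /backward subnn. Qed.

Lemma backward_last : backward L = 1.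
Proof. by rewrite /backward subSnn. Qed.

Lemma backwardE n : (n < L)%N ->
  backward n = y n.+1 * backward n.+1 - backward n.+2.
Proof.
move=> nL; rewrite /backward.
have -> : (L.+1 - n = (L - n.+1).+2)%N by lia.
have -> : (L.+1 - n.+1 = (L - n.+1).+1)%N by lia.
have -> : (L.+1 - n.+2 = L - n.+1)%N by lia.
have -> : y n.+1 = y (L - (L - n.+1))%N by congr y; lia.
by rewrite /=; case: (backward_pair _).
Qed.

(** For real [y] this would be constant along a solution; a positive imaginary part of [y] makes it
    increase at each step downwards, from [0] at the top. *)
Definition flux n := Im ((backward n.+1)^* * backward n).

Lemma flux_top : flux L = 0.
Proof. by rewrite /flux backward_top; case: (backward L) => a b /=; ring. Qed.

Lemma fluxE n : (n < L)%N ->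
  flux n = Im (y n.+1) * cmod (backward n.+1) ^+ 2 + flux n.+1.
Proof.
move=> nL; rewrite /flux (backwardE nL) sqr_cmod.
by case: (backward n.+1) => a b; case: (backward n.+2) => c d;
  case: (y n.+1) => u v /=; ring.
Qed.

Lemma flux_ge_succ n : (n < L)%N -> flux n.+1 <= flux n.
Proof.
by move=> nL; rewrite (fluxE nL) lerDr mulr_ge0 ?sqr_ge0// ltW// y_im.
Qed.

Lemma flux_mono i j : (i <= j <= L)%N -> flux j <= flux i.
Proof.
move=> /andP[ij jL]; elim: j ij jL => [|j IH]; first by rewrite leqn0 => /eqP ->.
rewrite leq_eqVlt => /predU1P[->//|]; rewrite ltnS => ij jL.
by rewrite (le_trans (flux_ge_succ jL))// IH// ltnW.
Qed.

Lemma flux_gt0 n : (n < L)%N -> 0 < flux n.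
Proof.
move=> nL; have L0 : (L.-1 < L)%N by lia.
apply: (@lt_le_trans _ _ (flux L.-1)); last by apply: flux_mono; lia.
rewrite (fluxE L0) prednK; last by lia.
by rewrite flux_top addr0 backward_last cmod1 expr1n mulr1 -{1}(ltn_predK nL) y_im.
Qed.

Lemma flux_le n : flux n <= cmod (backward n.+1) * cmod (backward n).
Proof. by rewrite -(cmodJ (backward n.+1)) -cmodM (le_trans (ler_norm _))// Im_le_cmod. Qed.

Lemma backward_neq0 n : (n <= L)%N -> backward n != 0.
Proof.
rewrite leq_eqVlt => /predU1P[->|nL]; first by rewrite backward_last oner_neq0.
apply/eqP => b0; have := flux_le n; rewrite b0 cmod0 mulr0.
by rewrite leNgt flux_gt0.
Qed.

(** Eliminates the middle value [v]. The two increments multiply to at least [t^2 v^2], because [v]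
    is at most the product of the two moduli. The resulting inequality
    [(1 + t^2) v^2 - (u + w) v + u w <= 0] forces a nonnegative discriminant, which is the claim. *)
Lemma flux_step n t : (n.+1 < L)%N -> 0 <= t ->
  t ^+ 2 <= Im (y n.+1) * Im (y n.+2) ->
  4 * t ^+ 2 * (flux n * flux n.+2) <= (flux n - flux n.+2) ^+ 2.
Proof.
move=> nL t0 ht; have nL' := ltnW nL.
have := fluxE nL; have := fluxE nL'.
set u := flux n; set v := flux n.+1; set w := flux n.+2.
set C1 := cmod (backward n.+1); set C2 := cmod (backward n.+2) => uE vE.
have v0 : 0 < v by apply: flux_gt0.
have vC : v <= C2 * C1 by apply: flux_le.
have w0 : 0 <= w.
  by rewrite -flux_top; apply: flux_mono; lia.
have u0 : 0 <= u by apply/ltW/flux_gt0.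
have h : t ^+ 2 * v ^+ 2 <= (u - v) * (v - w).
  have -> : u - v = Im (y n.+1) * C1 ^+ 2 by rewrite uE; ring.
  have -> : v - w = Im (y n.+2) * C2 ^+ 2 by rewrite vE; ring.
  have -> : Im (y n.+1) * C1 ^+ 2 * (Im (y n.+2) * C2 ^+ 2) =
            Im (y n.+1) * Im (y n.+2) * (C2 * C1) ^+ 2 by ring.
  by rewrite ler_pM ?sqr_ge0// ler_sqr ?nnegrE ?mulr_ge0 ?cmod_ge0// ltW.
have := sqr_ge0 (2 * (1 + t ^+ 2) * v - (u + w)).
have -> : (2 * (1 + t ^+ 2) * v - (u + w)) ^+ 2 =
   4 * (1 + t ^+ 2) * ((1 + t ^+ 2) * v ^+ 2 - v * (u + w) + u * w) +
   ((u - w) ^+ 2 - 4 * t ^+ 2 * (u * w)) by ring.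
have : 4 * (1 + t ^+ 2) * ((1 + t ^+ 2) * v ^+ 2 - v * (u + w) + u * w) <= 0.
  rewrite mulr_ge0_le0//; first by have := sqr_ge0 t; lra.
  by move: h; lra.
lra.
Qed.

Lemma cmod_backward i j rho : (i < j <= L)%N -> 0 < rho ->
  rho^-1 <= Im (y j) ->
  cmod (backward j) ^+ 2 <= rho * flux i.
Proof.
case: j => [//|j] /andP[ij jL] r0 hy.
have := fluxE jL; have f1 : 0 <= flux j.+1.
  by rewrite -flux_top; apply: flux_mono; lia.
have f2 : flux j <= flux i by apply: flux_mono; lia.
move=> fE; have : rho^-1 * cmod (backward j.+1) ^+ 2 <= flux i.
  rewrite (le_trans _ f2)// fE.
  by rewrite ler_wpDr// ler_wpM2r// sqr_ge0.
by rewrite mulrC ler_pdivrMr// mulrC.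
Qed.

End backward_solution.

(** * Approximate solutions compared through the Wronskian *)

Section wronskian.
Variables (R : realType) (L : nat) (y : nat -> R[i]).
Hypothesis y_im : forall n, (n < L)%N -> 0 < Im (y n.+1).
Variable rho : R.
Hypothesis rho_gt0 : 0 < rho.
Hypothesis y_rho : forall n, (n < L)%N -> rho^-1 <= Im (y n.+1).

Local Notation c := (backward L y).
Local Notation J := (flux L y).

Variables (a e : nat -> R[i]) (A eps : R).
Hypothesis aE : forall n, (n < L)%N -> a n = y n.+1 * a n.+1 - a n.+2 + e n.+1.
Hypothesis e_le : forall n, (n < L)%N -> cmod (e n.+1) <= eps.
Hypothesis A_ge : cmod (a L.+1) <= A.
Hypothesis eps_ge0 : 0 <= eps.

Let W n := c n * a n.+1 - c n.+1 * a n.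

(** The Wronskian [W] of two exact solutions is constant. Here the source changes it by
    [c i.+1 * e i.+1] at each step, starting from [a L.+1] at the top, and the flux bounds [c]. *)
Lemma wronskian_le b i : (b < L)%N -> (b <= i <= L)%N ->
  cmod (W i) <= A + eps * (L - i)%:R * Num.sqrt (rho * J b).
Proof.
move=> bL /andP[]; move: i; suff h k : forall i, (b <= i)%N -> (i <= L)%N ->
    (L - i)%N = k -> cmod (W i) <= A + eps * k%:R * Num.sqrt (rho * J b).
  by move=> i bi iL; exact: h.
elim: k => [|k IH] i bi iL Li.
  have -> : i = L by lia.
  by rewrite /W backward_top backward_last mul0r subr0 mul1r mulr0 mul0r addr0.
have iL' : (i < L)%N by lia.
have -> : W i = W i.+1 - c i.+1 * e i.+1.
  by rewrite /W (backwardE y iL') (aE iL'); ring.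
apply: (le_trans (cmodB _ _)).
have -> : A + eps * k.+1%:R * Num.sqrt (rho * J b) =
   (A + eps * k%:R * Num.sqrt (rho * J b)) + Num.sqrt (rho * J b) * eps.
  by rewrite -natr1; ring.
rewrite lerD//; first by apply: IH; lia.
rewrite cmodM ler_pM ?cmod_ge0 ?e_le//.
rewrite -[leLHS]ger0_norm ?cmod_ge0// -sqrtr_sqr ler_wsqrtr//.
by apply: cmod_backward => //; [lia|exact: y_rho].
Qed.

(** [a k.+1 / c k.+1 - a k / c k] is [W k / (c k * c k.+1)], whose denominator is at least the flux
    [J k] in modulus. After multiplication by [cmod (c n) <= sqrt (rho * J k)], each of the [n]
    steps costs [A * sqrt (rho / J k) + eps * L * rho], and among the steps [J] is smallest at
    [m.-1]. *)
Lemma wronskian_ratio m n : (0 < m <= L)%N -> (n <= m)%N ->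
  cmod (a n - c n / c 0%N * a 0%N) <=
  n%:R * (A * Num.sqrt (rho / J m.-1) + eps * L%:R * rho).
Proof.
move=> /andP[m0 mL] nm.
set K := A * Num.sqrt _ + _.
have cn0 k : (k <= L)%N -> c k != 0 by move=> ?; apply: backward_neq0.
pose D k := a k / c k - a 0%N / c 0%N.
have -> : a n - c n / c 0%N * a 0%N = c n * D n.
  by rewrite /D; field; rewrite !cn0//; lia.
suff h k : (k <= n)%N -> cmod (c n) * cmod (D k) <= k%:R * K by rewrite cmodM h.
elim: k => [_|k IH kn]; first by rewrite /D subrr cmod0 mulr0 mul0r.
have kL : (k < L)%N by lia.
have km : (k <= m.-1 <= L)%N by lia.
have nE : n = n.-1.+1 by lia.
have nL : (n.-1 < L)%N by lia.
have knL : (k < n <= L)%N by lia.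
have kkL : (k <= k <= L)%N by lia.
have m1 : (m.-1 < L)%N by lia.
have kn' : (k <= n)%N by lia.
have -> : D k.+1 = D k + W k / (c k * c k.+1).
  by rewrite /D /W; field; rewrite !cn0//; lia.
apply: (@le_trans _ _ (cmod (c n) * (cmod (D k) + cmod (W k / (c k * c k.+1))))).
  by rewrite ler_wpM2l ?cmod_ge0// cmodD.
have -> : k.+1%:R * K = k%:R * K + K by rewrite -natr1 mulrDl mul1r.
rewrite mulrDr lerD ?IH//.
rewrite cmodM cmodV cmodM.
set j := J k; have j0 : 0 < j by apply: flux_gt0.
set s := Num.sqrt (rho / j).
have s0 : 0 <= s by exact: sqrtr_ge0.
have s2 : s ^+ 2 = rho / j by rewrite sqr_sqrtr// ltW// divr_gt0.
have sj : Num.sqrt (rho * j) = j * s.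
  rewrite -[j in RHS]gtr0_norm// -sqrtr_sqr -sqrtrM ?sqr_ge0//; congr Num.sqrt.
  by field; rewrite gt_eqF.
have A0 : 0 <= A by rewrite (le_trans _ A_ge)// cmod_ge0.
have w := @wronskian_le k k kL kkL; rewrite -/j sj in w.
have w' : cmod (W k) <= A + eps * L%:R * (j * s).
  apply: (le_trans w); rewrite lerD2l ler_wpM2r ?mulr_ge0 ?(ltW j0)//.
  by rewrite ler_wpM2l// ler_nat leq_subr.
have cle : cmod (c n) <= j * s.
  rewrite -sj -[leLHS]ger0_norm ?cmod_ge0// -sqrtr_sqr ler_wsqrtr//.
  by apply: cmod_backward => //; rewrite nE; exact: y_rho.
have cc : j <= cmod (c k) * cmod (c k.+1) by rewrite mulrC flux_le.
have cc0 : 0 < cmod (c k) * cmod (c k.+1) by apply: lt_le_trans cc.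
apply: (@le_trans _ _ (j * s * ((A + eps * L%:R * (j * s)) / j))).
  rewrite ler_pM ?cmod_ge0//; first by rewrite divr_ge0 ?cmod_ge0// ltW.
  rewrite ler_pM ?cmod_ge0// ?invr_ge0 ?(ltW cc0)//.
  by rewrite lef_pV2// posrE.
have -> : j * s * ((A + eps * L%:R * (j * s)) / j) = A * s + eps * L%:R * (j * s ^+ 2).
  by field; rewrite gt_eqF.
have -> : j * s ^+ 2 = rho by rewrite s2; field; rewrite gt_eqF.
rewrite /K lerD2r ler_wpM2l// ler_wsqrtr// ler_wpM2l ?(ltW rho_gt0)//.
rewrite lef_pV2 ?posrE//; last exact: flux_gt0.
exact: flux_mono.
Qed.

End wronskian.

Section two_moment_sequences.
Variables (R : realType) (L : nat) (y : nat -> R[i]).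
Hypothesis y_im : forall n, (n < L)%N -> 0 < Im (y n.+1).
Variable rho : R.
Hypothesis rho_gt0 : 0 < rho.
Hypothesis y_rho : forall n, (n < L)%N -> rho^-1 <= Im (y n.+1).

(* Two approximate solutions of the recurrence are both nearly proportional to
   the backward solution, hence to each other. *)
Lemma nearly_proportional (a e b f : nat -> R[i]) (A eps B eps' : R) m n :
  (forall n, (n < L)%N -> a n = y n.+1 * a n.+1 - a n.+2 + e n.+1) ->
  (forall n, (n < L)%N -> cmod (e n.+1) <= eps) -> cmod (a L.+1) <= A -> 0 <= eps ->
  (forall n, (n < L)%N -> b n = y n.+1 * b n.+1 - b n.+2 + f n.+1) ->
  (forall n, (n < L)%N -> cmod (f n.+1) <= eps') -> cmod (b L.+1) <= B -> 0 <= eps' ->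
  (0 < m <= L)%N -> (n <= m)%N ->
  cmod (a n * b 0%N - b n * a 0%N) <=
    L%:R * (cmod (b 0%N) * (A * Num.sqrt (rho / flux L y m.-1) + eps * L%:R * rho)
          + cmod (a 0%N) * (B * Num.sqrt (rho / flux L y m.-1) + eps' * L%:R * rho)).
Proof.
move=> aE ea aA e0 bE fb bB f0 mL nm.
set k := Num.sqrt _.
have h1 := wronskian_ratio y_im rho_gt0 y_rho aE ea aA e0 mL nm.
have h2 := wronskian_ratio y_im rho_gt0 y_rho bE fb bB f0 mL nm.
set c := backward L y in h1 h2.
have -> : a n * b 0%N - b n * a 0%N = (a n - c n / c 0%N * a 0%N) * b 0%N
   - (b n - c n / c 0%N * b 0%N) * a 0%N by ring.
apply: (le_trans (cmodB _ _)); rewrite !cmodM mulrDr.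
have nL : (n%:R : R) <= L%:R by rewrite ler_nat; lia.
have A0 : 0 <= A by rewrite (le_trans _ aA)// cmod_ge0.
have B0 : 0 <= B by rewrite (le_trans _ bB)// cmod_ge0.
have k0 : 0 <= k by exact: sqrtr_ge0.
have hx (X Y : R) : 0 <= X -> 0 <= Y -> 0 <= X * k + Y * L%:R * rho.
  by move=> ? ?; rewrite addr_ge0// !mulr_ge0// ltW.
rewrite lerD// mulrC mulrCA ler_wpM2l ?cmod_ge0//.
  by apply: (le_trans h1); rewrite ler_wpM2r// hx.
by apply: (le_trans h2); rewrite ler_wpM2r// hx.
Qed.

End two_moment_sequences.

(** * Exponential growth of the flux *)

Section flux_growth.
Variables (R : realType) (L : nat) (y : nat -> R[i]).
Variable d : R.
Hypothesis d_gt0 : 0 < d.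
Hypothesis yE : forall n, Im (y n) = sin (n%:R * d).
Hypothesis L_pi : L%:R * d < pi.

Let y_im n : (n < L)%N -> 0 < Im (y n.+1).
Proof.
move=> nL; rewrite yE sin_gt0_pi// mulr_gt0 ?ltr0n//=.
by apply: le_lt_trans L_pi; rewrite ler_wpM2r ?(ltW d_gt0)// ler_nat.
Qed.

(** For [r = u / w] the inequality of [flux_step] reads [(r - 1)^2 >= 4 t^2 r], that is
    [r >= exp (2 arsinh t)], and [sinh_le] bounds [arsinh t] below by [17/20 t]. *)
Lemma flux_exp_step n t : (n.+1 < L)%N -> 0 <= t <= 1 ->
  t ^+ 2 <= Im (y n.+1) * Im (y n.+2) ->
  flux L y n.+2 * expR (17 / 20 * (2 * t)) <= flux L y n.
Proof.
move=> nL t01 ht; have t0 : 0 <= t by case/andP: t01.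
have := flux_step y_im nL t0 ht.
set u := flux L y n; set w := flux L y n.+2 => h.
have u0 : 0 < u by apply: flux_gt0 => //; exact: ltnW.
have w0 : 0 <= w by rewrite -(flux_top L y); apply: flux_mono => //; lia.
have wu : w <= u by apply: flux_mono => //; lia.
have := sinh_le t01.
rewrite expRN; have -> : 17 / 20 * (2 * t) = 17 / 20 * t + 17 / 20 * t by ring.
rewrite expRD; set E := expR _ => hE.
have E1 : 1 <= E by rewrite -expR0 ler_expR; lra.
have E0 : 0 < E by lra.
rewrite leNgt; apply/negP => uw.
have w1 : 0 < w.
  by rewrite lt_neqAle w0 andbT; apply/eqP => w00; move: uw; rewrite -w00 mul0r; lra.
have h1 : (E ^+ 2 - 1) ^+ 2 <= 4 * t ^+ 2 * E ^+ 2.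
  have : 0 <= E ^+ 2 - 1 <= 2 * t * E.
    rewrite subr_ge0 exprn_ege1//=.
    by move: hE; rewrite -(ler_pM2r E0) mulrBl mulVf ?gt_eqF// expr2.
  move=> /andP[p q]; have -> : 4 * t ^+ 2 * E ^+ 2 = (2 * t * E) ^+ 2 by ring.
  by rewrite ler_sqr ?nnegrE// (le_trans p).
(* with [u = w r], [1 <= r < E^2], the map [r -> (r - 1)^2 / r] is increasing *)
have : (u - w) ^+ 2 * E ^+ 2 < (E ^+ 2 - 1) ^+ 2 * (u * w).
  rewrite -subr_gt0.
  have -> : (E ^+ 2 - 1) ^+ 2 * (u * w) - (u - w) ^+ 2 * E ^+ 2 =
    (w * (E * E) - u) * (u * (E * E) - w) by ring.
  rewrite mulr_gt0 ?subr_gt0//.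
  apply: (le_lt_trans wu); apply: (lt_le_trans uw).
  by rewrite ler_wpM2r// mulr_ge0// ltW.
have := ler_wpM2r (mulr_ge0 (ltW u0) w0) h1.
have := ler_wpM2r (sqr_ge0 E) h.
lra.
Qed.

(** Induction by steps of two. The exponent replaces the sum of [2 sin (k d)] over every other [k]
    by [1 / d] times an integral of the sine. The term [(L - n) d] pays for taking the smaller of
    two neighbouring sines instead of [sin ((n + 2) d)], and [1] for the last one or two steps. *)
Lemma flux_growth n : (n < L)%N ->
  sin (L%:R * d) * expR (17 / 20 * ((cos (n.+1%:R * d) - cos (L%:R * d)) / d
    - (L - n)%:R * d - 1)) <= flux L y n.
Proof.
move=> nL.
pose Phi k : R := (cos (k.+1%:R * d) - cos (L%:R * d)) / d - (L - k)%:R * d - 1.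
have sL0 : 0 < sin (L%:R * d).
  have L0 : (L.-1 < L)%N by lia.
  by have := y_im L0; rewrite yE prednK//; lia.
have base k : (k < L)%N -> sin (L%:R * d) <= flux L y k.
  move=> kL; apply: (@le_trans _ _ (flux L y L.-1)); last by apply: flux_mono => //; lia.
  have L0 : (L.-1 < L)%N by lia.
  rewrite (fluxE _ L0) prednK; last by lia.
  by rewrite flux_top addr0 backward_last cmod1 expr1n mulr1 yE.
suff h k : forall n, (n < L)%N -> (L - n <= k)%N ->
    sin (L%:R * d) * expR (17 / 20 * Phi n) <= flux L y n by exact: (h L n nL (leq_subr _ _)).
elim/ltn_ind: k => k IH {nL}n nL Lnk.
have [L2|L2] := leqP (L - n) 2.
  apply: le_trans (base _ nL); rewrite ler_piMr ?(ltW sL0)// expR_le1.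
  rewrite pmulr_rle0; last by lra.
  have : (cos (n.+1%:R * d) - cos (L%:R * d)) / d <= 1.
    rewrite ler_pdivrMr// mul1r (le_trans (ler_norm _))//.
    rewrite (le_trans (cos_lipschitz _ _))// -mulrBl normrM (gtr0_norm d_gt0).
    rewrite ler_piMl ?(ltW d_gt0)//.
    have -> : L = (n.+1 + (L - n.+1))%N by lia.
    rewrite natrD opprD addNKr normrN normr_nat (_ : 1 = 1%:R)// ler_nat; lia.
  rewrite /Phi; have : 0 <= (L - n)%:R * d by rewrite mulr_ge0// ltW.
  lra.
have n1L : (n.+1 < L)%N by lia.
have n2L : (n.+2 < L)%N by lia.
have hk : (L - n.+2 < k)%N by lia.
have Ln2 : (L - n = (L - n.+2) + 2)%N by lia.
pose t := Num.min (sin (n.+1%:R * d)) (sin (n.+2%:R * d)).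
have s1 : 0 < sin (n.+1%:R * d) by rewrite -yE y_im.
have s2 : 0 < sin (n.+2%:R * d) by rewrite -yE y_im.
have t0 : 0 <= t by rewrite le_min !ltW.
have t1 : t <= 1 by rewrite ge_min sin_le1.
have st := flux_exp_step (t := t) n1L.
apply: le_trans (st _ _); last first.
- by rewrite expr2 !yE ler_pM// ge_min lexx ?orbT.
- by rewrite t0.
have ih : sin (L%:R * d) * expR (17 / 20 * Phi n.+2) <= flux L y n.+2.
  exact: (IH _ hk _ n2L (leqnn _)).
apply: le_trans (ler_wpM2r (expR_ge0 _) ih).
have ns : `|sin (n.+1%:R * d) - sin (n.+2%:R * d)| <= d.
  rewrite (le_trans (sin_lipschitz _ _))// -mulrBl -[n.+2%:R]natr1 opprD addNKr.
  by rewrite mulN1r normrN gtr0_norm.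
have tl : sin (n.+2%:R * d) - d <= t.
  rewrite le_min lerBlDr; apply/andP; split; last by rewrite gerBl ltW.
  rewrite -lerBlDl (le_trans (ler_norm _))// -normrN opprB; exact: ns.
have cc : (cos (n.+1%:R * d) - cos (n.+3%:R * d)) / d <= 2 * sin (n.+2%:R * d).
  rewrite ler_pdivrMr// cos_sub.
  have -> : (n.+1%:R * d + n.+3%:R * d) / 2 = n.+2%:R * d.
    by rewrite -!natr1; field.
  have -> : (n.+3%:R * d - n.+1%:R * d) / 2 = d by rewrite -!natr1; field.
  by rewrite ler_wpM2l ?sin_le ?(ltW d_gt0)// mulr_ge0// ltW.
have PhiE : Phi n = Phi n.+2 + (cos (n.+1%:R * d) - cos (n.+3%:R * d)) / d - 2 * d.
  by rewrite /Phi Ln2 natrD; ring.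
rewrite -[leRHS]mulrA ler_wpM2l ?(ltW sL0)// -expRD ler_expR -mulrDr ler_wpM2l//; lra.
Qed.

End flux_growth.

Section cis.
Variable R : realType.
Implicit Types x y : R.

Definition cis x : R[i] := cos x +i* sin x.

Lemma cisD x y : cis (x + y) = cis x * cis y.
Proof. by rewrite /cis cosD sinD; apply/eqP; rewrite eq_complex /= eqxx addrC /=. Qed.

Lemma cis0 : cis 0 = 1.
Proof. by rewrite /cis cos0 sin0. Qed.

Lemma cmod_cis x : cmod (cis x) = 1.
Proof. by rewrite cmodE /cis /= cos2Dsin2 sqrtr1. Qed.

Lemma cisN x : cis (- x) = (cis x)^*.
Proof. by rewrite /cis cosN sinN. Qed.

Lemma conjc_mulr (a : R) (z : R[i]) : (z * a%:C)^* = z^* * a%:C.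
Proof. by case: z => u v /=; apply/eqP; rewrite eq_complex /=; apply/andP; split; apply/eqP; ring. Qed.

Lemma cis_addN x : cis x + cis (- x) = (2 * cos x)%:C.
Proof.
by rewrite /cis cosN sinN; apply/eqP; rewrite eq_complex /= subrr eqxx andbT; apply/eqP; ring.
Qed.

Lemma cis_subN x : cis x - cis (- x) = 0 +i* (2 * sin x).
Proof.
by rewrite /cis cosN sinN; apply/eqP; rewrite eq_complex /= subrr eqxx /=; apply/eqP; ring.
Qed.

End cis.

(** * Moments and their recurrence *)

Section moments.
Variables (R : realType) (d : R) (P : nat -> R).

(* A trigonometric polynomial of degree 1 whose coefficients have absolute values summing up to 1;
   this keeps the powers of [weight] under control in terms of the moments. *)
Definition weight (k : nat) : R := (1 - sin (k.+1%:R * d)) / 2.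

(** The index [t] may be negative because multiplication by [weight] involves both neighbours
    [t + 1] and [t - 1]. *)
Definition moment (k0 k1 j : nat) (t : int) : R[i] :=
  \sum_(k0 <= k < k1) (P k * weight k ^+ j)%:C * cis (t%:~R * (k.+1%:R * d)).

Lemma moment_weightS k0 k1 j t : moment k0 k1 j.+1 t =
  2^-1 * moment k0 k1 j t +
  (0 +i* 4^-1) * (moment k0 k1 j (t + 1) - moment k0 k1 j (t - 1)).
Proof.
rewrite /moment -sumrB !mulr_sumr -big_split /=; apply: eq_bigr => k _.
set x := k.+1%:R * d.
have -> : (t + 1)%:~R * x = t%:~R * x + x by rewrite intrD mulrDl mul1r.
have -> : (t - 1)%:~R * x = t%:~R * x - x by rewrite intrD mulrDl mulrNz mulN1r.
rewrite !cisD exprSr mulrA rmorphM /=.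
set c := (P k * weight k ^+ j)%:C; set u := cis _.
have -> : (weight k)%:C = 2^-1 + (0 +i* 4^-1) * (cis x - cis (- x)) :> R[i].
  rewrite cis_subN -/x; apply/eqP; rewrite eq_complex /=.
  by rewrite /weight -/x; apply/andP; split; apply/eqP; field.
by ring.
Qed.

Lemma moment0 k0 k1 j : moment k0 k1 j 0 = (\sum_(k0 <= k < k1) P k * weight k ^+ j)%:C.
Proof.
by rewrite /moment rmorph_sum; apply: eq_bigr => k _; rewrite mul0r cis0 mulr1.
Qed.

Lemma momentN k0 k1 j t : moment k0 k1 j (- t) = (moment k0 k1 j t)^*.
Proof.
apply: (big_ind2 (fun u v : R[i] => u = v^*)) => [|u1 v1 u2 v2 -> ->|k _].
- by apply/eqP; rewrite eq_complex /= oppr0 !eqxx.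
- by rewrite rmorphD.
- by rewrite mulrNz mulNr cisN ![_%:C * _]mulrC conjc_mulr.
Qed.

Lemma cmod_moment k0 k1 t : cmod (moment k0 k1 0 t) <= \sum_(k0 <= k < k1) `|P k|.
Proof.
apply: (le_trans (cmod_sum _ _ _)); apply: ler_sum => k _.
by rewrite cmodM cmod_cis mulr1 expr0 mulr1 cmod_real.
Qed.

Variable Y : R.
Hypothesis PE : forall k, P k.+1 = (Y - 2 * cos (k.+1%:R * d)) * P k.

Definition moment_coef (n : nat) : R[i] := Y%:C - cis (- (n%:R * d)).

Definition moment_source (k0 k1 n : nat) : R[i] :=
  cis (- (n%:R * d)) * ((P k0)%:C * cis (n%:R * (k0.+1%:R * d))
                      - (P k1)%:C * cis (n%:R * (k1.+1%:R * d))).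

Lemma Im_moment_coef n : Im (moment_coef n) = sin (n%:R * d).
Proof. by rewrite /moment_coef /cis /= sinN opprK add0r. Qed.

Lemma cmod_moment_source k0 k1 n : cmod (moment_source k0 k1 n) <= `|P k0| + `|P k1|.
Proof.
by rewrite cmodM cmod_cis mul1r (le_trans (cmodB _ _))// !cmodM !cmod_cis !mulr1 !cmod_real.
Qed.

(** For [x = (k+1) d], the factor [2 cos x = e^(ix) + e^(-ix)] shifts the moment index both ways.
    Replacing [P k] by [P k.+1] is a shift of the summation index, that is a factor [e^(-i (n+1) d)]
    up to the two end terms, collected in [moment_source]. *)
Lemma moment_rec k0 k1 (n : nat) : (k0 <= k1)%N ->
  moment k0 k1 0 n%:Z = moment_coef n.+1 * moment k0 k1 0 n.+1%:Z
    - moment k0 k1 0 n.+2%:Z + moment_source k0 k1 n.+1.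
Proof.
elim: k1 => [|k1 IH].
  by rewrite leqn0 => /eqP ->; rewrite /moment !big_geq// /moment_source subrr !mulr0 subrr addr0.
rewrite leq_eqVlt => /predU1P[->|].
  by rewrite /moment !big_geq// /moment_source subrr !mulr0 subrr addr0.
rewrite ltnS => k01; have := IH k01; rewrite /moment !big_nat_recr//=.
set A := \sum_(_ <= _ < _) _; set B := \sum_(_ <= _ < _) _; set C := \sum_(_ <= _ < _) _ => ->.
rewrite /moment_source !expr0 !mulr1 (PE k1) /moment_coef -!pmulrn.
set x := k1.+1%:R * d.
have e1 : n%:R * x = n.+1%:R * x - x by rewrite -natr1; ring.
have e2 : n.+2%:R * x = n.+1%:R * x + x by rewrite -[n.+2%:R]natr1; ring.
have e3 : n.+1%:R * (k1.+2%:R * d) = n.+1%:R * x + n.+1%:R * d.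
  by rewrite /x -[k1.+2%:R]natr1; ring.
rewrite e1 e2 e3 !cisD.
have h : (2 * cos x)%:C = cis x + cis (- x) by rewrite cis_addN.
have h2 : cis (- (n.+1%:R * d)) * cis (n.+1%:R * d) = 1 by rewrite -cisD addNr cis0.
rewrite !rmorphM rmorphB /= h.
set g := cis (- (n.+1%:R * d)) in h2 *; set g' := cis (n.+1%:R * d) in h2 *.
rewrite !mulrBr; set u := cis (n.+1%:R * x); set p := (P k1)%:C.
have -> : g * ((Y%:C - (cis x + cis (- x))) * p * (u * g')) =
   (g * g') * ((Y%:C - (cis x + cis (- x))) * p * u) by ring.
by rewrite h2; ring.
Qed.

End moments.

(** * From proportional moments to the cancellation inequality *)

Section cancellation.
Variables (R : realType) (d Y rho : R) (P : nat -> R) (L m k1 k2 : nat).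
Hypothesis PE : forall k, P k.+1 = (Y - 2 * cos (k.+1%:R * d)) * P k.
Hypothesis d_gt0 : 0 < d.
Hypothesis L_pi : L%:R * d < pi.
Hypothesis rho_gt0 : 0 < rho.
Hypothesis sin_rho : forall n, (n < L)%N -> rho^-1 <= sin (n.+1%:R * d).
Hypothesis mL : (0 < m <= L)%N.
Hypothesis k12 : (k1 <= k2)%N.

Let y := moment_coef d Y.
Let yE n : Im (y n) = sin (n%:R * d). Proof. exact: Im_moment_coef. Qed.
Let T j := \sum_(0 <= k < k1) P k * weight d k ^+ j.
Let M j := \sum_(k1 <= k < k2) P k * weight d k ^+ j.
Let kappa := rho * expR (- (17 / 40) * ((cos (m%:R * d) - cos (L%:R * d)) / d - 5)).
Let AT := \sum_(0 <= k < k1) `|P k|.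
Let AM := \sum_(k1 <= k < k2) `|P k|.
Let eT := `|P 0| + `|P k1|.
Let eM := `|P k1| + `|P k2|.
Let K := L%:R * (`|M 0%N| * (AT * kappa + eT * L%:R * rho)
               + `|T 0%N| * (AM * kappa + eM * L%:R * rho)).

(** [17/40] is half of [17/20] because of the square root. The [5] collects the [1] of [flux_growth]
    and its term [(L - m.-1) d <= pi <= 4]. The full factor [rho] in [kappa] comes from
    [sin (L d) >= rho^-1] there. *)
Let kappa_ge : Num.sqrt (rho / flux L y m.-1) <= kappa.
Proof.
have m1 : (m.-1 < L)%N by lia.
have mE : m = m.-1.+1 by lia.
have := flux_growth d_gt0 yE L_pi m1; rewrite -mE => h.
have k0 : 0 < kappa by rewrite mulr_gt0// expR_gt0.
rewrite -[leRHS](gtr0_norm k0) -sqrtr_sqr ler_wsqrtr//.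
have yim n : (n < L)%N -> 0 < Im (y n.+1).
  by move=> nL; rewrite yE; apply: lt_le_trans (sin_rho nL); rewrite invr_gt0.
have f0 : 0 < flux L y m.-1 by exact: flux_gt0.
rewrite ler_pdivrMr// /kappa exprMn -expRM_natr.
set X := (_ - _) / d in h *.
have hX : rho^-1 * expR (17 / 20 * (X - 5)) <= flux L y m.-1.
  apply: le_trans h; rewrite ler_pM ?invr_ge0 ?expR_ge0 ?(ltW rho_gt0)//.
    by have := sin_rho (n := L.-1); rewrite prednK; [apply; lia|lia].
  rewrite ler_expR ler_wpM2l//.
  have : (L - m.-1)%:R * d <= 4.
    apply: le_trans (_ : pi <= 4); last first.
      by have := @pihalf_02_cos_pihalf R; move=> [/andP[_ ?] _]; lra.
    apply: le_trans (ltW L_pi); rewrite ler_wpM2r ?(ltW d_gt0)// ler_nat.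
    exact: leq_subr.
  lra.
have e0 := expR_gt0 (- (17 / 40) * (X - 5) * 2%:R).
apply: (@le_trans _ _ (rho ^+ 2 * expR (- (17 / 40) * (X - 5) * 2%:R)
   * (rho^-1 * expR (17 / 20 * (X - 5))))).
  rewrite (_ : _ * (rho^-1 * _) = rho * (expR (- (17 / 40) * (X - 5) * 2%:R)
     * expR (17 / 20 * (X - 5)))); last by field; rewrite gt_eqF.
  rewrite -expRD; set w := _ + _; have -> : w = 0 by rewrite /w; field.
  by rewrite expR0 mulr1.
by rewrite ler_wpM2l// mulr_ge0// ?sqr_ge0// ltW.
Qed.

(* Vanishes when the moments of the two blocks are proportional. *)
Let X j t := moment d P 0 k1 j t * (M 0%N)%:C - moment d P k1 k2 j t * (T 0%N)%:C.

Let X0_le n : (n <= m)%N -> cmod (X 0 n%:Z) <= K.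
Proof.
move=> nm.
have yim n' : (n' < L)%N -> 0 < Im (y n'.+1).
  by move=> nL; rewrite yE; apply: lt_le_trans (sin_rho nL); rewrite invr_gt0.
have yrho n' : (n' < L)%N -> rho^-1 <= Im (y n'.+1) by move=> nL; rewrite yE sin_rho.
have := @nearly_proportional _ L y yim rho rho_gt0 yrho
  (fun n => moment d P 0 k1 0 n%:Z) (moment_source d P 0 k1)
  (fun n => moment d P k1 k2 0 n%:Z) (moment_source d P k1 k2) AT eT AM eM m n
  (fun n' _ => moment_rec PE n' (leq0n k1)) (fun n' _ => cmod_moment_source d P 0 k1 n'.+1)
  (cmod_moment _ _ _ _ _) (addr_ge0 (normr_ge0 _) (normr_ge0 _))
  (fun n' _ => moment_rec PE n' k12) (fun n' _ => cmod_moment_source d P k1 k2 n'.+1)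
  (cmod_moment _ _ _ _ _) (addr_ge0 (normr_ge0 _) (normr_ge0 _)) mL nm.
rewrite !moment0 !cmod_real -/(T 0) -/(M 0) => h.
have AT0 : 0 <= AT by apply: sumr_ge0 => *.
have AM0 : 0 <= AM by apply: sumr_ge0 => *.
apply: (le_trans h); rewrite ler_wpM2l// lerD//; rewrite ler_wpM2l// lerD2r ler_wpM2l//; exact: kappa_ge.
Qed.

(** Each power of the weight shortens the range of moment indices by one. The bound [K] is not
    amplified, because the coefficients in [moment_weightS] have absolute values
    [1/2 + 1/4 + 1/4 = 1]. Negative indices reduce to positive ones by conjugation. *)
Let X_le j t : (j <= m)%N -> `|t| <= (m - j)%:Z -> cmod (X j t) <= K.
Proof.
elim: j t => [|j IH] t.
  rewrite subn0 => _ tm; have [n [tn nm]] : exists n : nat, (t = n%:Z \/ t = - n%:Z) /\ (n <= m)%N.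
    by exists `|t|%N; split; lia.
  case: tn => ->; first exact: X0_le.
  suff -> : X 0 (- n%:Z) = (X 0 n)^* by rewrite cmodJ X0_le.
  by rewrite /X !momentN rmorphB /= !conjc_mulr.
move=> jm tm.
have h u : `|u - t| <= 1 -> cmod (X j u) <= K by move=> ut; apply: IH; lia.
have -> : X j.+1 t = 2^-1 * X j t + (0 +i* 4^-1) * (X j (t + 1) - X j (t - 1)).
  by rewrite /X !moment_weightS; ring.
apply: (le_trans (cmodD _ _)); rewrite !cmodM.
have -> : cmod (2^-1 : R[i]) = 2^-1.
  by rewrite cmodV (_ : 2 = 2%:C) ?cmod_real ?ger0_norm// rmorph_nat.
have -> : cmod (0 +i* 4^-1 : R[i]) = 4^-1.
  by rewrite cmodE /= expr0n add0r sqrtr_sqr ger0_norm.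
have := cmodB (X j (t + 1)) (X j (t - 1)).
have := h t; have := h (t + 1); have := h (t - 1).
rewrite subrr normr0 => /(_ ltac:(lia)) h1 /(_ ltac:(lia)) h2 /(_ ltac:(lia)) h3 h4.
lra.
Qed.

(** At [j = m], [t = 0] the combination [X] is [T m * M 0 - M m * T 0]. The inequality bounds [T 0]
    once the weight makes [T m] small and leaves [M m] large. *)
Lemma alternating_cancellation : `|T 0%N| * M m <= `|M 0%N| * `|T m| + K.
Proof.
have := X_le (leqnn m) (t := 0); rewrite subnn normr0 => /(_ isT).
rewrite /X !moment0 -!rmorphM -rmorphB /= cmod_real -/(T m) -/(M m) => h.
have : `|M m * T 0%N| <= `|T m * M 0%N| + K.
  rewrite -[X in `|X|](subrK (T m * M 0%N)) addrC (le_trans (ler_normD _ _))// lerD2l.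
  by rewrite distrC.
rewrite !normrM (mulrC `|T m|) => h'; apply: le_trans h'.
by rewrite mulrC ler_wpM2r// ler_norm.
Qed.

End cancellation.

(** * Taylor bounds *)

Section taylor.
Variable R : realType.
Implicit Types (x : R) (n : nat).

Definition cos_sum n x : R := \sum_(k < n) (-1) ^+ k * x ^+ k.*2 / (k.*2)`!%:R.
Definition sin_sum n x : R := \sum_(k < n) (-1) ^+ k * x ^+ k.*2.+1 / (k.*2.+1)`!%:R.
Definition exp_sum n x : R := \sum_(k < n) x ^+ k / k`!%:R.

Lemma cos_sumS n x :
  cos_sum n.+1 x = cos_sum n x + (-1) ^+ n * x ^+ n.*2 / (n.*2)`!%:R.
Proof. by rewrite /cos_sum big_ord_recr. Qed.

Lemma sin_sumS n x :
  sin_sum n.+1 x = sin_sum n x + (-1) ^+ n * x ^+ n.*2.+1 / (n.*2.+1)`!%:R.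
Proof. by rewrite /sin_sum big_ord_recr. Qed.

Lemma exp_sumS n x : exp_sum n.+1 x = exp_sum n x + x ^+ n / n`!%:R.
Proof. by rewrite /exp_sum big_ord_recr. Qed.

Lemma cos_sum1 x : cos_sum 1 x = 1.
Proof. by rewrite cos_sumS /cos_sum big_ord0 expr0 fact0 divr1 mulr1 add0r. Qed.

Let fact_neq0 n : n`!%:R != 0 :> R.
Proof. by rewrite pnatr_eq0 -lt0n fact_gt0. Qed.

Lemma is_derive_sin_sum n x : is_derive x 1 (sin_sum n) (cos_sum n x).
Proof.
elim: n => [|n IH].
  rewrite /cos_sum big_ord0 (_ : sin_sum 0 = fun=> 0); first exact: is_derive1_cst.
  by apply/funext => t; rewrite /sin_sum big_ord0.
rewrite (_ : sin_sum n.+1 = fun t => sin_sum n t + (-1) ^+ n * t ^+ n.*2.+1 / (n.*2.+1)`!%:R);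
  last by apply/funext => t; rewrite sin_sumS.
rewrite cos_sumS; apply: is_derive1_add => //.
eapply is_derive1_eq; first by der.
rewrite /= factS natrM; field.
by rewrite fact_neq0 /= nat1r pnatr_eq0.
Qed.

Lemma is_derive_cos_sum n x : is_derive x 1 (cos_sum n.+1) (- sin_sum n x).
Proof.
elim: n => [|n IH].
  rewrite /sin_sum big_ord0 oppr0 (_ : cos_sum 1 = fun=> 1); first exact: is_derive1_cst.
  by apply/funext => t; rewrite cos_sum1.
rewrite (_ : cos_sum n.+2 = fun t => cos_sum n.+1 t + (-1) ^+ n.+1 * t ^+ n.+1.*2 / (n.+1.*2)`!%:R);
  last by apply/funext => t; rewrite [LHS]cos_sumS.
rewrite sin_sumS opprD; apply: is_derive1_add => //.
eapply is_derive1_eq; first by der.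
rewrite doubleS /= factS natrM [(-1) ^+ n.+1]exprS; field.
have h : 0 <= n.*2%:R :> R by [].
rewrite fact_neq0 /= -natr1; apply: lt0r_neq0; lra.
Qed.

Lemma is_derive_exp_sum n x : is_derive x 1 (exp_sum n.+1) (exp_sum n x).
Proof.
elim: n => [|n IH].
  rewrite /exp_sum big_ord0 (_ : (fun t => _) = fun=> 1); first exact: is_derive1_cst.
  by apply/funext => t; rewrite big_ord_recr big_ord0 /= expr0 fact0 divr1 add0r.
rewrite (_ : exp_sum n.+2 = fun t => exp_sum n.+1 t + t ^+ n.+1 / (n.+1)`!%:R);
  last by apply/funext => t; rewrite [LHS]exp_sumS.
rewrite exp_sumS; apply: is_derive1_add => //.
eapply is_derive1_eq; first by der.
rewrite /= factS natrM; field.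
by rewrite fact_neq0 /= nat1r pnatr_eq0.
Qed.

Lemma sin_sum0 n : sin_sum n 0 = 0.
Proof. by rewrite /sin_sum big1// => k _; rewrite expr0n mulr0 mul0r. Qed.

Lemma cos_sum0 n : cos_sum n.+1 0 = 1.
Proof.
by elim: n => [|n IH]; rewrite ?cos_sum1// cos_sumS IH doubleS expr0n mulr0 mul0r addr0.
Qed.

Lemma exp_sum0 n : exp_sum n.+1 0 = 1.
Proof.
elim: n => [|n IH]; last by rewrite exp_sumS IH expr0n mul0r addr0.
by rewrite exp_sumS /exp_sum big_ord0 expr0 fact0 divr1 add0r.
Qed.

(* The partial sums alternate around the limit: integrate from the previous case. *)
Lemma taylor_alternating n x : 0 <= x ->
  0 <= (-1) ^+ n * (cos_sum n.+1 x - cos x) /\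
  0 <= (-1) ^+ n * (sin_sum n.+1 x - sin x).
Proof.
have sgn (f g f' g' : R -> R) (m : nat) (y : R) : 0 <= y ->
    (forall t : R, is_derive t 1 f (f' t)) -> (forall t : R, is_derive t 1 g (g' t)) ->
    f 0 = g 0 -> (forall t, 0 <= t -> 0 <= (-1) ^+ m * (f' t - g' t)) ->
    0 <= (-1) ^+ m * (f y - g y).
  move=> y0 hf hg fg0 h.
  have hd t : 0 <= t <= y ->
      is_derive t 1 (fun t => (-1) ^+ m * (f t + - g t)) ((-1) ^+ m * (f' t - g' t)).
    move=> _; have := is_derive1_mul (is_derive1_cst ((-1) ^+ m) t)
      (is_derive1_add (hf t) (is_derive1_opp (hg t))).
    by rewrite mul0r add0r.
  have := derive_ge0_le y0 hd (fun t ht => h t (proj1 (andP ht))).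
  by rewrite fg0 subrr mulr0.
elim: n x => [|n IH] x x0.
  have h t : 0 <= t -> 0 <= (-1) ^+ 0 * (cos_sum 1 t - cos t).
    by move=> _; rewrite expr0 mul1r cos_sum1 subr_ge0 cos_le1.
  split; first exact: h.
  apply: (sgn _ _ (cos_sum 1) cos) => //; first exact: is_derive_sin_sum.
  by rewrite sin_sum0 sin0.
have h t : 0 <= t -> 0 <= (-1) ^+ n.+1 * (cos_sum n.+2 t - cos t).
  move=> t0; apply: (sgn _ _ (fun t => - sin_sum n.+1 t) (fun t => - sin t)) => //.
  - exact: is_derive_cos_sum.
  - by rewrite cos_sum0 cos0.
  - move=> u u0; have [_] := IH u u0.
    by rewrite exprS mulN1r mulNr -mulrN opprB opprK addrC.
split; first exact: h.
apply: (sgn _ _ (cos_sum n.+2) cos) => //; first exact: is_derive_sin_sum.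
by rewrite sin_sum0 sin0.
Qed.

Lemma exp_sum_le n x : 0 <= x -> exp_sum n x <= expR x.
Proof.
elim: n x => [|n IH] x x0; first by rewrite /exp_sum big_ord0 expR_ge0.
have := @derive_le _ (exp_sum n.+1) expR (exp_sum n) expR 0 x x0
  (fun t _ => is_derive_exp_sum n t) (fun t _ => is_derive_expR t)
  (fun t ht => IH t (proj1 (andP ht))).
by rewrite exp_sum0 expR0; lra.
Qed.

(** In the derivative of [exp_sum n.+1 t * expR (- t)] only the last term of the sum survives,
    multiplied by an exponential that is at most [1]. *)
Lemma exp_sum_ge n x : 0 <= x -> 1 - x ^+ n.+1 / (n.+1)`!%:R <= exp_sum n.+1 x * expR (- x).
Proof.
move=> x0.
have := @derive_le _ (fun t => - (t ^+ n.+1 / (n.+1)`!%:R))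
  (fun t => exp_sum n.+1 t * expR (- t))
  (fun t => - (t ^+ n / n`!%:R)) (fun t => - (t ^+ n / n`!%:R) * expR (- t)) 0 x x0.
rewrite exp_sum0 oppr0 expR0 mulr1 expr0n /= mul0r oppr0 subr0.
move=> h; suff : - (x ^+ n.+1 / (n.+1)`!%:R) <= exp_sum n.+1 x * expR (- x) - 1 by lra.
apply: h.
- move=> t _; eapply is_derive1_eq; first by der.
  by rewrite /= factS natrM; field; rewrite fact_neq0 /= nat1r pnatr_eq0.
- move=> t _; have hE : is_derive t 1 (fun t => expR (- t)) (- expR (- t)).
    by eapply is_derive1_eq; [der|rewrite mulrN1].
  eapply is_derive1_eq.
    by apply: (is_derive1_mul (is_derive_exp_sum n t) hE).
  by rewrite exp_sumS; ring.
- move=> t /andP[t0 _]; rewrite mulNr lerN2 ler_piMr//.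
    by rewrite divr_ge0 ?exprn_ge0.
  by rewrite -expR0 ler_expR oppr_le0.
Qed.

Lemma sin_ge_cubic x : 0 <= x -> x - x ^+ 3 / 6 <= sin x.
Proof.
move=> x0; have [_] := taylor_alternating 1 x0.
have -> : sin_sum 2 x = x - x ^+ 3 / 6.
  by rewrite /sin_sum !big_ord_recr big_ord0 /= !factS fact0 !natrM; field.
by rewrite expr1; lra.
Qed.

Lemma cos_le_quartic x : cos x <= 1 - x ^+ 2 / 2 + x ^+ 4 / 24.
Proof.
wlog x0 : x / 0 <= x => [h|].
  have [/h//|/ltW x0] := leP 0 x; have := h (- x).
  by rewrite cosN !(exprNn x) /= -signr_odd expr0 -[in (-1) ^+ 4]signr_odd expr0 !mul1r; apply; lra.
have [+ _] := taylor_alternating 2 x0.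
have -> : cos_sum 3 x = 1 - x ^+ 2 / 2 + x ^+ 4 / 24.
  by rewrite /cos_sum !big_ord_recr big_ord0 /= !factS fact0 !natrM; field.
by rewrite expr2 mulrNN !mul1r; lra.
Qed.

Lemma cos_ge_quadratic x : 1 - x ^+ 2 / 2 <= cos x.
Proof.
wlog x0 : x / 0 <= x => [h|].
  have [/h//|/ltW x0] := leP 0 x; have := h (- x).
  by rewrite cosN sqrrN; apply; lra.
have [+ _] := taylor_alternating 1 x0.
have -> : cos_sum 2 x = 1 - x ^+ 2 / 2.
  by rewrite /cos_sum !big_ord_recr big_ord0 /= !factS fact0 !natrM; field.
by rewrite expr1; lra.
Qed.

End taylor.

Section pi_bounds.
Variable R : realType.

Lemma pi_gt_314 : 314 / 100 < pi :> R.
Proof.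
have h : 0 < cos (157 / 100 : R).
  have [+ _] := @taylor_alternating R 5 (157 / 100) ltac:(lra).
  rewrite /cos_sum !big_ord_recr big_ord0 /= !factS fact0 !natrM; lra.
rewrite ltNge; apply/negP => hpi.
have : cos (157 / 100 : R) <= cos (pi / 2).
  rewrite leNgt ltr_cos ?in_itv/=.
  - by rewrite -leNgt; lra.
  - by have := pi_ge2 R => ?; apply/andP; split; lra.
  - by have := pi_ge2 R => ?; apply/andP; split; lra.
by rewrite cos_pihalf; lra.
Qed.

Lemma pi_lt_315 : pi < 315 / 100 :> R.
Proof.
have h : cos (1575 / 1000 : R) < 0.
  have [+ _] := @taylor_alternating R 4 (1575 / 1000) ltac:(lra).
  rewrite /cos_sum !big_ord_recr big_ord0 /= !factS fact0 !natrM; lra.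
rewrite ltNge; apply/negP => hpi.
have : 0 <= cos (1575 / 1000 : R).
  by apply: cos_ge0_pihalf; have := pi_ge2 R; lra.
lra.
Qed.

End pi_bounds.

(** * The Lobachevsky function *)

Section log_sine.
Variable R : realType.
Local Notation mu := (@lebesgue_measure R).

(* The dominating function [1 / sqrt t], in a form whose measurability is immediate. *)
Definition invsqrt (t : R) : R := expR (- (ln t / 2)).

Lemma measurable_invsqrt (D : set R) : measurable_fun D invsqrt.
Proof.
apply: measurable_funTS.
have h : measurable_fun [set: R] (fun t : R => - (ln t / 2)).
  by apply: measurable_funN; apply: measurable_funM => //; exact: measurable_ln.
exact: (measurableT_comp (@measurable_expR R) h).
Qed.

Lemma is_derive_invsqrt (x : R) : 0 < x ->
  is_derive x 1 (fun t => 2 * expR (ln t / 2)) (invsqrt x).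
Proof.
move=> x0.
apply: is_derive1_eq (is_derive1_mul (is_derive1_cst 2 x)
  (is_derive1_expR (is_derive1_mul (is_derive1_ln x0) (is_derive1_cst 2^-1 x)))) _.
rewrite mul0r add0r mulr0 addr0 /invsqrt expRN.
have e2 : expR (ln x / 2) * expR (ln x / 2) = x.
  by rewrite -expRD -splitr lnK.
rewrite -[in x^-1]e2; field; exact: lt0r_neq0 (expR_gt0 _).
Qed.

(** The integrand is singular at [0]: the intervals [[b / (n+1), b]] exhaust []0, b]], and on each
    of them the primitive [2 sqrt t] bounds the integral by [2 sqrt b]. *)
Lemma integrable_invsqrt (b : R) : 0 < b -> mu.-integrable `[0, b] (EFin \o invsqrt).
Proof.
move=> b0; apply/integrableP; split.
  by apply/measurable_EFinP; exact: measurable_invsqrt.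
have g0 (t : R) : 0 <= invsqrt t by exact: expR_ge0.
under eq_integral do rewrite /= ger0_norm//.
rewrite -integral_itv_obnd_cbnd; last first.
  by apply/measurable_EFinP; exact: measurable_invsqrt.
pose F (n : nat) : set (measurableTypeR R) := `[b / n.+1%:R, b]%classic.
have FE : `]0, b]%classic = \bigcup_n F n.
  apply/seteqP; split => x /=.
    rewrite in_itv /= => /andP[x0 xb].
    have [n nx] : exists n : nat, b / x <= n.+1%:R.
      by exists (Num.truncn (b / x)); apply: ltW; apply: truncnS_gt.
    exists n => //=; rewrite /F /= in_itv /= xb andbT ler_pdivrMr ?ltr0n//.
    by rewrite mulrC -ler_pdivrMr.
  move=> [n _]; rewrite /F /= !in_itv /= => /andP[bx ->]; rewrite andbT.
  by apply: lt_le_trans bx; rewrite divr_gt0// ltr0n.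
rewrite FE.
have nd : nondecreasing_seq F.
  apply/nondecreasing_seqP => n; rewrite subsetEset => x.
  rewrite /F /= !in_itv /= => /andP[bx ->]; rewrite andbT; apply: le_trans bx.
  by rewrite ler_pM2l// lef_pV2 ?posrE ?ltr0n// ler_nat.
have mF i : measurable (F i) by exact: measurable_itv.
have mf i : measurable_fun (F i) (fun t : R => (invsqrt t)%:E).
  by apply/measurable_EFinP; exact: measurable_invsqrt.
have cv := @ge0_nondecreasing_set_cvg_integral _ (measurableTypeR R) R F
  (fun t : R => (invsqrt t)%:E) mu nd mF mf (fun i x _ => g0 x).
apply: (@le_lt_trans _ _ (2 * expR (ln b / 2))%:E); last exact: ltry.
apply: (cvge_le _ cv); near=> n.
have nb : b / n.+1%:R < b.
  have n0 : (0 < n)%N by near: n; exact: nbhs_infty_gt.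
  by rewrite ltr_pdivrMr ?ltr0n// -{1}[b]mulr1 ltr_pM2l// ltr1n ltnS.
have bn : 0 < b / n.+1%:R by rewrite divr_gt0// ltr0n.
have dF (x : R) : 0 < x -> derivable (fun t => 2 * expR (ln t / 2)) x 1.
  by move=> x0; have [] := is_derive_invsqrt x0.
have cF (x : R) : 0 < x -> {for x, continuous (fun t => 2 * expR (ln t / 2))}.
  by move=> x0; exact: is_derive1_continuous (is_derive_invsqrt x0).
rewrite (continuous_FTC2 nb (F := fun t => 2 * expR (ln t / 2))).
- by rewrite -EFinB lee_fin lerBlDr lerDl mulr_ge0// expR_ge0.
- apply: continuous_in_subspaceT => x; rewrite inE /= in_itv /= => /andP[bx _].
  have x0 := lt_le_trans bn bx.
  apply: (@is_derive1_continuous _ _ _ (expR (- (ln x / 2)) * - (x^-1 / 2))).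
  apply: is_derive1_eq (is_derive1_expR (is_derive1_opp
    (is_derive1_mul (is_derive1_ln x0) (is_derive1_cst 2^-1 x)))) _.
  by rewrite mulr0 addr0.
- split.
  + by move=> x; rewrite in_itv /= => /andP[bx _]; apply: dF; exact: lt_trans bx.
  + by apply: cvg_at_right_filter; exact: cF.
  + by apply: cvg_at_left_filter; exact: cF.
- move=> x; rewrite in_itv /= => /andP[bx _].
  by rewrite derive1E; have [_ ->] := is_derive_invsqrt (lt_trans bn bx).
Unshelve. all: by end_near. Qed.

Definition log_sine (u : R) : R := ln `|2 * sin u|.

Lemma measurable_log_sine (D : set R) : measurable_fun D log_sine.
Proof.
apply: measurable_funTS.
have h : measurable_fun [set: R] (fun t : R => 2 * sin t).
  by apply: measurable_funM => //; apply: continuous_measurable_fun; exact: continuous_sin.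
exact: (measurableT_comp (@measurable_ln R) (measurableT_comp (@normr_measurable R setT) h)).
Qed.

Lemma sin_ge_linear (b u : R) : b < pi -> 0 <= u <= b -> sin b / 4 * u <= sin u.
Proof.
move=> bpi /andP[u0 ub]; have pi315 := pi_lt_315 R; have pi314 := pi_gt_314 R.
have b0 : 0 <= b by exact: le_trans ub.
have sb0 : 0 <= sin b by apply: sin_ge0_pi; rewrite b0 ltW.
have sb1 := sin_le1 b.
have [u2|u2] := leP u (pi / 2).
  apply: le_trans (sin_ge_cubic u0).
  have : sin b * u <= u by rewrite ler_piMl.
  have : u * (u * u) <= u * 4.
    by rewrite ler_wpM2l// (_ : 4 = 2 * 2 :> R) ?ler_pM//; lra.
  by rewrite !exprS expr0 mulr1; lra.
have : sin b <= sin u.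
  rewrite -!cosBpihalf leNgt ltr_cos ?in_itv /= -?leNgt; first by rewrite lerD2r.
  - by apply/andP; split; lra.
  - by apply/andP; split; lra.
apply: le_trans; rewrite -mulrA ler_piMr//; lra.
Qed.

(** Dominated by [1 + 2 / sqrt (k u)]: [2 sin u >= k u] by [sin_ge_linear], and
    [- ln v <= 2 / sqrt v] follows from [exp x >= 1 + x]. *)
Lemma integrable_log_sine (b : R) : 0 < b < pi -> mu.-integrable `[0, b] (EFin \o log_sine).
Proof.
move=> /andP[b0 bpi].
have sb : 0 < sin b by apply: sin_gt0_pi; rewrite b0 bpi.
pose k := sin b / 2; have k0 : 0 < k by rewrite divr_gt0.
pose g (t : R) : R := 1 + 2 * invsqrt k * invsqrt t.
have intg : mu.-integrable `[0, b] (EFin \o g).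
  have i1 : mu.-integrable `[0, b] (EFin \o (fun=> 1 : R)).
    apply: measurable_bounded_integrable => //; last exact: bounded_cst.
    by rewrite /= lebesgue_measure_itv /=; case: ifP => _; rewrite ?ltry// -EFinB ltry.
  have mI : measurable (`[0, b]%classic : set (measurableTypeR R)) by exact: measurable_itv.
  have i2 := integrableZl mI (2 * invsqrt k) (integrable_invsqrt b0).
  exact: eq_integrable (integrableD mI i1 i2).
apply: le_integrable intg => //.
  by apply/measurable_EFinP; exact: measurable_log_sine.
move=> u /=; rewrite in_itv /= => /andP[u0 ub]; rewrite lee_fin.
have e0 (t : R) : 0 < invsqrt t by exact: expR_gt0.
have g0 : 0 <= g u by rewrite addr_ge0// !mulr_ge0// ltW.
rewrite (ger0_norm g0).
move: u0; rewrite le_eqVlt => /predU1P[<-|u0].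
  by rewrite /log_sine sin0 mulr0 normr0 ln0// normr0 addr_ge0// !mulr_ge0// ltW.
have su : sin b / 4 * u <= sin u by apply: sin_ge_linear => //; rewrite ub ltW.
have su0 : 0 < sin u by apply: sin_gt0_pi; rewrite u0 (le_lt_trans ub bpi).
rewrite /log_sine (ger0_norm (x := 2 * sin u)) ?mulr_ge0 ?(ltW su0)//.
have s2 : 0 < 2 * sin u by rewrite mulr_gt0.
rewrite ler_norml; apply/andP; split.
  have ku : 0 < k * u by rewrite mulr_gt0.
  apply: (@le_trans _ _ (ln (k * u))); last by rewrite ler_ln ?posrE// /k; lra.
  rewrite lerNl; apply: (@le_trans _ _ (2 * (invsqrt k * invsqrt u))).
    rewrite /invsqrt -expRD lnM ?posrE//.
    have := expR_ge1Dx (- (ln k / 2) + - (ln u / 2)); lra.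
  by rewrite /g mulrA lerDr.
have s1 := sin_le1 u; have := @le_ln1Dx R (2 * sin u - 1) ltac:(lra).
rewrite addrC subrK => h.
have : 0 <= 2 * invsqrt k * invsqrt u by rewrite !mulr_ge0// ltW.
rewrite /g; lra.
Qed.

Lemma lobachevskyE (t : R) : 0 <= t -> lobachevsky t = - \int[mu]_(u in `[0, t]) log_sine u.
Proof. by move=> t0; rewrite /lobachevsky t0. Qed.

Lemma lobachevsky0 : lobachevsky (0 : R) = 0.
Proof. by rewrite lobachevskyE// set_itv1 Rintegral_set1 oppr0. Qed.

(** Replaces the derivative at the endpoint [0], near which [log_sine] is unbounded. *)
Lemma lobachevsky_at0 (e : R) : 0 < e ->
  exists2 h : R, 0 < h & forall t, 0 < t < h -> `|lobachevsky t| <= e.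
Proof.
move=> e0; have p1 : (1 : R) < pi by have := pi_gt_314 R; lra.
have := parameterized_integral_cvg_left (ltr01 : 0 < 1 :> R) (integrable_log_sine (introT andP (conj ltr01 p1))).
move=> /cvgrPdist_le /(_ e e0) [h /= h0 hh]; exists h => // t /andP[t0 th].
have := hh t; rewrite /= !sub0r normrN gtr0_norm// => /(_ th).
by rewrite (lobachevskyE (ltW t0)) !normrN.
Qed.

Lemma is_derive_lobachevsky (t : R) : 0 < t < pi ->
  is_derive t 1 (@lobachevsky R) (- ln (2 * sin t)).
Proof.
move=> /andP[t0 tpi]; pose u := (t + pi) / 2.
have tu : t < u by rewrite /u; lra.
have u0 : 0 < u < pi by rewrite /u; lra.
have st : 0 < sin t by apply: sin_gt0_pi; rewrite t0.
have logE : \forall x \near t, ln (2 * sin x) = log_sine x.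
  near=> x; rewrite /log_sine ger0_norm// mulr_ge0// ltW//.
  apply: sin_gt0_pi; apply/andP; split.
    by near: x; exact: lt_nbhsr.
  by near: x; exact: lt_nbhsl.
have ct : {for t, continuous log_sine}.
  have h : is_derive t 1 (fun x => ln (2 * sin x)) ((2 * sin t)^-1 * (2 * cos t)).
    eapply is_derive1_eq.
      by eapply is_derive1_lnc; [der|rewrite mulr_gt0].
    by rewrite /=; ring.
  exact: is_derive1_continuous (near_eq_is_derive logE h).
have [dF F'] := continuous_FTC1_closed tu (integrable_log_sine u0) t0 ct.
have h : is_derive t 1 (fun x => \int[mu]_(u in `[0, x]) log_sine u) (ln (2 * sin t)).
  split; first exact: dF.
  by rewrite -derive1E F' /log_sine ger0_norm// mulr_ge0// ltW.
have lobE : \forall x \near t, - (\int[mu]_(u in `[0, x]) log_sine u) = lobachevsky x.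
  near=> x; rewrite lobachevskyE// ltW//; near: x; exact: lt_nbhsr.
exact: near_eq_is_derive lobE (is_derive1_opp h).
Unshelve. all: by end_near. Qed.

End log_sine.

Declare Scope binz_scope.
Delimit Scope binz_scope with binz.
Number Notation Z BinInt.Z.of_num_int BinInt.Z.to_num_int : binz_scope.
Notation "x + y" := (BinInt.Z.add x y) : binz_scope.
Notation "x - y" := (BinInt.Z.sub x y) : binz_scope.
Notation "x * y" := (BinInt.Z.mul x y) : binz_scope.
Notation "x / y" := (BinInt.Z.div x y) : binz_scope.
Notation "- x" := (BinInt.Z.opp x) : binz_scope.
Notation "x <= y" := (BinInt.Z.leb x y) : binz_scope.
Bind Scope binz_scope with Z.

(** * Certified values of the Lobachevsky function *)

Section integer_polynomials.
Variable R : realType.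
Implicit Types (x : R) (l : seq Z) (a b : Z).

(* Locked: unfolding [int_of_Z] yields unary integers. *)
Definition ZR : Z -> R := locked (fun z => (int_of_Z z)%:~R).

Lemma ZRE z : ZR z = (int_of_Z z)%:~R.
Proof. by rewrite /ZR -lock. Qed.

Lemma ZRD a b : ZR (a + b)%binz = ZR a + ZR b.
Proof. by rewrite !ZRE -rmorphD /=; congr (_%:~R); lia. Qed.

Lemma ZRM a b : ZR (a * b)%binz = ZR a * ZR b.
Proof. by rewrite !ZRE -rmorphM /=; congr (_%:~R); lia. Qed.

Lemma ZRN a : ZR (- a)%binz = - ZR a.
Proof. by rewrite !ZRE -rmorphN /=; congr (_%:~R); lia. Qed.

Lemma ZR_pos (p : positive) : 0 < ZR (Zpos p).
Proof. by rewrite ZRE ltr0z; lia. Qed.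

Lemma ZR_le a b : (a <= b)%binz -> ZR a <= ZR b.
Proof. by move=> h; rewrite !ZRE ler_int; lia. Qed.

Lemma ZR0 : ZR Z0 = 0. Proof. by rewrite ZRE. Qed.
Lemma ZR1 : ZR (Zpos xH) = 1. Proof. by rewrite ZRE. Qed.

Lemma ZR_nat n : ZR (BinInt.Z.of_nat n) = n%:R.
Proof. by rewrite ZRE pmulrn; congr (_%:~R); lia. Qed.

Lemma ZR_abs a : ZR (BinInt.Z.abs a) = `|ZR a|.
Proof.
case: a => [|p|p] /=; rewrite ?ZR0 ?normr0//; first by rewrite gtr0_norm ?ZR_pos.
by rewrite (ZRN (Zpos p)) normrN gtr0_norm ?ZR_pos.
Qed.

Lemma ZR_div a (q : positive) :
  ZR (a / Zpos q)%binz <= ZR a / ZR (Zpos q) < ZR (a / Zpos q)%binz + 1.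
Proof.
have q0 := ZR_pos q; rewrite ler_pdivlMr// ltr_pdivrMr//.
rewrite -ZR1 -ZRD -!ZRM !ZRE ler_int ltr_int.
have := BinInt.Z.div_mod a (Zpos q) ltac:(by []).
have := BinInt.Z.mod_pos_bound a (Zpos q) ltac:(by []).
move: (a / _)%binz (BinInt.Z.modulo a _) => u v h1 h2; apply/andP; split; lia.
Qed.

Lemma ZR_div_near a (q : positive) : `|ZR (a / Zpos q)%binz - ZR a / ZR (Zpos q)| <= 1.
Proof. by have /andP[h1 h2] := ZR_div a q; rewrite ler_norml; apply/andP; split; lra. Qed.

Definition zpow b (n : nat) : Z := iter n (BinInt.Z.mul b) (Zpos xH).

Lemma zpowE b n : ZR (zpow b n) = ZR b ^+ n.
Proof. by elim: n => [|n IH]; rewrite ?ZR1 ?expr0// /= ZRM IH exprS. Qed.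

Fixpoint pfact (n : nat) : positive :=
  if n is m.+1 then BinPos.Pos.mul (BinPos.Pos.of_succ_nat m) (pfact m) else xH.

Lemma pfactE n : ZR (Zpos (pfact n)) = n`!%:R.
Proof.
elim: n => [|n IH]; first by rewrite ZR1.
rewrite /= BinInt.Pos2Z.inj_mul ZRM IH factS natrM; congr (_ * _).
by rewrite Znat.Zpos_P_of_succ_nat -Znat.Nat2Z.inj_succ ZR_nat.
Qed.

Definition ev l x : R := foldr (fun c acc => ZR c + x * acc) 0 l.

Fixpoint padd (l l' : seq Z) : seq Z :=
  match l, l' with
  | [::], _ => l'
  | _, [::] => l
  | c :: l1, c' :: l1' => (c + c')%binz :: padd l1 l1'
  end.
Definition pscale b l : seq Z := map (BinInt.Z.mul b) l.
Fixpoint pmul (l l' : seq Z) : seq Z :=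
  if l is c :: l1 then padd (pscale c l') (Z0 :: pmul l1 l') else [::].
Fixpoint pderiv l : seq Z := if l is _ :: l' then padd l' (Z0 :: pderiv l') else [::].

Lemma paddE l l' x : ev (padd l l') x = ev l x + ev l' x.
Proof.
elim: l l' => [|c l IH] [|e l'] /=; rewrite ?addr0 ?add0r//.
by rewrite ZRD IH; ring.
Qed.

Lemma pscaleE b l x : ev (pscale b l) x = ZR b * ev l x.
Proof. by elim: l => [|e l IH] /=; rewrite ?mulr0// ZRM IH; ring. Qed.

Lemma pmulE l l' x : ev (pmul l l') x = ev l x * ev l' x.
Proof.
elim: l => [|c l IH] /=; first by rewrite mul0r.
by rewrite paddE pscaleE /= ZR0 IH; ring.
Qed.

Lemma is_derive_ev l x : is_derive x 1 (ev l) (ev (pderiv l) x).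
Proof.
elim: l => [|c l IH]; first exact: is_derive1_cst.
rewrite /pderiv -/pderiv paddE /= ZR0 add0r.
have h := is_derive1_add (is_derive1_cst (ZR c) x) (is_derive1_mul (is_derive1_id x) IH).
have e : 0 + (1 * ev l x + x * ev (pderiv l) x) = ev l x + x * ev (pderiv l) x by ring.
exact: is_derive1_eq h e.
Qed.

(* All arguments of [ev] below are at most [17/32]; errors made on the coefficients or
   on the products in Horner's scheme add up to at most [1 / (1 - 17/32) <= 3] times each of them. *)
Definition ev_ub l : Z :=
  foldr (fun c acc => BinInt.Z.abs c + (17 * acc / 32 + 1))%binz Z0 l.

Lemma ev_ubP l x : 0 <= x <= 17 / 32 -> `|ev l x| <= ZR (ev_ub l).
Proof.
move=> /andP[x0 x1]; elim: l => [|c l IH] /=; first by rewrite ZR0 normr0.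
rewrite !ZRD ZR_abs ZR1 (le_trans (ler_normD _ _))// lerD2l normrM (ger0_norm x0).
have /andP[_ h] := ZR_div (17 * ev_ub l)%binz (xO (xO (xO (xO (xO xH))))).
apply: le_trans (ltW h); rewrite ZRM (ZR_nat 17) (ZR_nat 32).
have -> : 17 * ZR (ev_ub l) / 32 = 17 / 32 * ZR (ev_ub l) by field.
by apply: ler_pM.
Qed.

(** Reals are represented by integers in units of [2^-64]. *)
Definition log_scale := 64%N.
Definition scale : positive := iter log_scale xO xH.

Definition ev_fix (v : Z) l : Z :=
  foldr (fun c acc => c + BinInt.Z.shiftr (v * acc) (BinInt.Z.of_nat log_scale))%binz Z0 l.

Lemma shiftr_scale a : BinInt.Z.shiftr a (BinInt.Z.of_nat log_scale) = (a / Zpos scale)%binz.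
Proof. by rewrite BinInt.Z.shiftr_div_pow2. Qed.

Local Notation sigma := (ZR (Zpos scale)).

Lemma ev_fixP (v : Z) l : 0 <= ZR v / sigma <= 17 / 32 ->
  `|ev l (ZR v / sigma) - ZR (ev_fix v l)| <= 3.
Proof.
set x := ZR v / sigma => /andP[x0 x1]; elim: l => [|c l IH] /=; first by rewrite ZR0 subrr normr0.
rewrite ZRD shiftr_scale; set f := ev_fix v l in IH *.
have := ZR_div_near (v * f)%binz scale; rewrite ZRM mulrAC -/x => h.
have -> : ZR c + x * ev l x - (ZR c + ZR (v * f / Zpos scale)%binz) =
  x * (ev l x - ZR f) - (ZR (v * f / Zpos scale)%binz - x * ZR f) by ring.
apply: le_trans (ler_normB _ _) _; rewrite normrM (ger0_norm x0).
have : x * `|ev l x - ZR f| <= 17 / 32 * 3 by apply: ler_pM.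
lra.
Qed.

Lemma ev_mkseqP (c : nat -> Z) (f : nat -> R) (s : R) n x : 0 <= x <= 17 / 32 ->
  (forall k, `|ZR (c k) - s * f k| <= 1) ->
  `|ev (mkseq c n) x - s * (\sum_(k < n) f k * x ^+ k)| <= 3.
Proof.
move=> /andP[x0 x1]; elim: n c f => [|n IH] c f H.
  by rewrite big_ord0 mulr0 subr0 normr0.
rewrite big_ord_recl /= expr0 mulr1 /mkseq /= (iotaDl 1 0) -map_comp.
have h := IH (c \o S) (f \o S) (fun k => H k.+1); rewrite /mkseq in h.
have -> : \sum_(i < n) f (bump 0 i) * x ^+ bump 0 i = x * \sum_(i < n) (f \o S) i * x ^+ i.
  by rewrite mulr_sumr; apply: eq_bigr => i _; rewrite /= exprS; ring.
move: h; set u := ev _ x; set w := \sum_(i < n) _ => h.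
have -> : ZR (c 0) + x * u - s * (f 0 + x * w) = (ZR (c 0) - s * f 0) + x * (u - s * w) by ring.
apply: le_trans (ler_normD _ _) _; rewrite normrM (ger0_norm x0).
have : x * `|u - s * w| <= 17 / 32 * 3 by apply: ler_pM.
by have := H 0; lra.
Qed.

(* Fixed point evaluation at [(a / t)^2 / q]. *)
Definition ev_sq (q t a : Z) l : Z :=
  ev_fix (a * a * Zpos scale / (q * (t * t)))%binz l.

(** [K] pays, through the mean value inequality, for rounding the argument down to a multiple of
    [1 / sigma]; [3] is the cost of Horner's scheme. *)
Lemma ev_sqP (q t : positive) a l (K x : R) : x = ZR a / ZR (Zpos t) ->
  x ^+ 2 / ZR (Zpos q) <= 17 / 32 -> ZR (ev_ub (pderiv l)) <= K * sigma ->
  `|ev l (x ^+ 2 / ZR (Zpos q)) - ZR (ev_sq (Zpos q) (Zpos t) a l)| <= 3 + K.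
Proof.
move=> xE; set y := x ^+ 2 / _ => y1 hK.
have s0 := ZR_pos scale; have q0 := ZR_pos q; have t0 := ZR_pos t.
have y0 : 0 <= y by rewrite divr_ge0 ?sqr_ge0// ltW.
rewrite /ev_sq; set v := (_ / _)%binz.
have /andP[v1 v2] := ZR_div (a * a * Zpos scale)%binz (BinPos.Pos.mul q (BinPos.Pos.mul t t)).
rewrite -[(_ / _)%binz]/v in v1 v2.
have e : ZR (a * a * Zpos scale)%binz / ZR (Zpos (BinPos.Pos.mul q (BinPos.Pos.mul t t))) = y * sigma.
  rewrite !BinInt.Pos2Z.inj_mul !ZRM /y xE; field.
  by rewrite (gt_eqF q0) (gt_eqF t0).
rewrite e in v1 v2.
have z1 : ZR v / sigma <= y by rewrite ler_pdivrMr.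
have z0 : 0 <= ZR v / sigma.
  rewrite divr_ge0 ?(ltW s0)// -ZR0; apply: ZR_le; apply/BinInt.Z.leb_le.
  apply: BinInt.Z.div_pos; last by [].
  by apply: BinInt.Z.mul_nonneg_nonneg => //; exact: BinInt.Z.square_nonneg.
have z2 : y - ZR v / sigma <= sigma^-1.
  have : y * sigma / sigma <= (ZR v + 1) / sigma by rewrite ler_pM2r ?invr_gt0 ?ltW.
  by rewrite mulfK ?gt_eqF// mulrDl mul1r; lra.
have h1 := ev_fixP l (introT andP (conj z0 (le_trans z1 y1))).
have h2 : `|ev l y - ev l (ZR v / sigma)| <= K.
  have bd u : ZR v / sigma <= u <= y -> `|ev (pderiv l) u| <= ZR (ev_ub (pderiv l)).
    by move=> /andP[u0 u1]; apply: ev_ubP; rewrite (le_trans z0 u0) (le_trans u1 y1).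
  apply: le_trans (derive_lipschitz z1 (fun t _ => is_derive_ev l t) bd) _.
  have b0 : 0 <= ZR (ev_ub (pderiv l)).
    by apply: le_trans (ev_ubP (pderiv l) (introT andP (conj z0 (le_trans z1 y1)))); exact: normr_ge0.
  apply: le_trans (ler_wpM2l b0 z2) _.
  by rewrite ler_pdivrMr.
have -> : ev l y - ZR (ev_fix v l) = (ev l y - ev l (ZR v / sigma)) + (ev l (ZR v / sigma) - ZR (ev_fix v l)) by ring.
apply: le_trans (ler_normD _ _) _; lra.
Qed.

End integer_polynomials.

(** * Certified power series for ln (sin u / u) and for the Lobachevsky function *)

Section series_numerics.
Variable R : realType.
Notation ZR := (@ZR R). Notation ev := (@ev R).
Local Notation S := (Zpos scale).
Local Notation sigma := (ZR S).

(** A mean value inequality from a one-sided limit at [0], for functions with a logarithm that is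
    singular there. *)
Lemma derive_bound_at0 (f df : R -> R) (f0 M a : R) : 0 < a ->
  (forall t, 0 < t <= a -> is_derive t 1 f (df t)) ->
  (forall t, 0 < t <= a -> `|df t| <= M) ->
  (forall e, 0 < e -> exists2 h, 0 < h & forall t, 0 < t < h -> `|f t - f0| <= e) ->
  `|f a - f0| <= M * a.
Proof.
move=> a0 fd fM f00; apply/ler_addgt0Pr => e e0.
have [h h0 hh] := f00 e e0.
have M0 : 0 <= M by apply: le_trans (fM a _) => //; rewrite a0 lexx.
pose t := Num.min (h / 2) (a / 2).
have t0 : 0 < t by rewrite lt_min !divr_gt0.
have th : t < h by rewrite gt_min; apply/orP; left; rewrite ltr_pdivrMr//; lra.
have ta : t <= a by rewrite ge_min; apply/orP; right; lra.
have h1 : `|f t - f0| <= e by apply: hh; rewrite t0.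
have h2 : `|f a - f t| <= M * (a - t).
  apply: (derive_lipschitz ta (df := df)) => x /andP[tx xa].
  - by apply: fd; rewrite xa (lt_le_trans t0).
  - by apply: fM; rewrite xa (lt_le_trans t0).
have -> : f a - f0 = (f a - f t) + (f t - f0) by ring.
apply: le_trans (ler_normD _ _) _; apply: lerD => //.
by apply: le_trans h2 _; rewrite ler_wpM2l// gerBl ltW.
Qed.

Lemma alternating_bound (n : nat) (x y q : R) : 0 <= q ->
  0 <= (-1) ^+ n * (x + (-1) ^+ n * q - y) -> (-1) ^+ n * (x - y) <= 0 -> `|x - y| <= q.
Proof.
move=> q0; rewrite -(signr_odd _ n); case: (odd n); rewrite ?expr1 ?expr0 ler_norml => h1 h2; lra.
Qed.

Lemma sin_sum_bound n (u : R) : 0 <= u -> `|sin_sum n u - sin u| <= u ^+ n.*2.+1 / (n.*2.+1)`!%:R.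
Proof.
case: n => [|n] u0.
  rewrite /sin_sum big_ord0 distrC divr1 expr1.
  by have := sin_lipschitz u 0; rewrite sin0 !subr0 (ger0_norm u0).
apply: (@alternating_bound n.+1); first by rewrite divr_ge0 ?exprn_ge0.
  by have [_] := taylor_alternating n.+1 u0; rewrite sin_sumS -mulrA.
by have [_] := taylor_alternating n u0; rewrite exprS mulN1r mulNr oppr_le0.
Qed.

Lemma cos_sum_bound n (u : R) : 0 <= u -> `|cos_sum n.+1 u - cos u| <= u ^+ n.+1.*2 / (n.+1.*2)`!%:R.
Proof.
move=> u0; apply: (@alternating_bound n.+1); first by rewrite divr_ge0 ?exprn_ge0.
  have [h _] := taylor_alternating n.+1 u0; rewrite cos_sumS -mulrA in h; exact: h.
have [h _] := taylor_alternating n u0.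
by rewrite exprS mulN1r mulNr oppr_le0.
Qed.

Definition zsign (k : nat) (b : Z) : Z := if odd k then BinInt.Z.opp b else b.

Lemma zsignE k b : ZR (zsign k b) = (-1) ^+ k * ZR b.
Proof.
rewrite /zsign -(signr_odd _ k); case: (odd k); first by rewrite expr1 mulN1r ZRN.
by rewrite expr0 mul1r.
Qed.

(* Power series of [sin u / u] and of [(cos u - sin u / u) / u ^ 2] in [v = u ^ 2 / 8]. *)
Definition sinc_coef k : R := (-1) ^+ k * 8 ^+ k / (k.*2.+1)`!%:R.
Definition dsinc_coef k : R := (-1) ^+ k.+1 * 8 ^+ k * k.*2.+2%:R / (k.*2.+3)`!%:R.
Definition sincz k : Z := (zsign k (S * zpow 8 k) / Zpos (pfact k.*2.+1))%binz.
Definition dsincz k : Z :=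
  (zsign k.+1 (S * zpow 8 k * BinInt.Z.of_nat k.*2.+2) / Zpos (pfact k.*2.+3))%binz.

Lemma sinczP k : `|ZR (sincz k) - sigma * sinc_coef k| <= 1.
Proof.
have h := ZR_div_near R (zsign k (S * zpow 8 k)%binz) (pfact k.*2.+1).
rewrite zsignE ZRM zpowE (ZR_nat R 8) pfactE in h.
by rewrite (_ : sigma * sinc_coef k = (-1) ^+ k * (sigma * 8 ^+ k) / (k.*2.+1)`!%:R) // /sinc_coef; ring.
Qed.

Lemma dsinczP k : `|ZR (dsincz k) - sigma * dsinc_coef k| <= 1.
Proof.
have h := ZR_div_near R (zsign k.+1 (S * zpow 8 k * BinInt.Z.of_nat k.*2.+2)%binz) (pfact k.*2.+3).
rewrite zsignE !ZRM zpowE (ZR_nat R 8) ZR_nat pfactE in h.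
rewrite (_ : sigma * dsinc_coef k =
  (-1) ^+ k.+1 * (sigma * 8 ^+ k * k.*2.+2%:R) / (k.*2.+3)`!%:R) // /dsinc_coef; ring.
Qed.

Lemma sinc_sumE n (u : R) : sin_sum n u = u * \sum_(k < n) sinc_coef k * (u ^+ 2 / 8) ^+ k.
Proof.
rewrite /sin_sum mulr_sumr; apply: eq_bigr => k _.
rewrite /sinc_coef expr_div_n exprS -muln2 mulnC exprM; field.
by rewrite expf_neq0 pnatr_eq0 // -lt0n fact_gt0.
Qed.

Lemma sinc_bound n (u : R) : 0 < u ->
  `|sin u / u - \sum_(k < n) sinc_coef k * (u ^+ 2 / 8) ^+ k| <= (u ^+ 2) ^+ n / (n.*2.+1)`!%:R.
Proof.
move=> u0; rewrite -(ler_pM2l u0) -{1}(gtr0_norm u0) -normrM mulrBr -sinc_sumE.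
have -> : u * (sin u / u) = sin u by field; rewrite gt_eqF.
have := sin_sum_bound n (ltW u0); rewrite distrC => h; apply: le_trans h _.
by rewrite mulrA exprS -muln2 mulnC exprM.
Qed.

Lemma dsinc_sumE n (u : R) :
  cos_sum n.+1 u - \sum_(k < n.+1) sinc_coef k * (u ^+ 2 / 8) ^+ k =
  u ^+ 2 * \sum_(k < n) dsinc_coef k * (u ^+ 2 / 8) ^+ k.
Proof.
rewrite /cos_sum !big_ord_recl /= /sinc_coef /dsinc_coef !expr0 !fact0 (_ : (0.*2.+1)`! = 1)%N//.
rewrite !divr1 !mulr1 opprD addrACA subrr add0r -sumrB mulr_sumr; apply: eq_bigr => k _.
rewrite /bump /= add1n doubleS.
have -> : u ^+ (k.*2).+2 = (u ^+ 2) ^+ k.+1 by rewrite -exprM mulnC muln2.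
have e : ((k.*2.+3)`!)%:R = k.*2.+3%:R * (k.*2.+2)`!%:R :> R by rewrite factS natrM.
have f0 : (k.*2.+2)`!%:R != 0 :> R by rewrite pnatr_eq0 -lt0n fact_gt0.
have n0 : k.*2.+3%:R != 0 :> R by rewrite pnatr_eq0.
have n1 : k.*2.+3%:R = k.*2.+2%:R + 1 :> R by rewrite -natr1.
rewrite e !expr_div_n; move: f0 n0; rewrite n1.
move: (_`!)%:R (k.*2.+2%:R) => F m f0 n0.
set w := u ^+ 2; rewrite [(-1) ^+ k.+1]exprS [w ^+ k.+1]exprS [8 ^+ k.+1]exprS; field.
by rewrite f0 n0 expf_neq0.
Qed.

Lemma dsinc_bound n (u : R) : 0 < u ->
  `|(cos u - sin u / u) / u ^+ 2 - \sum_(k < n) dsinc_coef k * (u ^+ 2 / 8) ^+ k| <=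
  2 * (u ^+ 2) ^+ n / (n.*2.+2)`!%:R.
Proof.
move=> u0; have w0 : 0 < u ^+ 2 by rewrite exprn_gt0.
rewrite -(ler_pM2l w0) -{1}(gtr0_norm w0) -normrM mulrBr -dsinc_sumE.
set T := \sum_(k < n.+1) _.
have -> : u ^+ 2 * ((cos u - sin u / u) / u ^+ 2) - (cos_sum n.+1 u - T) =
   (cos u - cos_sum n.+1 u) - (sin u / u - T).
  by field; rewrite gt_eqF.
have h1 := cos_sum_bound n (ltW u0); rewrite distrC in h1.
have h2 := sinc_bound n.+1 u0.
apply: le_trans (ler_normB _ _) _; apply: le_trans (lerD h1 h2) _.
have -> : u ^+ n.+1.*2 = (u ^+ 2) ^+ n.+1 by rewrite -exprM -muln2 mulnC.
set W := (u ^+ 2) ^+ n.+1.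
have -> : u ^+ 2 * (2 * (u ^+ 2) ^+ n / (n.*2.+2)`!%:R) = W / (n.*2.+2)`!%:R + W / (n.*2.+2)`!%:R.
  by rewrite /W; set w := u ^+ 2; rewrite exprS; ring.
have W0 : 0 <= W by rewrite exprn_ge0// ltW.
apply: lerD => //; apply: ler_wpM2l => //.
by rewrite lef_pV2 ?posrE ?ltr0n ?fact_gt0// ler_nat [leqRHS]factS leq_pmull.
Qed.

Definition tail_check n : bool :=
  (2 * S * zpow 17 n <= zpow 4 n * Zpos (pfact n.*2.+1))%binz.

Lemma tail_checkP n (w : R) : tail_check n -> 0 <= w <= 17 / 4 ->
  sigma * (2 * w ^+ n / (n.*2.+1)`!%:R) <= 1.
Proof.
move=> /ZR_le-/(_ R); rewrite !ZRM !zpowE pfactE (ZR_nat R 17) (ZR_nat R 4) (ZR_nat R 2) => h /andP[w0 w1].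
have f0 : 0 < (n.*2.+1)`!%:R :> R by rewrite ltr0n fact_gt0.
rewrite 2!mulrA ler_pdivrMr// mul1r.
have w2 : w ^+ n <= (17 / 4) ^+ n by rewrite lerXn2r// nnegrE; lra.
have s0 := ZR_pos R scale.
apply: (@le_trans _ _ (sigma * 2 * (17 / 4) ^+ n)); first by rewrite ler_wpM2l// mulr_ge0// ltW.
rewrite expr_div_n mulrA ler_pdivrMr ?exprn_gt0//.
by rewrite (mulrC sigma) (mulrC _`!%:R).
Qed.

Lemma v_range (u : R) : u ^+ 2 <= 17 / 4 -> 0 <= u ^+ 2 / 8 <= 17 / 32.
Proof. by move=> h; rewrite divr_ge0 ?sqr_ge0//=; move: (u ^+ 2) h => w h; lra. Qed.

Lemma sincz_ev n (u : R) : tail_check n -> 0 < u -> u ^+ 2 <= 17 / 4 ->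
  `|sigma * (sin u / u) - ev (mkseq sincz n) (u ^+ 2 / 8)| <= 4.
Proof.
move=> hn u0 u2; have s0 := ltW (ZR_pos R scale).
have h1 := ev_mkseqP n (v_range u2) sinczP; have h2 := sinc_bound n u0.
have := tail_checkP hn (w := u ^+ 2); rewrite sqr_ge0 u2 => /(_ isT) h3.
move: h1 h2; set T := \sum_(k < n) _ => h1 h2.
have -> : sigma * (sin u / u) - ev (mkseq sincz n) (u ^+ 2 / 8) =
  sigma * (sin u / u - T) - (ev (mkseq sincz n) (u ^+ 2 / 8) - sigma * T) by ring.
apply: le_trans (ler_normB _ _) _; rewrite normrM (ger0_norm s0).
have : sigma * `|sin u / u - T| <= 1; last by move: h1; lra.
apply: le_trans (ler_wpM2l s0 h2) _; apply: le_trans h3; apply: ler_wpM2l => //.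
have : 0 <= (u ^+ 2) ^+ n / (n.*2.+1)`!%:R by rewrite mulr_ge0 ?invr_ge0// exprn_ge0// sqr_ge0.
by rewrite -mulrA; move: (_ / _) => y y0; lra.
Qed.

Lemma dsincz_ev n (u : R) : tail_check n -> 0 < u -> u ^+ 2 <= 17 / 4 ->
  `|sigma * ((cos u - sin u / u) / u ^+ 2) - ev (mkseq dsincz n) (u ^+ 2 / 8)| <= 4.
Proof.
move=> hn u0 u2; have s0 := ltW (ZR_pos R scale).
have h1 := ev_mkseqP n (v_range u2) dsinczP; have h2 := dsinc_bound n u0.
have := tail_checkP hn (w := u ^+ 2); rewrite sqr_ge0 u2 => /(_ isT) h3.
move: h1 h2; set T := \sum_(k < n) _; set D := (_ / u ^+ 2) => h1 h2.
have -> : sigma * D - ev (mkseq dsincz n) (u ^+ 2 / 8) =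
  sigma * (D - T) - (ev (mkseq dsincz n) (u ^+ 2 / 8) - sigma * T) by ring.
apply: le_trans (ler_normB _ _) _; rewrite normrM (ger0_norm s0).
have : sigma * `|D - T| <= 1; last by move: h1; lra.
apply: le_trans (ler_wpM2l s0 h2) _; apply: le_trans h3; apply: ler_wpM2l => //.
apply: ler_wpM2l; first by rewrite mulr_ge0// exprn_ge0// sqr_ge0.
by rewrite lef_pV2 ?posrE ?ltr0n ?fact_gt0// ler_nat [leqRHS]factS leq_pmull.
Qed.

(* If [a - a ln (2 a) - a p(a^2 / 8)] is to approximate the Lobachevsky function then
   [e(u^2 / 8)] approximates [ln (sin u / u)] and [u r(u^2 / 8) / 4] its derivative;
   [l], [ser_e l] and [ser_r l] are the coefficients of [p], [e] and [r], scaled. *)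
Definition ser_e l := padd l (pscale 2%binz (Z0 :: pderiv l)).
Definition ser_r l := pderiv (ser_e l).
Definition ser_check l n (K : Z) : bool := tail_check n &&
  (K * (ev_ub (padd (pmul (ser_r l) (mkseq sincz n)) (pscale (- (4 * S)) (mkseq dsincz n)))
     + (4 * ev_ub (ser_r l) + 16 * S)) <= 4 * (S * S))%binz.

Lemma ser_eE l w : ev (ser_e l) w = ev l w + 2 * (w * ev (pderiv l) w).
Proof. by rewrite paddE pscaleE (ZR_nat R 2) /= ZR0 add0r. Qed.

(** The logarithm [e] of [s = sin u / u] is certified through its differential equation [s e' = s'],
    divided by [u]. Both sides become polynomials in [u^2 / 8] up to rounding and remainders, so the
    check only bounds the coefficients of the residual, whatever the origin of [l]. *)
Lemma ser_checkP l n K u : ser_check l n K -> 0 < ZR K -> 0 < u -> u ^+ 2 <= 17 / 4 ->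
  `|ev (ser_r l) (u ^+ 2 / 8) / (4 * sigma) * (sin u / u) - (cos u - sin u / u) / u ^+ 2| <= (ZR K)^-1.
Proof.
move=> /andP[hn /ZR_le-/(_ R)].
rewrite !ZRM !ZRD !ZRM (ZR_nat R 4) (ZR_nat R 16) => hK K0 u0 u2.
have s0 := ZR_pos R scale; have vr := v_range u2.
have := sincz_ev hn u0 u2; have := dsincz_ev hn u0 u2; have := ev_ubP (ser_r l) vr.
have := ev_ubP (padd (pmul (ser_r l) (mkseq sincz n)) (pscale (- (4 * S))%binz (mkseq dsincz n))) vr.
rewrite paddE pmulE pscaleE ZRN ZRM (ZR_nat R 4).
move: (ev_ub (padd _ _)) hK => A hK.
set r := ev (ser_r l) _; set s := sin u / u; set d := (_ / u ^+ 2).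
set P := ev _ _; set Q := ev _ _ => h1 h2 h3 h4.
have B0 : 0 <= ZR (ev_ub (ser_r l)) by apply: le_trans h2; exact: normr_ge0.
have q0 : 0 < 4 * sigma ^+ 2 by rewrite mulr_gt0// exprn_gt0.
rewrite -(ler_pM2l q0) -{1}(gtr0_norm q0) -normrM.
have -> : 4 * sigma ^+ 2 * (r / (4 * sigma) * s - d) =
   (r * P + - (4 * sigma) * Q) + (r * (sigma * s - P) - 4 * sigma * (sigma * d - Q)).
  by field; rewrite gt_eqF.
have h5 : `|r * (sigma * s - P)| <= ZR (ev_ub (ser_r l)) * 4 by rewrite normrM; apply: ler_pM.
have h6 : `|4 * sigma * (sigma * d - Q)| <= 4 * sigma * 4.
  by rewrite normrM ger0_norm ?mulr_ge0 ?(ltW s0)// ler_wpM2l// mulr_ge0// ltW.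
rewrite ler_pdivlMr// mulrC expr2; apply: le_trans hK; rewrite ler_pM2l//.
apply: le_trans (ler_normD _ _) _; apply: lerD => //.
apply: le_trans (ler_normB _ _) _; apply: le_trans (lerD h5 h6) _; lra.
Qed.

Definition ser_lob l (a : R) : R := a - a * ln (2 * a) - a * (ev l (a ^+ 2 / 8) / sigma).

Lemma sinc_ge (u : R) : 0 < u -> u ^+ 2 <= 17 / 4 -> 7 / 24 <= sin u / u.
Proof.
move=> u0 u2; have h := sin_ge_cubic (ltW u0).
have -> : 7 / 24 = 1 - (17 / 4) / 6 :> R by field.
apply: (@le_trans _ _ ((u - u ^+ 3 / 6) / u)); last by rewrite ler_pM2r ?invr_gt0.
have -> : (u - u ^+ 3 / 6) / u = 1 - u ^+ 2 / 6 by field; rewrite gt_eqF.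
lra.
Qed.

Lemma small_linear (f : R -> R) (C a e : R) : 0 < a -> 0 < e ->
  (forall t, 0 < t <= a -> `|f t| <= C * t) -> 
  exists2 h, 0 < h & forall t, 0 < t < h -> `|f t - 0| <= e.
Proof.
move=> a0 e0 hf.
pose C' := 1 + `|C|; have C0 : 0 < C' by rewrite ltr_pwDl.
exists (Num.min a (e / C')); first by rewrite lt_min a0 divr_gt0.
move=> t /andP[t0]; rewrite lt_min => /andP[ta te]; rewrite subr0.
apply: le_trans (hf t _) _; first by rewrite t0 ltW.
apply: (@le_trans _ _ (C' * t)).
  by rewrite ler_wpM2r ?ltW// /C' ltr_pwDl// ler_norm.
by rewrite mulrC -ler_pdivlMr// ltW.
Qed.

(** The residual of [ser_checkP] is integrated from [0], where the zero leading coefficient makes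
    the approximation exact. With [u <= 21/10] and [sin u / u >= 7/24], the derivative is at most
    [(21/2) / K], and [21/2 * 21/10 <= 23]. *)
Lemma ln_sinc_bound l n K u : ser_check (Z0 :: l) n K -> 0 < ZR K ->
  0 < u -> u ^+ 2 <= 17 / 4 ->
  `|ev (ser_e (Z0 :: l)) (u ^+ 2 / 8) / sigma - ln (sin u / u)| <= 23 / ZR K.
Proof.
move=> chk K0 u0 uW; have sg0 := ZR_pos R scale; pose eta := (ZR K)^-1.
set el := ser_e (Z0 :: l); rewrite -/eta.
have le2 t : 0 < t <= u -> t ^+ 2 <= 17 / 4.
  by move=> /andP[t0 tu]; apply: le_trans uW; rewrite lerXn2r// nnegrE ltW.
have s0 t : 0 < t <= u -> 7 / 24 <= sin t / t.
  move=> tu; apply: sinc_ge; first by case/andP: tu.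
  exact: le2 t tu.
have tb t : 0 < t <= u -> t <= 21 / 10.
  move=> tu; have t2 := le2 t tu; rewrite leNgt; apply/negP => h.
  have : (21 / 10) * (21 / 10) < t * t by apply: ltr_pM => //; lra.
  by rewrite expr2 in t2; lra.
have eta0 : 0 <= eta by rewrite invr_ge0 ltW.
pose f (t : R) := ev el (t ^+ 2 / 8) / sigma - ln (sin t / t).
pose df (t : R) := t * (ev (ser_r (Z0 :: l)) (t ^+ 2 / 8) / (4 * sigma) * (sin t / t) - (cos t - sin t / t) / t ^+ 2) / (sin t / t).
have fd t : 0 < t <= u -> is_derive t 1 f (df t).
  move=> tu; have t0 : 0 < t by case/andP: tu.
  have st : 0 < sin t / t by apply: lt_le_trans (s0 t tu).
  have h1 : is_derive t 1 (fun t => ln (sin t / t)) ((cos t * t - sin t) / t ^+ 2 / (sin t / t)).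
    have tn0 : t != 0 by rewrite gt_eqF.
    have hs := is_derive1_mul (is_derive_sin t) (is_derive1_inv (is_derive1_id t) tn0).
    apply: is_derive1_eq (is_derive1_lnc hs st) _.
    have sn0 : sin t != 0 by apply: contraL st => /eqP ->; rewrite mul0r ltxx.
    by field; rewrite tn0.
  have h2 : is_derive t 1 (fun t => ev el (t ^+ 2 / 8) / sigma) (ev (ser_r (Z0 :: l)) (t ^+ 2 / 8) * (t / 4) / sigma).
    have h2 : is_derive t 1 (fun t => t ^+ 2 / 8) (t / 4).
      by eapply is_derive1_eq; [der|rewrite /= expr1; field].
    have h := is_derive1_mul (is_derive1_comp_cst (is_derive_ev el _) h2) (is_derive1_cst sigma^-1 t).
    by apply: is_derive1_eq h _; rewrite mulr0 addr0.
  have := is_derive1_add h2 (is_derive1_opp h1) => h; apply: is_derive1_eq h _.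
  rewrite /df.
  have sn0 : sin t != 0 by apply: contraL st => /eqP ->; rewrite mul0r ltxx.
  field.
  by rewrite ?sn0 ?(gt_eqF sg0) ?(gt_eqF t0).
have h := @derive_bound_at0 f df 0 (21 / 2 * eta) u u0 fd.
rewrite /f subr0 in h; apply: le_trans (h _ _) _.
- move=> t tu; have t0 : 0 < t by case/andP: tu.
  have st := s0 t tu; have st0 : 0 < sin t / t by apply: lt_le_trans st.
  rewrite /df normrM normrM (gtr0_norm t0) normfV (gtr0_norm st0).
  have e1 := ser_checkP chk K0 t0 (le2 t tu).
  rewrite ler_pdivrMr//.
  apply: (@le_trans _ _ (21 / 10 * eta)); first by apply: ler_pM => //; [exact: ltW|exact: tb].
  have : eta * (7 / 24) <= eta * (sin t / t) by rewrite ler_wpM2l.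
  lra.
- move=> e e0; apply: (@small_linear _ (ZR (ev_ub (behead el)) / (8 * sigma) * (21 / 10) + 21 / 10) u) => // t tu.
  have t0 : 0 < t by case/andP: tu.
  have t2 := le2 t tu; have st := s0 t tu; have st0 : 0 < sin t / t by apply: lt_le_trans st.
  have tb' := tb t tu.
  apply: le_trans (ler_normB _ _) _; rewrite [leRHS]mulrDl; apply: lerD.
    have -> : ev el (t ^+ 2 / 8) / sigma = ev (behead el) (t ^+ 2 / 8) / (8 * sigma) * t ^+ 2.
      by rewrite /el /ser_e /= ZR0; field; rewrite gt_eqF.
    have s80 : 0 < 8 * sigma by rewrite mulr_gt0.
    rewrite normrM (gtr0_norm (x := t ^+ 2)) ?exprn_gt0// -mulrA; apply: ler_pM => //; first exact: sqr_ge0.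
      rewrite normrM normfV (gtr0_norm s80) ler_pM2r ?invr_gt0//.
      by apply: ev_ubP; exact: v_range.
    by rewrite expr2 ler_wpM2r// ltW.
  have s1 : sin t / t <= 1 by rewrite ler_pdivrMr// mul1r sin_le// ltW.
  rewrite ler0_norm ?ln_le0//.
  have h2 : - ln (sin t / t) <= (sin t / t)^-1 - 1.
    have hh := @le_ln1Dx R ((sin t / t)^-1 - 1).
    rewrite (_ : 1 + ((sin t / t)^-1 - 1) = (sin t / t)^-1) in hh; last by ring.
    rewrite -lnV ?posrE//; apply: hh.
    by rewrite ltrBrDr addrC subrr invr_gt0.
  apply: le_trans h2 _.
  have h3 := sin_ge_cubic (ltW t0).
  have h4 : 1 - t ^+ 2 / 6 <= sin t / t.
    by rewrite ler_pdivlMr//; apply: le_trans h3; rewrite !exprS expr0; lra.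
  rewrite -(ler_pM2l st0) mulrBr divff ?gt_eqF// mulr1.
  have : 7 / 24 * (21 / 10 * t) <= sin t / t * (21 / 10 * t).
    by rewrite ler_wpM2r// mulr_ge0 ?ltW.
  have : t ^+ 2 <= 21 / 10 * t by rewrite expr2 ler_wpM2r// ltW.
  lra.
have := tb u; rewrite u0 lexx => /(_ isT) hu.
have : eta * u <= eta * (21 / 10) by rewrite ler_wpM2l.
lra.
Qed.

Lemma xlnx_small (e : R) : 0 < e -> exists2 h, 0 < h & forall t, 0 < t < h -> `|t * ln (2 * t)| <= e.
Proof.
move=> e0; exists (Num.min (1 / 2) (e ^+ 2 / 2)).
  by rewrite lt_min !divr_gt0 ?exprn_gt0.
move=> t /andP[t0]; rewrite lt_min => /andP[t1 te].
have t20 : 0 < 2 * t by rewrite mulr_gt0.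
pose v := expR (ln (2 * t) / 2).
have v0 : 0 < v by exact: expR_gt0.
have vv : v * v = 2 * t by rewrite -expRD -splitr lnK ?posrE.
have ve : v <= e.
  rewrite leNgt; apply/negP => h; have : e * e < v * v by rewrite ltr_pM// ltW.
  by rewrite expr2 in te; lra.
have l0 : ln (2 * t) <= 0 by apply: ln_le0; lra.
rewrite normrM (gtr0_norm t0) ler0_norm//.
have h := expR_ge1Dx (- (ln (2 * t) / 2)); rewrite expRN -/v in h.
have h2 : - ln (2 * t) <= 2 * v^-1 by lra.
apply: (@le_trans _ _ (t * (2 * v^-1))); first by rewrite ler_pM2l.
have -> : t * (2 * v^-1) = v by rewrite mulrA [t * 2]mulrC -vv mulfK ?gt_eqF.
by [].
Qed.

(** A second integration from [0]. The part [a - a ln (2 a)] carries the singularity, so that the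
    derivative of the difference is the small quantity of [ln_sinc_bound]. *)
Lemma ser_lobP l n K a : ser_check (Z0 :: l) n K -> 0 < ZR K -> 0 < a -> a ^+ 2 <= 17 / 4 ->
  `|lobachevsky a - ser_lob (Z0 :: l) a| <= 23 / ZR K * a.
Proof.
move=> chk K0 a0 aW; set pl := Z0 :: l; have sg0 := ZR_pos R scale.
have le2 t : 0 < t <= a -> t ^+ 2 <= 17 / 4.
  by move=> /andP[t0 ta]; apply: le_trans aW; rewrite lerXn2r// nnegrE ltW.
have tpi t : 0 < t <= a -> 0 < t < pi.
  move=> ta; have t2 := le2 t ta; have [t0 _] := andP ta; rewrite t0/=.
  have p3 := pi_gt_314 R; rewrite ltNge; apply/negP => h.
  have h3 : 3 <= t by lra.
  by have : 3 * 3 <= t * t by [apply: ler_pM; lra]; rewrite expr2 in t2; lra.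
pose f (t : R) := lobachevsky t - ser_lob pl t.
pose df (t : R) := ev (ser_e pl) (t ^+ 2 / 8) / sigma - ln (sin t / t).
have fd t : 0 < t <= a -> is_derive t 1 f (df t).
  move=> ta; have tp := tpi t ta; have t0 : 0 < t by case/andP: ta.
  have st : 0 < sin t by apply: sin_gt0_pi.
  have t2 : 0 < 2 * t by rewrite mulr_gt0.
  have h2 : is_derive t 1 (fun t => ev pl (t ^+ 2 / 8) / sigma) (ev (pderiv pl) (t ^+ 2 / 8) * (t / 4) / sigma).
    have h2 : is_derive t 1 (fun t => t ^+ 2 / 8) (t / 4).
      by eapply is_derive1_eq; [der|rewrite /= expr1; field].
    have h := is_derive1_mul (is_derive1_comp_cst (is_derive_ev pl _) h2) (is_derive1_cst sigma^-1 t).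
    by apply: is_derive1_eq h _; rewrite mulr0 addr0.
  have h1 : is_derive t 1 (fun t => ln (2 * t)) (t^-1).
    apply: is_derive1_eq (is_derive1_lnc (is_derive1_mul (is_derive1_cst 2 t) (is_derive1_id t)) t2) _.
    by field; rewrite gt_eqF.
  have hi := is_derive1_id t.
  have h := is_derive1_add (is_derive_lobachevsky tp) (is_derive1_opp (is_derive1_add (is_derive1_add hi
     (is_derive1_opp (is_derive1_mul hi h1))) (is_derive1_opp (is_derive1_mul hi h2)))).
  apply: is_derive1_eq h _.
  rewrite /df ser_eE lnM ?posrE// ln_div ?posrE// lnM ?posrE//.
  field.
  by rewrite ?(gt_eqF sg0) ?(gt_eqF t0).
have h := @derive_bound_at0 f df 0 (23 / ZR K) a a0 fd.
rewrite /f subr0 in h; apply: h.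
  move=> t ta; have [t0 _] := andP ta.
  exact: ln_sinc_bound chk K0 t0 (le2 t ta).
move=> e e0; have e4 : 0 < e / 4 by rewrite divr_gt0.
have [h1 h10 H1] := lobachevsky_at0 e4.
have [h2 h20 H2] := xlnx_small e4.
have [h3 h30 H3] := @small_linear (fun t => t * (1 - ev pl (t ^+ 2 / 8) / sigma)) (1 + ZR (ev_ub pl) / sigma) a (e / 2) a0 ltac:(lra) ltac:(
  move=> t ta; have [t0 _] := andP ta; rewrite normrM mulrC (gtr0_norm t0) ler_pM2r//;
  apply: le_trans (ler_normB _ _) _; rewrite normr1 lerD2l; rewrite normrM normfV (gtr0_norm sg0) ler_pM2r ?invr_gt0//; apply: ev_ubP; apply: v_range; exact: le2).
exists (Num.min h1 (Num.min h2 h3)); first by rewrite !lt_min h10 h20.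
move=> t /andP[t0]; rewrite !lt_min => /and3P[t1 t2 t3].
have := H1 t; have := H2 t; have := H3 t; rewrite t0 t1 t2 t3 => /(_ isT) k3 /(_ isT) k2 /(_ isT) k1.
rewrite subr0 in k3.
have -> : lobachevsky t - ser_lob pl t - 0 = lobachevsky t + (t * ln (2 * t) - t * (1 - ev pl (t ^+ 2 / 8) / sigma)).
  by rewrite /ser_lob; ring.
apply: le_trans (ler_normD _ _) _.
have := ler_normB (t * ln (2 * t)) (t * (1 - ev pl (t ^+ 2 / 8) / sigma)); lra.
Qed.

End series_numerics.

(* [- 2^(2k-1) |B_2k| / (k (2k+1)!)], the coefficient of [a^2k] in the series of
   [(1/a) int_0^a ln (sin u / u) du], multiplied by [8^k 2^64] and rounded. *)
Definition lob_coefs : seq Z := [::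
  -8198552921648689607; -1311768467463790337; -475925067560558852; -222098364861594131;
  -117473515298694416; -67092415875673993; -40391382061187238; -25276060365971322;
  -16294365146928558; -10754822772617861; -7235890107030337; -4946310700419724;
  -3426776290077546; -2401358898396223; -1699496967807975; -1213192357248251; -872643511895183;
  -631931264191040; -460379635764775; -337217964182513; -248214441520752; -183514271142110;
  -136229005259611; -101502841279775; -75886684318845; -56913695583711; -42808478474116;
  -32285952269441; -24411064569210; -18500176887102; -14051250262049; -10694096995867;
  -8154718105700; -6229596665726; -4767072814054; -3653785595654; -2804759801448]%binz.

(** [14] terms of the series of [sin u / u] suffice to certify a residual of at most [10^-14]. *)
Lemma lob_coefs_ok : ser_check (Z0 :: lob_coefs) 14 (zpow 10%binz 14) = true.
Proof. by vm_compute. Qed.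

(** * Certified logarithms, and values of the Lobachevsky function at six points *)

Section lobachevsky_values.
Variable R : realType.
Notation ZR := (@ZR R). Notation ev := (@ev R).
Local Notation S := (Zpos scale).
Local Notation sigma := (ZR S).

(** Logarithms are certified by exponentiation: [4 v / sigma] is the proposed logarithm and
    [exp_fix v] its exponential. Expanding in a quarter of the exponent keeps the argument of the
    polynomial below [17/32]. *)
Definition expz k : Z := (S * zpow 4 k / Zpos (pfact k))%binz.
Definition exp_fix (v : Z) : Z := ev_fix v (mkseq expz 31).

Lemma exp_fixP v : 0 <= ZR v / sigma <= 17 / 32 ->
  `|sigma * exp_sum 31 (4 * (ZR v / sigma)) - ZR (exp_fix v)| <= 6.
Proof.
move=> hv.
have hc k : `|ZR (expz k) - sigma * (4 ^+ k / k`!%:R)| <= 1.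
  have h := ZR_div_near R (S * zpow 4 k)%binz (pfact k).
  by rewrite ZRM zpowE (ZR_nat R 4) pfactE -mulrA in h.
have := ev_mkseqP 31 hv hc; have := ev_fixP (mkseq expz 31) hv.
have -> : exp_sum 31 (4 * (ZR v / sigma)) = \sum_(k < 31) 4 ^+ k / k`!%:R * (ZR v / sigma) ^+ k.
  by apply: eq_bigr => k _; rewrite exprMn; ring.
rewrite -/(exp_fix v); move: (\sum_(k < 31) _) (ev _ _) => F e h1 h2.
have -> : sigma * F - ZR (exp_fix v) = (e - ZR (exp_fix v)) - (e - sigma * F) by ring.
by apply: le_trans (ler_normB _ _) _; lra.
Qed.

Lemma sigma_ge : 10 ^+ 18 <= sigma.
Proof.
have h : BinInt.Z.leb (zpow 10%binz 18) S by vm_compute.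
by have := ZR_le R h; rewrite zpowE (ZR_nat R 10).
Qed.

Lemma exp_tail n (x : R) : (4 * S * zpow 17 n <= zpow 8 n * Zpos (pfact n))%binz ->
  0 <= x <= 17 / 8 -> 0 <= x ^+ n / n`!%:R <= (4 * sigma)^-1.
Proof.
move=> /(ZR_le R) + /andP[x0 x1]; rewrite !ZRM !zpowE pfactE (ZR_nat R 4) (ZR_nat R 17) (ZR_nat R 8).
have f0 : 0 < n`!%:R :> R by rewrite ltr0n fact_gt0.
have s0 : 0 < 4 * sigma by rewrite mulr_gt0// ZR_pos.
rewrite divr_ge0 ?exprn_ge0 ?(ltW f0)//=; move: (4 * sigma) s0 (n`!%:R) f0 => s s0 f f0 H.
have x2 : x ^+ n <= (17 / 8) ^+ n by rewrite lerXn2r// nnegrE; lra.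
rewrite ler_pdivrMr// mulrC -(ler_pM2r s0) mulfVK ?gt_eqF// mulrC.
apply: le_trans (ler_wpM2l (ltW s0) x2) _.
by rewrite expr_div_n mulrA ler_pdivrMr ?exprn_gt0// [leRHS]mulrC.
Qed.

Lemma ln_near1 (y e : R) : e <= 1 / 2 -> `|y - 1| <= e -> `|ln y| <= 2 * e.
Proof.
move=> e2; rewrite ler_distl => /andP[h1 h2]; have y0 : 0 < y by lra.
have h3 : ln y <= y - 1.
  have := @le_ln1Dx R (y - 1); rewrite (_ : 1 + (y - 1) = y); last by ring.
  by apply; lra.
have h4 : - ln y <= y^-1 - 1.
  have := @le_ln1Dx R (y^-1 - 1); rewrite (_ : 1 + (y^-1 - 1) = y^-1); last by ring.
  rewrite lnV ?posrE//; apply.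
  by have := invr_gt0 y; rewrite y0; lra.
have h5 : y^-1 - 1 <= 2 * e.
  rewrite lerBlDr -(ler_pM2l y0) divff ?gt_eqF//.
  have : (1 - e) * (2 * e + 1) <= y * (2 * e + 1) by rewrite ler_wpM2r//; lra.
  by apply: le_trans; nra.
by rewrite ler_norml; apply/andP; split; lra.
Qed.

Let exp_bounds v : 0 <= ZR v / sigma <= 17 / 32 -> exists2 t : R, 0 <= t <= (4 * sigma)^-1 &
  expR (4 * (ZR v / sigma)) * (1 - t) <= exp_sum 31 (4 * (ZR v / sigma)) <= expR (4 * (ZR v / sigma)).
Proof.
move=> /andP[v0 v1]; set x := 4 * (ZR v / sigma).
have x0 : 0 <= x by rewrite mulr_ge0.
have x1 : x <= 17 / 8 by rewrite /x; lra.
exists (x ^+ 31 / 31`!%:R); first by apply: exp_tail; rewrite ?x0//; vm_compute.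
have := ler_wpM2l (expR_ge0 x) (exp_sum_ge 30 x0).
by rewrite expRN mulrCA divff ?gt_eqF ?expR_gt0// mulr1 (exp_sum_le _ x0) andbT.
Qed.

(** [34] is twice [10 + 6 + 1]: the tolerance of the check, the error of [exp_fix] and the
    truncation of the series, doubled by [ln_near1]. *)
Lemma ln_ge1_check (x : R) v : 0 < x -> 0 <= ZR v / sigma <= 17 / 32 ->
  `|sigma * x - ZR (exp_fix v)| <= 10 -> `|ln x - 4 * (ZR v / sigma)| <= 34 / sigma.
Proof.
move=> x0 hv h1; have h2 := exp_fixP hv; have [t /andP[t0 t1]] := exp_bounds hv.
have s18 := sigma_ge; have s0 := ZR_pos R scale.
have L0 : 0 <= 4 * (ZR v / sigma) by have /andP[v0 _] := hv; rewrite mulr_ge0.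
move: h1 h2 L0; set L := 4 * _; move: (ZR (exp_fix v)) (exp_sum _ _) => E F h1 h2 L0 /andP[f1 f2].
have e0 := expR_gt0 L; have e1 : 1 <= expR L by have := expR_ge1Dx L; lra.
have -> : ln x - L = ln (x / expR L) by rewrite ln_div ?posrE// expRK.
have -> : 34 / sigma = 2 * (17 / sigma) by rewrite mulrA; congr (_ / _); ring.
have s40 : (4 * sigma)^-1 = sigma^-1 / 4 by field; rewrite gt_eqF.
apply: ln_near1.
  rewrite ler_pdivrMr//; apply: (@le_trans _ _ (1 / 2 * 10 ^+ 18)); last by rewrite ler_wpM2l.
  by rewrite !exprS; lra.
have -> : x / expR L - 1 = (x - expR L) / expR L by field; rewrite gt_eqF.
rewrite normrM normfV (gtr0_norm e0) ler_pdivrMr//.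
have h3 : `|x - F| <= 16 / sigma.
  rewrite ler_pdivlMr// -{1}(gtr0_norm s0) -normrM.
  have -> : (x - F) * sigma = (sigma * x - E) - (sigma * F - E) by ring.
  by apply: le_trans (ler_normB _ _) _; lra.
have h4 : `|F - expR L| <= sigma^-1 * expR L.
  rewrite distrC ger0_norm ?subr_ge0//.
  have : expR L * t <= expR L * sigma^-1.
    by rewrite ler_wpM2l ?(ltW e0)// (le_trans t1)// s40 ler_pdivrMr// ler_peMr ?invr_ge0 ?(ltW s0)//; lra.
  lra.
have -> : x - expR L = (x - F) + (F - expR L) by ring.
apply: le_trans (ler_normD _ _) _.
have : 16 / sigma * 1 <= 16 / sigma * expR L by rewrite ler_wpM2l// divr_ge0// ltW.
lra.
Qed.

(** [exp_fix] takes nonnegative exponents, so for [x <= 1] the product of [x] with the exponential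
    of [- ln x] is compared with [1]. *)
Lemma ln_le1_check (x : R) v : 0 < x <= 1 -> 0 <= ZR v / sigma <= 17 / 32 ->
  `|x * ZR (exp_fix v) - sigma| <= 10 -> `|ln x + 4 * (ZR v / sigma)| <= 34 / sigma.
Proof.
move=> /andP[x0 x1] hv h1; have h2 := exp_fixP hv; have [t /andP[t0 t1]] := exp_bounds hv.
have s18 := sigma_ge; have s0 := ZR_pos R scale.
move: h1 h2; set L := 4 * _; move: (ZR (exp_fix v)) (exp_sum _ _) => E F h1 h2 /andP[f1 f2].
have e0 := expR_gt0 L.
have -> : ln x + L = ln (x * expR L) by rewrite lnM ?posrE// expRK.
have -> : 34 / sigma = 2 * (17 / sigma) by rewrite mulrA; congr (_ / _); ring.
have s40 : (4 * sigma)^-1 = sigma^-1 / 4 by field; rewrite gt_eqF.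
have i0 : 0 < sigma^-1 by rewrite invr_gt0.
have i1 : 17 * sigma^-1 <= 1 / 2.
  rewrite ler_pdivrMr//; apply: (@le_trans _ _ (1 / 2 * 10 ^+ 18)); last by rewrite ler_wpM2l.
  by rewrite !exprS; lra.
apply: ln_near1 => //.
have h3 : `|x * F - 1| <= 16 * sigma^-1.
  rewrite ler_pdivlMr// -{1}(gtr0_norm s0) -normrM.
  have -> : (x * F - 1) * sigma = (x * E - sigma) + x * (sigma * F - E) by ring.
  apply: le_trans (ler_normD _ _) _; rewrite normrM (gtr0_norm x0).
  have : x * `|sigma * F - E| <= 1 * 6 by apply: ler_pM => //; exact: ltW.
  lra.
move: h3; rewrite ler_distl => /andP[h3 h4].
have g1 : x * F <= x * expR L by rewrite ler_wpM2l// ltW.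
have g2 : x * (expR L * (1 - t)) <= x * F by rewrite ler_wpM2l// ltW.
have t4 : t <= sigma^-1 / 4 by rewrite -s40.
move: (sigma^-1) i0 i1 h3 h4 t4 => i i0 i1 h3 h4 t4.
have y4 : x * expR L <= 4.
  have : x * expR L * (1 / 2) <= x * expR L * (1 - t) by rewrite ler_wpM2l ?mulr_ge0 ?ltW//; lra.
  lra.
have : x * expR L * t <= 4 * (i / 4) by apply: ler_pM => //; rewrite mulr_ge0 ?ltW.
by rewrite ler_distl; lra.
Qed.

Definition tera : positive := iter 12 (BinPos.Pos.mul (xO (xI (xO xH)))) xH.

Lemma teraE : ZR (Zpos tera) = 10 ^+ 12.
Proof.
have -> : Zpos tera = zpow 10%binz 12 by [].
by rewrite zpowE (ZR_nat R 10).
Qed.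

Definition dec12 (a : Z) : R := ZR a / 10 ^+ 12.

Lemma dec12_pos (p : positive) : 0 < dec12 (Zpos p).
Proof. by rewrite divr_gt0 ?ZR_pos ?exprn_gt0. Qed.

(* Approximation of the Lobachevsky function at [a / 10^12], in units of [10^-12 / sigma];
   [L] is [sigma / 4] times the logarithm of [2 a / 10^12]. *)
Definition lob_fix (a L : Z) : Z :=
  (a * ((S - 4 * L) - ev_sq 8 (Zpos tera) a (Z0 :: lob_coefs)))%binz.

Definition exp_range (v : Z) : bool := (0 <= v)%binz && (32 * v <= 17 * S)%binz.

Lemma exp_rangeP v : exp_range v -> 0 <= ZR v / sigma <= 17 / 32.
Proof.
move=> /andP[/(ZR_le R) + /(ZR_le R)]; have s0 := ZR_pos R scale.
rewrite ZR0 !ZRM (ZR_nat R 32) (ZR_nat R 17) => v0 v1.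
by rewrite divr_ge0 ?(ltW s0)//= ler_pdivrMr//; lra.
Qed.

Lemma ln_ge1_dec12 (p : positive) v : exp_range v ->
  (BinInt.Z.abs (S * (2 * Zpos p) - exp_fix v * Zpos tera) <= 10 * Zpos tera)%binz ->
  `|ln (2 * dec12 (Zpos p)) - 4 * (ZR v / sigma)| <= 34 / sigma.
Proof.
move=> hv /(ZR_le R).
rewrite ZR_abs ZRD ZRN !ZRM teraE (ZR_nat R 10) (ZR_nat R 2) => h.
have T0 : 0 < 10 ^+ 12 :> R by rewrite exprn_gt0.
apply: ln_ge1_check; [by rewrite mulr_gt0// dec12_pos|exact: exp_rangeP|].
rewrite -(ler_pM2r T0) -{1}(gtr0_norm T0) -normrM.
by rewrite (_ : (_ - _) * _ = sigma * (2 * ZR (Zpos p)) - ZR (exp_fix v) * 10 ^+ 12)// /dec12; field.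
Qed.

Lemma ln_le1_dec12 (p : positive) v : exp_range v -> (2 * Zpos p <= Zpos tera)%binz ->
  (BinInt.Z.abs (2 * Zpos p * exp_fix v - S * Zpos tera) <= 10 * Zpos tera)%binz ->
  `|ln (2 * dec12 (Zpos p)) - 4 * (ZR (- v)%binz / sigma)| <= 34 / sigma.
Proof.
move=> hv /(ZR_le R) + /(ZR_le R).
rewrite ZR_abs ZRD !ZRN !ZRM teraE (ZR_nat R 10) (ZR_nat R 2) => h2 h.
have T0 : 0 < 10 ^+ 12 :> R by rewrite exprn_gt0.
rewrite mulNr mulrN opprK.
apply: ln_le1_check; [|exact: exp_rangeP|].
  by rewrite mulr_gt0 ?dec12_pos//= /dec12 mulrA ler_pdivrMr// mul1r.
rewrite -(ler_pM2r T0) -{1}(gtr0_norm T0) -normrM.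
by rewrite (_ : (_ - _) * _ = 2 * ZR (Zpos p) * ZR (exp_fix v) - sigma * 10 ^+ 12)// /dec12; field.
Qed.

Lemma lob_deriv_ub : ZR (ev_ub (pderiv (Z0 :: lob_coefs))) <= 1 * sigma.
Proof. by rewrite mul1r; apply: ZR_le; vm_compute. Qed.

Let pow10_11 : 2 / 10 ^+ 11 = 20 * 10 ^- 12 :> R.
Proof.
have h (y : R) : y != 0 -> 2 / y = 20 * (10 * y)^-1 by move=> y0; field.
by rewrite (exprS _ 11); apply: h; rewrite expf_neq0 ?pnatr_eq0.
Qed.

Let pow10_14 : 24 / 10 ^+ 14 * (206 / 100) <= 10 ^- 12 :> R.
Proof.
have e : 10 ^+ 14 = 100 * 10 ^+ 12 :> R by rewrite (exprD 10 2 12); congr (_ * _); ring.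
have i0 : 0 <= 10 ^- 12 :> R by rewrite invr_ge0 exprn_ge0.
by rewrite e invfM; move: (10 ^- 12) i0 => i i0; lra.
Qed.

(** The series contributes [23 * 10^-14 * a]. The logarithm ([34]) and the fixed point evaluation
    ([3 + 1]) contribute [38 / sigma * a], at most [10^-14 * a]. The total is below [10^-12] for
    [a <= 206/100], whose square is under [17/4]. *)
Lemma lob_fixP (p : positive) L : BinInt.Z.leb (Zpos p) (206 * zpow 10 10)%binz -> 
  `|ln (2 * dec12 (Zpos p)) - 4 * (ZR L / sigma)| <= 34 / sigma ->
  `|lobachevsky (dec12 (Zpos p)) - ZR (lob_fix (Zpos p) L) / (10 ^+ 12 * sigma)| <= 10 ^- 12.
Proof.
move=> /(ZR_le R); rewrite ZRM zpowE (ZR_nat R 206) (ZR_nat R 10) => hp lnb.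
have a0 := dec12_pos p; have s0 := ZR_pos R scale; have s18 := sigma_ge.
have T0 : 0 < 10 ^+ 12 :> R by rewrite exprn_gt0.
have aE : dec12 (Zpos p) = ZR (Zpos p) / ZR (Zpos tera) by rewrite teraE.
have a206 : dec12 (Zpos p) <= 206 / 100.
  rewrite /dec12 ler_pdivrMr// (_ : 206 / 100 * 10 ^+ 12 = 206 * 10 ^+ 10)//.
  by rewrite -[12%N]/(2 + 10)%N exprD; field.
move: lnb a0 a206 aE; set a := dec12 _ => lnb a0 a206 aE.
have a2 : a ^+ 2 <= 17 / 4.
  apply: (@le_trans _ _ (206 / 100 * (206 / 100))); last by lra.
  by rewrite expr2; apply: ler_pM => //; exact: ltW.
have K0 : 0 < ZR (zpow 10%binz 14) by rewrite zpowE (ZR_nat R 10) exprn_gt0.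
have h1 := ser_lobP lob_coefs_ok K0 a0 a2; rewrite zpowE (ZR_nat R 10) in h1.
have q8 : ZR (Zpos (xO (xO (xO xH)))) = 8 := ZR_nat R 8.
have h2 := @ev_sqP R (xO (xO (xO xH))) tera (Zpos p) (Z0 :: lob_coefs) 1 a aE.
rewrite q8 in h2; have {}h2 := h2 (andP (v_range a2)).2 lob_deriv_ub.
move: h1; rewrite /ser_lob; set P := ev _ _ in h2 * => h1.
have e : ZR (lob_fix (Zpos p) L) / (10 ^+ 12 * sigma) =
   a * (1 - 4 * (ZR L / sigma) - ZR (ev_sq 8 (Zpos tera) (Zpos p) (Z0 :: lob_coefs)) / sigma).
  rewrite /lob_fix !(ZRD, ZRN, ZRM) (ZR_nat R 4) /a /dec12; field.
  by rewrite !gt_eqF.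
rewrite e; move: (ZR (ev_sq _ _ _ _)) h2 => Q h2.
have -> : lobachevsky a - a * (1 - 4 * (ZR L / sigma) - Q / sigma) =
  (lobachevsky a - (a - a * ln (2 * a) - a * (P / sigma)))
  - (a * (ln (2 * a) - 4 * (ZR L / sigma)) + a * ((P - Q) / sigma)) by field; rewrite gt_eqF.
apply: le_trans (ler_normB _ _) _.
have h3 : `|a * (ln (2 * a) - 4 * (ZR L / sigma)) + a * ((P - Q) / sigma)| <= 38 / sigma * a.
  apply: le_trans (ler_normD _ _) _.
  have -> : 38 / sigma * a = a * (34 / sigma) + a * ((3 + 1) / sigma) by field; rewrite gt_eqF.
  apply: lerD; rewrite normrM (gtr0_norm a0) ler_pM2l//.
  by rewrite normrM normfV (gtr0_norm s0) ler_pM2r ?invr_gt0.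
have h4 : 38 / sigma <= 1 / 10 ^+ 14.
  rewrite ler_pdivrMr// mulrAC ler_pdivlMr ?exprn_gt0// mul1r; apply: le_trans s18.
  by rewrite -[18%N]/(4 + 14)%N exprD ler_pM2r ?exprn_gt0// !exprS; lra.
have h5 : (23 / 10 ^+ 14 + 1 / 10 ^+ 14) * a <= (24 / 10 ^+ 14) * (206 / 100).
  by rewrite -mulrDl (_ : 23 + 1 = 24); [rewrite ler_wpM2l// divr_ge0// exprn_ge0|ring].
have h6 : 24 / 10 ^+ 14 * (206 / 100) <= 10 ^- 12 :> R by exact: pow10_14.
have h7 : 38 / sigma * a <= 1 / 10 ^+ 14 * a by rewrite ler_wpM2r// ltW.
lra.
Qed.

(* [val_c] and [val_d] will bracket [alpha0]; the other values are [t + val_c / 2], [t - val_c / 2],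
   [t + val_d / 2] and [t - val_d / 2], where [t = 1.168061] approximates [theta_fig8] at both. *)
Definition val_c := 1764782617400%binz.
Definition val_cp := 2050452308700%binz.
Definition val_cm := 285669691300%binz.
Definition val_d := 1764782617490%binz.
Definition val_dp := 2050452308745%binz.
Definition val_dm := 285669691255%binz.

(** Proposed logarithms, accepted through [exp_fix]. For [Lcm] and [Ldm] the argument [2 a] is below
    [1]; the opposite of the logarithm is stored. *)
Let Lc := 5816141732692907627%binz.
Let Lcp := 6508046301587279329%binz.
Let Lcm := 2581492155120763418%binz.
Let Ld := 5816141732928093387%binz.
Let Ldp := 6508046301688489130%binz.
Let Ldm := 2581492155847217351%binz.

Let lob_valE (p : positive) L : BinInt.Z.leb (Zpos p) (206 * zpow 10 10)%binz -> exp_range L ->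
  (BinInt.Z.abs (S * (2 * Zpos p) - exp_fix L * Zpos tera) <= 10 * Zpos tera)%binz ->
  `|lobachevsky (dec12 (Zpos p)) - ZR (lob_fix (Zpos p) L) / (10 ^+ 12 * sigma)| <= 10 ^- 12.
Proof. by move=> h1 h2 h3; apply: lob_fixP h1 (ln_ge1_dec12 h2 h3). Qed.

Let lob_valEn (p : positive) L : BinInt.Z.leb (Zpos p) (206 * zpow 10 10)%binz -> exp_range L ->
  (2 * Zpos p <= Zpos tera)%binz ->
  (BinInt.Z.abs (2 * Zpos p * exp_fix L - S * Zpos tera) <= 10 * Zpos tera)%binz ->
  `|lobachevsky (dec12 (Zpos p)) - ZR (lob_fix (Zpos p) (- L)%binz) / (10 ^+ 12 * sigma)| <= 10 ^- 12.
Proof. by move=> h1 h2 h3 h4; apply: lob_fixP h1 (ln_le1_dec12 h2 h3 h4). Qed.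

Let lob_c : `|lobachevsky (dec12 val_c) - ZR (lob_fix val_c Lc) / (10 ^+ 12 * sigma)| <= 10 ^- 12.
Proof. by apply: lob_valE; vm_compute. Qed.
Let lob_cp : `|lobachevsky (dec12 val_cp) - ZR (lob_fix val_cp Lcp) / (10 ^+ 12 * sigma)| <= 10 ^- 12.
Proof. by apply: lob_valE; vm_compute. Qed.
Let lob_cm : `|lobachevsky (dec12 val_cm) - ZR (lob_fix val_cm (- Lcm)%binz) / (10 ^+ 12 * sigma)| <= 10 ^- 12.
Proof. by apply: lob_valEn; vm_compute. Qed.
Let lob_d : `|lobachevsky (dec12 val_d) - ZR (lob_fix val_d Ld) / (10 ^+ 12 * sigma)| <= 10 ^- 12.
Proof. by apply: lob_valE; vm_compute. Qed.
Let lob_dp : `|lobachevsky (dec12 val_dp) - ZR (lob_fix val_dp Ldp) / (10 ^+ 12 * sigma)| <= 10 ^- 12.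
Proof. by apply: lob_valE; vm_compute. Qed.
Let lob_dm : `|lobachevsky (dec12 val_dm) - ZR (lob_fix val_dm (- Ldm)%binz) / (10 ^+ 12 * sigma)| <= 10 ^- 12.
Proof. by apply: lob_valEn; vm_compute. Qed.

Let near (x y e : R) : `|x - y| <= e -> y - e <= x /\ x <= y + e.
Proof. by rewrite ler_distl => /andP. Qed.

Let sum3_ge k (a b c : Z) : (BinInt.Z.of_nat k * S <= a + (b + c))%binz ->
  k%:R * 10 ^- 12 <= ZR a / (10 ^+ 12 * sigma) + (ZR b / (10 ^+ 12 * sigma) + ZR c / (10 ^+ 12 * sigma)).
Proof.
move=> /(ZR_le R); rewrite !ZRD ZRM ZR_nat => h; have s0 := ZR_pos R scale.
rewrite -!mulrDl ler_pdivlMr ?mulr_gt0 ?exprn_gt0//; apply: le_trans h.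
by rewrite mulrA mulfVK// expf_neq0.
Qed.

Let sum3_le k (a b c : Z) : (a + (b + c) <= - (BinInt.Z.of_nat k * S))%binz ->
  ZR a / (10 ^+ 12 * sigma) + (ZR b / (10 ^+ 12 * sigma) + ZR c / (10 ^+ 12 * sigma)) <= - (k%:R * 10 ^- 12).
Proof.
move=> /(ZR_le R); rewrite !ZRD ZRN ZRM ZR_nat => h; have s0 := ZR_pos R scale.
rewrite -!mulrDl ler_pdivrMr ?mulr_gt0 ?exprn_gt0//; apply: le_trans h _.
by rewrite mulNr mulrA mulfVK// expf_neq0.
Qed.

Let sum2_ge (a b : Z) : (131 * (zpow 10 9 * S) <= a + b)%binz ->
  131 / 10 ^+ 3 <= ZR a / (10 ^+ 12 * sigma) + ZR b / (10 ^+ 12 * sigma).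
Proof.
move=> /(ZR_le R); rewrite ZRD (ZRM R (Zpos _)) (ZRM R (zpow _ _)) zpowE (ZR_nat R 10) (ZR_nat R 131) => h.
have s0 := ZR_pos R scale.
rewrite -mulrDl ler_pdivlMr ?mulr_gt0 ?exprn_gt0//; apply: le_trans h.
rewrite -[12%N]/(3 + 9)%N exprD; move: (10 ^+ 9) sigma => e s.
by rewrite (_ : 131 / 10 ^+ 3 * (10 ^+ 3 * e * s) = 131 * (e * s))//; field.
Qed.

Let i12 : 0 < 10 ^- 12 :> R.
Proof. by rewrite invr_gt0 exprn_gt0. Qed.

Let comb (x y z X Y Z i : R) : 0 < i -> 5 * i <= x + (y + z) -> x - i <= X ->
  y - i <= Y -> z - i <= Z -> 0 < X + (Y + Z).
Proof. lra. Qed.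

Let comb' (x y z X Y Z i : R) : x + (y + z) <= - (25 * i) -> X <= x + i ->
  Y <= y + i -> Z <= z + i -> X + (Y + Z) <= - (20 * i) - 2 * i.
Proof. lra. Qed.

Let comb2 (y z Y Z i : R) : 131 / 10 ^+ 3 <= y + z -> i <= 1 / 10000 ->
  y - i <= Y -> z - i <= Z -> 13 / 100 <= Y + Z.
Proof. by rewrite (_ : 10 ^+ 3 = 1000); [lra|ring]. Qed.

(** A computed sum of at least [5 * 10^-12] outweighs three errors of [10^-12]. *)
Lemma lobachevsky_sum_c :
  0 < lobachevsky (dec12 val_c) + (lobachevsky (dec12 val_cp) + lobachevsky (dec12 val_cm)).
Proof.
have k := @sum3_ge 5 (lob_fix val_c Lc) (lob_fix val_cp Lcp) (lob_fix val_cm (- Lcm)%binz) ltac:(by vm_compute).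
exact: comb i12 k (near lob_c).1 (near lob_cp).1 (near lob_cm).1.
Qed.

(** The margin [2 / 10^11] is there to absorb the effect of the error on [theta_fig8] at [val_d]. *)
Lemma lobachevsky_sum_d :
  lobachevsky (dec12 val_d) + (lobachevsky (dec12 val_dp) + lobachevsky (dec12 val_dm)) <= - (2 / 10 ^+ 11).
Proof.
have k := @sum3_le 25 (lob_fix val_d Ld) (lob_fix val_dp Ldp) (lob_fix val_dm (- Ldm)%binz) ltac:(by vm_compute).
apply: le_trans (comb' k (near lob_d).2 (near lob_dp).2 (near lob_dm).2) _.
rewrite pow10_11; move: i12; move: (10 ^- 12) => i; lra.
Qed.

(** Gives a volume of at least [26/100] at [val_d], above the exponent [1/4] on which the comparison
    of the two blocks relies. *)
Lemma lobachevsky_volume_d :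
  13 / 100 <= lobachevsky (dec12 val_dp) + lobachevsky (dec12 val_dm).
Proof.
have k := @sum2_ge (lob_fix val_dp Ldp) (lob_fix val_dm (- Ldm)%binz) ltac:(by vm_compute).
have i4 : 10 ^- 12 <= 1 / 10000 :> R.
  have -> : 1 / 10000 = 10 ^- 4 :> R by rewrite mul1r; congr (_^-1); ring.
  by rewrite lef_pV2 ?posrE ?exprn_gt0// ler_weXn2l//; lra.
have [h2 _] := near lob_dp; have [h3 _] := near lob_dm.
exact: comb2 k i4 h2 h3.
Qed.


End lobachevsky_values.

(** * The volume as a function of the cone angle *)

Section cone_sum.
Variable R : realType.
Implicit Types a b t : R.
Notation Lob := (@lobachevsky R).

Definition cone_sum a t : R := Lob (t + a / 2) + Lob (t - a / 2).

Lemma is_derive1_lobachevsky (f : R -> R) (x d : R) : 0 < f x < pi -> is_derive x 1 f d ->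
  is_derive x 1 (fun t => Lob (f t)) (- ln (2 * sin (f x)) * d).
Proof. by move=> fx fd; apply: is_derive1_comp_cst => //; exact: is_derive_lobachevsky. Qed.


Lemma cos_antitone (x y : R) : 0 <= x -> x <= y -> y <= pi -> cos y <= cos x.
Proof.
move=> x0 xy yp; rewrite leNgt ltr_cos ?in_itv/= -?leNgt//.
  by rewrite (le_trans x0 xy).
by rewrite x0 (le_trans xy yp).
Qed.

(* [cos 3x = 4 cos^3 x - 3 cos x] and [4 c^3 - 3 c + 1 = (c + 1) (2 c - 1)^2]. *)
Lemma cos_pi3 : cos (pi / 3 : R) = 1 / 2.
Proof.
have p0 := pi_gt0 R; set x := pi / 3; set c := cos x.
have e : cos (x + x + x) = -1 by rewrite -cospi; congr cos; rewrite /x; field.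
rewrite cosD cosD sinD in e.
have e2 : (c + 1) * (2 * c - 1) ^+ 2 = 0.
  have s2 : sin x ^+ 2 = 1 - c ^+ 2 by rewrite sin2cos2.
  have -> : (c + 1) * (2 * c - 1) ^+ 2 = (c * c - sin x * sin x) * c - (sin x * c + c * sin x) * sin x + 1
     + 3 * c * (sin x ^+ 2 - (1 - c ^+ 2)) by ring.
  by rewrite s2 subrr mulr0 addr0 /c e addrC subrr.
have c0 : 0 < c.
  by apply: cos_gt0_pihalf; apply/andP; split; rewrite /x; lra.
move/eqP: e2; rewrite mulf_eq0 sqrf_eq0 gt_eqF ?addr_gt0//= subr_eq0 => /eqP h.
by move: h; rewrite -/c; lra.
Qed.

Lemma cos_2pi3 : cos (2 * pi / 3 : R) = - (1 / 2).
Proof.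
have -> : 2 * pi / 3 = pi - pi / 3 :> R by field.
by rewrite cosB cospi sinpi mul0r addr0 mulN1r cos_pi3.
Qed.

Lemma cos_gt_half a : 0 <= a < 2 * pi / 3 -> - (1 / 2) < cos a.
Proof.
move=> /andP[a0 a1]; have p0 := pi_gt0 R; rewrite -cos_2pi3.
by rewrite ltr_cos ?in_itv/=; [|apply/andP; split; lra..].
Qed.

Lemma cos_theta_fig8 a : 0 <= a < 2 * pi / 3 -> cos (2 * theta_fig8 a) = cos a - 1 / 2.
Proof.
move=> ha; rewrite /theta_fig8 mulrC divfK// acosK// in_itv /=.
have c1 := cos_le1 a; have c2 := cos_gt_half ha; lra.
Qed.

Lemma theta_fig8_bounds a : 0 <= a < 2 * pi / 3 -> a / 2 < theta_fig8 a < pi / 2 /\ pi / 6 <= theta_fig8 a.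
Proof.
move=> ha; have [a0 a1] := andP ha; have p0 := pi_gt0 R.
have c1 := cos_le1 a; have c2 := cos_gt_half ha.
have e := cos_theta_fig8 ha.
have t0 : 0 <= 2 * theta_fig8 a <= pi.
  by rewrite /theta_fig8 mulrC divfK// acos_ge0 ?acos_lepi; lra.
have h1 : a < 2 * theta_fig8 a.
  by rewrite -ltr_cos ?in_itv/= ?t0 ?e//; [lra|apply/andP; split; lra].
have h2 : 2 * theta_fig8 a < pi.
  by rewrite -ltr_cos ?in_itv/= ?t0 ?e ?cospi//; [lra|apply/andP; split; lra].
have h3 : pi / 3 <= 2 * theta_fig8 a.
  rewrite leNgt -ltr_cos ?in_itv/= ?t0 ?e ?cos_pi3//; [lra|apply/andP; split; lra].
split; [apply/andP; split; lra|lra].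
Qed.

Definition dcone_sum a t : R := - ln (2 * (cos a - cos (2 * t))).

Lemma is_derive_cone_sum a t : 0 < t - a / 2 < pi -> 0 < t + a / 2 < pi ->
  is_derive t 1 (cone_sum a) (dcone_sum a t).
Proof.
move=> h1 h2.
have s1 := sin_gt0_pi h1; have s2 := sin_gt0_pi h2.
have d1 := is_derive1_add (is_derive1_id t) (is_derive1_cst (a / 2) t).
have d2 := is_derive1_add (is_derive1_id t) (is_derive1_cst (- (a / 2)) t).
have h := is_derive1_add (@is_derive1_lobachevsky (fun t => t + a / 2) _ _ h2 d1)
  (@is_derive1_lobachevsky (fun t => t - a / 2) _ _ h1 d2).
apply: is_derive1_eq (h : is_derive t 1 (cone_sum a) _) _.
rewrite addr0 !mulr1 -opprD -lnM ?posrE ?mulr_gt0// /dcone_sum; congr (- ln _).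
rewrite cos_sub.
have -> : (a + 2 * t) / 2 = t + a / 2 by field.
have -> : (2 * t - a) / 2 = t - a / 2 by field.
ring.
Qed.

(** The derivative [- ln (2 (cos a - cos 2t))] vanishes where [cos 2t = cos a - 1/2], that is at
    [theta_fig8 a], and changes from positive to negative there. *)
Lemma cone_sum_max a t : 0 <= a < 2 * pi / 3 -> a / 2 < t <= pi / 2 ->
  cone_sum a t <= cone_sum a (theta_fig8 a).
Proof.
move=> ha /andP[t1 t2]; have [/andP[h1 h2] h3] := theta_fig8_bounds ha; have [a0 a1] := andP ha.
have p0 := pi_gt0 R; have e := cos_theta_fig8 ha.
have dom x : a / 2 < x <= pi / 2 -> 0 < x - a / 2 < pi /\ 0 < x + a / 2 < pi.
  by move=> /andP[x1 x2]; split; apply/andP; split; lra.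
have pos x : a / 2 < x <= pi / 2 -> 0 < 2 * (cos a - cos (2 * x)).
  move=> /andP[x1 x2]; rewrite mulr_gt0// subr_gt0 ltr_cos ?in_itv/=; [lra|apply/andP; split; lra..].
have [tt|tt] := leP t (theta_fig8 a).
  apply: (@derive_ge0_le _ _ (dcone_sum a)) => // x /andP[x1 x2].
    by have [? ?] := dom x ltac:(apply/andP; split; lra); exact: is_derive_cone_sum.
  rewrite oppr_ge0 ln_le0//.
  have : cos (2 * theta_fig8 a) <= cos (2 * x).
    by apply: cos_antitone; lra.
  by rewrite e; lra.
have h := @derive_ge0_le _ (fun x => - cone_sum a x) (fun x => - dcone_sum a x) _ _ (ltW tt).
have : - cone_sum a (theta_fig8 a) <= - cone_sum a t.
  apply: h => x /andP[x1 x2].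
    by have [? ?] := dom x ltac:(apply/andP; split; lra); apply: is_derive1_opp; exact: is_derive_cone_sum.
  rewrite opprK ln_ge0//.
  have : cos (2 * x) <= cos (2 * theta_fig8 a).
    by apply: cos_antitone; lra.
  by rewrite e; lra.
by rewrite lerN2.
Qed.

Lemma cone_sum_antitone a b t : 0 <= a <= b -> b < 2 * pi / 3 -> b / 2 < t <= pi / 2 ->
  cone_sum b t <= cone_sum a t.
Proof.
move=> /andP[a0 ab] b1 /andP[t1 t2]; have p0 := pi_gt0 R.
pose g (x : R) := - (Lob (t + x / 2) + Lob (t + - (x / 2))).
pose dg (x : R) := - (- ln (2 * sin (t + x / 2)) * (1 / 2) + - ln (2 * sin (t + - (x / 2))) * - (1 / 2)).
have : g a <= g b; last by rewrite /g /cone_sum lerN2.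
apply: (@derive_ge0_le _ g dg) => // x /andP[x1 x2].
  have e0 : 0 * x + 1 / 2 * 1 = 1 / 2 :> R by ring.
  have dx : is_derive x 1 (fun y : R => y / 2) (1 / 2).
    apply: is_derive1_eq (is_derive1_mul (is_derive1_id x) (is_derive1_cst 2^-1 x)) _; ring.
  have d1 : is_derive x 1 (fun y : R => t + y / 2) (1 / 2).
    by apply: is_derive1_eq (is_derive1_add (is_derive1_cst t x) dx) _; rewrite add0r.
  have d2 : is_derive x 1 (fun y : R => t + - (y / 2)) (- (1 / 2)).
    by apply: is_derive1_eq (is_derive1_add (is_derive1_cst t x) (is_derive1_opp dx)) _; rewrite add0r.
  apply: is_derive1_opp; apply: is_derive1_add; apply: is_derive1_lobachevsky => //; apply/andP; split; lra.
have s1 : 0 < sin (t + - (x / 2)) by apply: sin_gt0_pi; apply/andP; split; lra.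
have : ln (2 * sin (t + - (x / 2))) <= ln (2 * sin (t + x / 2)).
  have h : sin (t - x / 2) <= sin (t + x / 2).
    rewrite -subr_ge0 sinD sinB.
    have -> : sin t * cos (x / 2) + cos t * sin (x / 2) - (sin t * cos (x / 2) - cos t * sin (x / 2)) = 2 * (cos t * sin (x / 2)) by ring.
    rewrite mulr_ge0// mulr_ge0//.
      by apply: cos_ge0_pihalf; apply/andP; split; lra.
    by apply: sin_ge0_pi; apply/andP; split; lra.
  by rewrite ler_ln ?posrE ?mulr_gt0// ?ler_pM2l// (lt_le_trans s1 h).
rewrite /dg; lra.
Qed.

Definition cone_vol a : R := 2 * cone_sum a (theta_fig8 a).

(** Envelope argument without differentiating [theta_fig8]: at the fixed point [theta_fig8 b] the
    sum decreases with the angle, and its value there for the angle [a] is at most the maximum. *)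
Lemma cone_vol_antitone a b : 0 <= a <= b -> b < 2 * pi / 3 -> cone_vol b <= cone_vol a.
Proof.
move=> /andP[a0 ab] b1; rewrite ler_pM2l//.
have hb : 0 <= b < 2 * pi / 3 by rewrite b1 (le_trans a0 ab).
have [/andP[h1 h2] h3] := theta_fig8_bounds hb.
apply: (@le_trans _ _ (cone_sum a (theta_fig8 b))).
  by apply: cone_sum_antitone => //; rewrite ?a0 ?ab// h1 ltW.
by apply: cone_sum_max; [rewrite a0 (le_lt_trans ab b1)|apply/andP; split; lra].
Qed.

Lemma lobachevsky_antitone a b : pi / 6 <= a -> a <= b -> b <= 5 * pi / 6 -> Lob b <= Lob a.
Proof.
move=> a0 ab b1; have p0 := pi_gt0 R.
rewrite -lerN2; apply: (@derive_ge0_le _ (fun x => - Lob x) (fun x => - - ln (2 * sin x))) => // x /andP[x1 x2].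
  by apply: is_derive1_opp; apply: is_derive_lobachevsky; apply/andP; split; lra.
rewrite opprK ln_ge0//.
have : 1 / 2 <= sin x; last by lra.
rewrite -cosBpihalf -cos_pi3 -(cosN (x - _)).
have [xx|xx] := leP x (pi / 2).
  by apply: cos_antitone; lra.
by rewrite cosN; apply: cos_antitone; lra.
Qed.

End cone_sum.

(** * Effect of an error on the critical angle *)

Section theta_error.
Variable R : realType.

Lemma pi_gt3 : 3 < pi :> R.
Proof. have := pi_gt_314 R; lra. Qed.

Lemma pi_lt4 : pi < 4 :> R.
Proof. have := pi_lt_315 R; lra. Qed.

Lemma theta_fig8_near (d t ep : R) : 17 / 10 <= d <= 18 / 10 -> 11 / 10 <= t <= 12 / 10 ->
  0 < ep <= 1 / 100 -> cos (2 * (t + ep)) <= cos d - 1 / 2 -> cos d <= cos (2 * (t - ep)) + 1 / 2 ->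
  `|theta_fig8 d - t| <= ep.
Proof.
move=> /andP[d1 d2] /andP[t1 t2] /andP[e0 e1] h1 h2.
have p3 := pi_gt3.
have hd : 0 <= d < 2 * pi / 3 by apply/andP; split; lra.
have [/andP[b1 b2] b3] := theta_fig8_bounds hd.
have e := cos_theta_fig8 hd.
rewrite ler_distl; apply/andP; split.
- have : 2 * (t - ep) <= 2 * theta_fig8 d; last by lra.
  rewrite leNgt -ltr_cos ?in_itv/= -?leNgt; first by rewrite e; lra.
  + by apply/andP; split; lra.
  + by apply/andP; split; lra.
- have : 2 * theta_fig8 d <= 2 * (t + ep); last by lra.
  rewrite leNgt -ltr_cos ?in_itv/= -?leNgt; first by rewrite e; lra.
  + by apply/andP; split; lra.
  + by apply/andP; split; lra.
Qed.

(* [theta_fig8 d] maximizes [cone_sum d], so an error on it only costs a quadratically small amount. *)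
Lemma cone_sum_near (d t ep : R) : 17 / 10 <= d <= 18 / 10 -> 11 / 10 <= t <= 12 / 10 ->
  0 < ep <= 1 / 100 -> `|theta_fig8 d - t| <= ep -> cone_sum d (theta_fig8 d) <= cone_sum d t + 8 * ep * ep.
Proof.
move=> /andP[d1 d2] /andP[t1 t2] /andP[ep0 ep1] ht.
have p3 := pi_gt3.
have hd : 0 <= d < 2 * pi / 3 by apply/andP; split; lra.
have [/andP[b1 b2] b3] := theta_fig8_bounds hd.
have e := cos_theta_fig8 hd.
set th := theta_fig8 d in ht b1 b2 b3 e *; clearbody th.
have th1 : 109 / 100 <= th <= 121 / 100 by move: ht; rewrite ler_distl => /andP[? ?]; apply/andP; split; lra.
(* At [th] the argument of the logarithm is [1]; within distance [ep] it is [1 + y] with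
   [|y| <= 4 ep], so the logarithm is at most [8 ep] in absolute value. *)
have db x : `|th - x| <= ep -> `|dcone_sum d x| <= 8 * ep.
  move=> hx; rewrite /dcone_sum normrN.
  have -> : 2 * (cos d - cos (2 * x)) = 1 + 2 * (cos (2 * th) - cos (2 * x)) by rewrite e; field.
  have : `|2 * (cos (2 * th) - cos (2 * x))| <= 4 * ep.
    rewrite normrM (gtr0_norm (x := 2))//.
    have := cos_lipschitz (2 * th) (2 * x); rewrite -mulrBr normrM (gtr0_norm (x := 2))//; lra.
  move: (2 * (cos (2 * th) - cos (2 * x))) => y; rewrite ler_norml => /andP[y1 y2].
  rewrite ler_norml; apply/andP; split.
    have y3 : 0 < 1 + y by lra.
    have h := @le_ln1Dx R ((1 + y)^-1 - 1).
    rewrite (_ : 1 + ((1 + y)^-1 - 1) = (1 + y)^-1) ?lnV ?posrE// in h; last by ring.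
    have y4 : 0 < (1 + y)^-1 by rewrite invr_gt0.
    have := h ltac:(lra) => k.
    have : (1 + y)^-1 <= 1 + 8 * ep.
      rewrite -[leLHS]mul1r ler_pdivrMr//; nra.
    lra.
  have := @le_ln1Dx R y ltac:(lra); lra.
have dom x : `|th - x| <= ep -> is_derive x 1 (cone_sum d) (dcone_sum d x).
  rewrite ler_distl => /andP[x1 x2]; have /andP[u1 u2] := th1.
  have q1 : 0 < x - d / 2 < pi by apply/andP; split; lra.
  have q2 : 0 < x + d / 2 < pi by apply/andP; split; lra.
  exact: (is_derive_cone_sum q1 q2).
have fin : `|cone_sum d th - cone_sum d t| <= 8 * ep * ep.
  have M0 : 0 <= 8 * ep by rewrite mulr_ge0// ltW.
  have [tt|tt] := leP t th.
    apply: (@le_trans _ _ (8 * ep * (th - t))).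
      apply: derive_lipschitz => // x /andP[x1 x2]; [apply: dom|apply: db];
      move: ht; rewrite !ler_distl => /andP[? ?]; apply/andP; split; lra.
    by apply: ler_wpM2l => //; move: ht; rewrite ler_distl => /andP[? ?]; lra.
  rewrite distrC; apply: (@le_trans _ _ (8 * ep * (t - th))).
    apply: derive_lipschitz; first exact: ltW.
      by move=> x /andP[x1 x2]; apply: dom; move: ht; rewrite !ler_distl => /andP[? ?]; apply/andP; split; lra.
    by move=> x /andP[x1 x2]; apply: db; move: ht; rewrite !ler_distl => /andP[? ?]; apply/andP; split; lra.
  by apply: ler_wpM2l => //; move: ht; rewrite ler_distl => /andP[? ?]; lra.
move: fin; rewrite ler_norml => /andP[_]; lra.
Qed.

End theta_error.

(** * Bracketing of the critical cone angle *)

Section alpha0_numerics.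
Variable R : realType.
Notation ZR := (@ZR R). Notation ev := (@ev R).
Notation dec12 := (@dec12 R).
Notation Lob := (@lobachevsky R).
Local Notation S := (Zpos scale).
Local Notation sigma := (ZR S).

(** The cosine is expanded in [x^2 / 16], which stays below [17/32] for [x <= 29/10]. *)
Definition cosz k : Z := (zsign k (S * zpow 16 k) / Zpos (pfact k.*2))%binz.
Definition cos_fix (X : Z) : Z := ev_sq 16 (Zpos tera) X (mkseq cosz 16).

Lemma cos_tail n m (w : R) : (S * zpow 17 n <= zpow 2 n * Zpos (pfact m))%binz ->
  0 <= w <= 17 / 2 -> sigma * (w ^+ n / m`!%:R) <= 1.
Proof.
move=> /(ZR_le R); rewrite !ZRM !zpowE pfactE (ZR_nat R 17) (ZR_nat R 2) => h /andP[w0 w1].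
have f0 : 0 < m`!%:R :> R by rewrite ltr0n fact_gt0.
rewrite mulrA ler_pdivrMr// mul1r.
have w2 : w ^+ n <= (17 / 2) ^+ n by rewrite lerXn2r// nnegrE; lra.
have s0 := ZR_pos R scale.
apply: le_trans (ler_wpM2l (ltW s0) w2) _.
by rewrite expr_div_n mulrA ler_pdivrMr ?exprn_gt0// [leRHS]mulrC.
Qed.

Lemma cosz_deriv_ub : ZR (ev_ub (pderiv (mkseq cosz 16))) <= 30 * sigma.
Proof.
have h : (ev_ub (pderiv (mkseq cosz 16)) <= 30 * S)%binz by vm_compute.
by have := ZR_le R h; rewrite (ZRM R (Zpos _)) (ZR_nat R 30).
Qed.

Definition cos_range (X : Z) : bool := (0 <= X)%binz && (X <= 2 * Zpos tera + 9 * zpow 10 11)%binz.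

Lemma dec12D a b : dec12 (a + b)%binz = dec12 a + dec12 b.
Proof. by rewrite /dec12 ZRD mulrDl. Qed.

Lemma dec12N a : dec12 (- a)%binz = - dec12 a.
Proof. by rewrite /dec12 ZRN mulNr. Qed.

Lemma dec12M2 a : dec12 (2 * a)%binz = 2 * dec12 a.
Proof. by rewrite /dec12 ZRM (ZR_nat R 2) mulrA. Qed.

Lemma dec12_le a b : (a <= b)%binz -> dec12 a <= dec12 b.
Proof. by move=> /(ZR_le R) h; rewrite /dec12 ler_wpM2r// invr_ge0 exprn_ge0. Qed.

Lemma dec12_pow k e : (e <= 12)%N -> dec12 (BinInt.Z.of_nat k * zpow 10 e)%binz = k%:R / 10 ^+ (12 - e).
Proof.
move=> he; rewrite /dec12 ZRM zpowE ZR_nat (ZR_nat R 10).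
have -> : 10 ^+ 12 = 10 ^+ (12 - e) * 10 ^+ e :> R by rewrite -exprD subnK.
by field; rewrite !expf_neq0 ?pnatr_eq0.
Qed.

(** The error is at most [33 + 3 + 1]: [ev_sqP] with [K = 30], the rounded coefficients and the
    Taylor remainder. *)
Lemma cos_fixP X : cos_range X -> `|sigma * cos (dec12 X) - ZR (cos_fix X)| <= 40.
Proof.
move=> /andP[/dec12_le h0 /dec12_le h1].
have x0 : 0 <= dec12 X by move: h0; rewrite {1}/dec12 ZR0 mul0r.
have x1 : dec12 X <= 29 / 10.
  move: h1; rewrite dec12D dec12M2 (@dec12_pow 9 11)// (_ : dec12 (Zpos tera) = 1); first by rewrite expr1; lra.
  by rewrite /dec12 teraE divff// expf_neq0 ?pnatr_eq0.
move: x0 x1; set x := dec12 X => x0 x1.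
have x2 : x ^+ 2 <= 17 / 2.
  by apply: (@le_trans _ _ (29 / 10 * (29 / 10))); [rewrite expr2; apply: ler_pM|lra].
have q16 : ZR (Zpos (xO (xO (xO (xO xH))))) = 16 := ZR_nat R 16.
have vr : 0 <= x ^+ 2 / 16 <= 17 / 32 by rewrite divr_ge0 ?sqr_ge0//= ler_pdivrMr//; lra.
have hc k : `|ZR (cosz k) - sigma * ((-1) ^+ k * 16 ^+ k / (k.*2)`!%:R)| <= 1.
  have h := ZR_div_near R (zsign k (S * zpow 16 k)%binz) (pfact k.*2).
  rewrite zsignE ZRM zpowE (ZR_nat R 16) pfactE in h.
  by rewrite (_ : sigma * _ = (-1) ^+ k * (sigma * 16 ^+ k) / (k.*2)`!%:R) //; ring.
have aE : x = ZR X / ZR (Zpos tera) by rewrite teraE.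
have h3 := @ev_sqP R (xO (xO (xO (xO xH)))) tera X (mkseq cosz 16) 30 x aE.
rewrite q16 in h3; have {}h3 := h3 (andP vr).2 cosz_deriv_ub.
have h4 := ev_mkseqP 16 vr hc.
have h5 := cos_sum_bound 15 x0.
have cE : cos_sum 16 x = \sum_(k < 16) (-1) ^+ k * 16 ^+ k / (k.*2)`!%:R * (x ^+ 2 / 16) ^+ k.
  apply: eq_bigr => k _; have -> : x ^+ k.*2 = (x ^+ 2) ^+ k by rewrite -exprM mul2n.
  rewrite (expr_div_n (x ^+ 2) 16); have : 16 ^+ k != 0 :> R by rewrite expf_neq0 ?pnatr_eq0.
  have : (k.*2)`!%:R != 0 :> R by rewrite pnatr_eq0 -lt0n fact_gt0.
  move: (16 ^+ k : R) ((x ^+ 2) ^+ k) ((k.*2)`!%:R : R) => y z f f0 y0; field.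
  by rewrite f0 y0.
rewrite -cE in h4; move: h3 h4 h5; rewrite -/(cos_fix X); set P := ev _ _; set F := cos_sum _ _; set Q := ZR (cos_fix X) => h3 h4 h5.
have s0 := ZR_pos R scale.
have h6 : sigma * `|F - cos x| <= 1.
  apply: le_trans (ler_wpM2l (ltW s0) h5) _; rewrite -mul2n exprM.
  by apply: cos_tail; [vm_compute|rewrite sqr_ge0].
have -> : sigma * cos x - Q = (P - Q) - ((P - sigma * F) + sigma * (F - cos x)) by ring.
apply: le_trans (ler_normB _ _) _; have := ler_normD (P - sigma * F) (sigma * (F - cos x)).
rewrite normrM (gtr0_norm s0); lra.
Qed.

Lemma cos_le_check X Y s : cos_range X -> cos_range Y ->
  (2 * (cos_fix X + 80) <= 2 * cos_fix Y + s * S)%binz ->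
  cos (dec12 X) <= cos (dec12 Y) + ZR s / 2.
Proof.
move=> /cos_fixP hX /cos_fixP hY /(ZR_le R).
rewrite (ZRD R (2 * _)%binz) !ZRM ZRD (ZR_nat R 2) (ZR_nat R 80).
move: hX hY; rewrite !ler_distl => /andP[_ h1] /andP[h2 _] h3; have s0 := ZR_pos R scale.
rewrite -(ler_pM2l s0) mulrDr; lra.
Qed.

Definition val_t := 1168061000000%binz.
Definition val_eps := 100000%binz.

Lemma val_cE : dec12 val_c = 1 + 764 / 10 ^+ 3 + 782 / 10 ^+ 6 + 617 / 10 ^+ 9 + 4 / 10 ^+ 10.
Proof.
have -> : val_c = (BinInt.Z.of_nat 1 * zpow 10 12 + BinInt.Z.of_nat 764 * zpow 10 9 + BinInt.Z.of_nat 782 * zpow 10 6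
  + BinInt.Z.of_nat 617 * zpow 10 3 + BinInt.Z.of_nat 4 * zpow 10 2)%binz by vm_compute.
by rewrite !dec12D !dec12_pow// expr0 divr1.
Qed.

Lemma val_dE : dec12 val_d = dec12 val_c + 9 / 10 ^+ 11.
Proof. by rewrite -(@dec12_pow 9 1)// -dec12D. Qed.

Lemma dec12_half a b c : (2 * a)%binz = (2 * b + c)%binz -> dec12 a = dec12 b + dec12 c / 2.
Proof. by move=> h; have := congr1 dec12 h; rewrite dec12D !dec12M2; lra. Qed.

Lemma val_dpE : dec12 val_dp = dec12 val_t + dec12 val_d / 2.
Proof. exact: (@dec12_half val_dp val_t val_d erefl). Qed.
Lemma val_dmE : dec12 val_dm = dec12 val_t - dec12 val_d / 2.
Proof. by rewrite (@dec12_half val_dm val_t (- val_d)%binz erefl) dec12N mulNr. Qed.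
Lemma val_cpE : dec12 val_cp = dec12 val_t + dec12 val_c / 2.
Proof. exact: (@dec12_half val_cp val_t val_c erefl). Qed.
Lemma val_cmE : dec12 val_cm = dec12 val_t - dec12 val_c / 2.
Proof. by rewrite (@dec12_half val_cm val_t (- val_c)%binz erefl) dec12N mulNr. Qed.

Let bnd (x : Z) (a b : nat) : (BinInt.Z.of_nat a * zpow 10 11 <= x)%binz ->
  (x <= BinInt.Z.of_nat b * zpow 10 11)%binz -> a%:R / 10 <= dec12 x <= b%:R / 10.
Proof. by move=> /dec12_le + /dec12_le; rewrite !dec12_pow// expr1 => -> ->. Qed.

Lemma val_d_bounds : 17 / 10 <= dec12 val_d <= 18 / 10.
Proof. by apply: (@bnd val_d 17 18); vm_compute. Qed.
Lemma val_c_bounds : 17 / 10 <= dec12 val_c <= 18 / 10.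
Proof. by apply: (@bnd val_c 17 18); vm_compute. Qed.
Lemma val_t_bounds : 11 / 10 <= dec12 val_t <= 12 / 10.
Proof. by apply: (@bnd val_t 11 12); vm_compute. Qed.

Lemma theta_val_d : `|theta_fig8 (dec12 val_d) - dec12 val_t| <= 10 ^- 7.
Proof.
have e0 : 0 < (10 ^- 7 : R) <= 1 / 100.
  have -> : 1 / 100 = 10 ^- 2 :> R by field.
  by rewrite invr_gt0 exprn_gt0//= lef_pV2 ?posrE ?exprn_gt0// ler_weXn2l//; lra.
have eE : dec12 val_eps = 10 ^- 7 by rewrite (@dec12_pow 1 5)// mul1r.
apply: theta_fig8_near => //; [exact: val_d_bounds|exact: val_t_bounds|..].
- have k : dec12 (2 * (val_t + val_eps))%binz = 2 * (dec12 val_t + 10 ^- 7).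
    by rewrite (dec12M2 (val_t + val_eps)%binz) (dec12D val_t) eE.
  have := @cos_le_check (2 * (val_t + val_eps))%binz val_d (- 1)%binz ltac:(by vm_compute) ltac:(by vm_compute) ltac:(by vm_compute).
  by rewrite k (ZRN R (Zpos xH)) ZR1 mulNr.
- have k : dec12 (2 * (val_t + - val_eps))%binz = 2 * (dec12 val_t - 10 ^- 7).
    by rewrite (dec12M2 (val_t + - val_eps)%binz) (dec12D val_t) (dec12N val_eps) eE.
  have := @cos_le_check val_d (2 * (val_t + - val_eps))%binz 1%binz ltac:(by vm_compute) ltac:(by vm_compute) ltac:(by vm_compute).
  by rewrite k ZR1.
Qed.

Lemma cone_vol_val_d : 26 / 100 <= cone_vol (dec12 val_d).
Proof.
have comb (x y : R) : 13 / 100 <= x -> x <= y -> 26 / 100 <= 2 * y by lra.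
have hd : 0 <= dec12 val_d < 2 * pi / 3 /\ dec12 val_d / 2 < dec12 val_t <= pi / 2.
  move: val_d_bounds val_t_bounds; move: (dec12 val_d) (dec12 val_t) => d t /andP[d1 d2] /andP[t1 t2].
  have p3 := pi_gt3 R; split; apply/andP; split; lra.
have h1 := cone_sum_max hd.1 hd.2; have h2 := lobachevsky_volume_d R.
rewrite val_dpE val_dmE in h2.
exact: comb h2 h1.
Qed.

(** Bounding a maximum from above requires locating it: [theta_val_d] puts it within [10^-7] of
    [val_t], which costs [8 * 10^-14] in [cone_sum]. *)
Lemma cone_vol_val_d_le : cone_vol (dec12 val_d) + 2 * Lob (dec12 val_d) <= 0.
Proof.
have e7 : 0 < (10 ^- 7 : R) <= 1 / 100.
  have -> : 1 / 100 = 10 ^- 2 :> R by field.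
  by rewrite invr_gt0 exprn_gt0//= lef_pV2 ?posrE ?exprn_gt0// ler_weXn2l//; lra.
have h1 := cone_sum_near val_d_bounds val_t_bounds e7 theta_val_d.
have h2 := lobachevsky_sum_d R.
rewrite val_dpE val_dmE in h2.
have comb (F G D : R) : F <= G + 8 * 10 ^- 7 * 10 ^- 7 -> D + G <= - (2 / 10 ^+ 11) -> 2 * F + 2 * D <= 0.
  have -> : 8 * 10 ^- 7 * 10 ^- 7 = 8 / 10 ^+ 3 * 10 ^- 11 :> R.
    by rewrite -!mulrA -!invfM -!exprD.
  have : 0 < 10 ^- 11 :> R by rewrite invr_gt0// exprn_gt0.
  have : 8 / 10 ^+ 3 <= 1 :> R by rewrite ler_pdivrMr ?exprn_gt0//; lra.
  move: (10 ^- 11) (8 / 10 ^+ 3) => e w; nra.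
exact: comb h1 h2.
Qed.

(** For a lower bound, [cone_sum_max] passes from the value at [val_t] to the maximum without
    loss. *)
Lemma cone_vol_val_c_gt : 0 < cone_vol (dec12 val_c) + 2 * Lob (dec12 val_c).
Proof.
have comb (A B C : R) : 0 < A + B -> B <= C -> 0 < 2 * C + 2 * A by lra.
have hd : 0 <= dec12 val_c < 2 * pi / 3 /\ dec12 val_c / 2 < dec12 val_t <= pi / 2.
  move: val_c_bounds val_t_bounds; move: (dec12 val_c) (dec12 val_t) => d t /andP[d1 d2] /andP[t1 t2].
  have p3 := pi_gt3 R; split; apply/andP; split; lra.
have h1 := cone_sum_max hd.1 hd.2; have h2 := lobachevsky_sum_c R.
rewrite val_cpE val_cmE in h2.
exact: comb h2 h1.
Qed.

(** [val_c] belongs to the set. Beyond [val_d] both the volume and the Lobachevsky function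
    decrease, the latter because [[val_d, 2 pi / 3]] lies in [[pi / 6, 5 pi / 6]]; hence their
    combination stays nonpositive. *)
Lemma sup_bounds :
  dec12 val_c <= sup [set a : R | 0 <= a < 2 * pi / 3 /\ 2 * (- Lob a) < cone_vol a] <= dec12 val_d.
Proof.
set S := [set a | _].
have hc : S (dec12 val_c).
  split; last by have := cone_vol_val_c_gt; move: (dec12 val_c) => c; lra.
  move: val_c_bounds; move: (dec12 val_c) => c /andP[c1 c2].
  have p3 := pi_gt3 R; apply/andP; split; lra.
have ub : ubound S (dec12 val_d).
  move=> a [/andP[a0 a1] a2]; rewrite leNgt; apply/negP => ha.
  have h1 := cone_vol_val_d_le.
  have /andP[d1 d2] := val_d_bounds; have p3 := pi_gt3 R; have p4 := pi_lt4 R.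
  have h2 : cone_vol a <= cone_vol (dec12 val_d).
    have dd : dec12 val_d < 2 * pi / 3 by move: d2; move: (dec12 val_d) => d; lra.
    apply: cone_vol_antitone => //; apply/andP; split; last exact: ltW.
    by move: d1; move: (dec12 val_d) => d; lra.
  have h3 : Lob a <= Lob (dec12 val_d).
    move: ha d1; move: (dec12 val_d) => d ha d1.
    by apply: lobachevsky_antitone; lra.
  move: h1 h2 h3 a2; move: (Lob (dec12 val_d)) (cone_vol (dec12 val_d)) => x y; lra.
apply/andP; split; first by apply: ub_le_sup => //; exists (dec12 val_d).
by apply: ge_sup => //; exists (dec12 val_c).
Qed.

End alpha0_numerics.

(** * The dilogarithm on the unit circle *)

Section dilogarithm.
Variable R : realType.
Local Notation mu := (@lebesgue_measure R).
Implicit Types (t x y phi : R).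

(** The opposite of the argument of [1 - t e^(i phi)], whose real part is positive for
    [0 <= t < 1]. *)
Definition dilog_arg phi t : R := atan (t * sin phi / (1 - t * cos phi)).
Definition dilog_slope phi t : R := (cos phi - t) / (1 - 2 * t * cos phi + t ^+ 2).
Local Notation B := (`]0, 1[%classic : set (measurableTypeR R)).

Lemma dilog_den_gt0 phi t : 0 <= t < 1 -> 0 < 1 - t * cos phi.
Proof.
move=> /andP[t0 t1]; have := cos_le1 phi => c1.
have : t * cos phi <= t * 1 by rewrite ler_wpM2l.
lra.
Qed.

Lemma dilog_quad_gt0 phi t : 0 <= t < 1 -> 0 < 1 - 2 * t * cos phi + t ^+ 2.
Proof.
move=> ht; have h := dilog_den_gt0 phi ht.
have -> : 1 - 2 * t * cos phi + t ^+ 2 = (1 - t * cos phi) ^+ 2 + t ^+ 2 * (1 - cos phi ^+ 2) by ring.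
by rewrite -sin2cos2 ltr_pwDl ?exprn_gt0// mulr_ge0 ?sqr_ge0.
Qed.

Lemma is_derive1_atan_comp (f : R -> R) x d : is_derive x 1 f d ->
  is_derive x 1 (fun y => atan (f y)) ((1 + f x ^+ 2)^-1 * d).
Proof. by move=> fd; apply: is_derive1_comp_cst; exact: is_derive1_atan. Qed.

Lemma is_derive_dilog_arg phi t : 0 < t < 1 ->
  is_derive phi 1 (fun p => dilog_arg p t / t) (dilog_slope phi t).
Proof.
move=> /andP[t0 t1]; have h : 0 < 1 - t * cos phi by apply: dilog_den_gt0; rewrite ltW.
have q : 0 < 1 - 2 * t * cos phi + t ^+ 2 by apply: dilog_quad_gt0; rewrite ltW.
have tn : t != 0 by rewrite gt_eqF.
have hn : 1 - t * cos phi != 0 by rewrite gt_eqF.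
have qn : 1 - 2 * t * cos phi + t ^+ 2 != 0 by rewrite gt_eqF.
have ds := is_derive1_mul (is_derive1_cst t phi) (is_derive_sin phi).
have dc := is_derive1_add (is_derive1_cst 1 phi) (is_derive1_opp (is_derive1_mul (is_derive1_cst t phi) (is_derive_cos phi))).
have d := is_derive1_mul (is_derive1_atan_comp (is_derive1_mul ds (is_derive1_inv dc hn))) (is_derive1_cst t^-1 phi).
apply: is_derive1_eq d _ => /=; rewrite /dilog_slope.
have e1 : 1 + (t * sin phi / (1 - t * cos phi)) ^+ 2 = (1 - 2 * t * cos phi + t ^+ 2) / (1 - t * cos phi) ^+ 2.
  have -> : 1 - 2 * t * cos phi + t ^+ 2 = (1 - t * cos phi) ^+ 2 + t ^+ 2 * (sin phi ^+ 2).
    by rewrite sin2cos2; ring.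
  by field.
have sE : sin phi * sin phi = 1 - cos phi ^+ 2 by rewrite -expr2 sin2cos2.
rewrite e1 invfM invrK; set D := 1 - t * cos phi in hn *; set Q := 1 - _ + _ in qn *.
have -> : (0 * sin phi + t * cos phi) / D + t * sin phi * (- (0 - (0 * cos phi + t * - sin phi)) / D ^+ 2) =
   t * (cos phi - t) / D ^+ 2.
  have -> : (0 * sin phi + t * cos phi) / D + t * sin phi * (- (0 - (0 * cos phi + t * - sin phi)) / D ^+ 2) =
   t * cos phi / D - t ^+ 2 * (sin phi * sin phi) / D ^+ 2 by field.
  by rewrite sE /D; field.
by move: D Q hn qn => D Q hn qn; field; rewrite tn hn qn.
Qed.

Lemma atan_le x : `|atan x| <= `|x|.
Proof.
wlog x0 : x / 0 <= x => [h|].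
  by have [/h//|/ltW x0] := leP 0 x; rewrite -(normrN x) -(normrN (atan x)) -atanN; apply: h; rewrite oppr_ge0.
have h1 t : 0 <= t <= x -> is_derive t 1 (@atan R) (1 + t ^+ 2)^-1 by move=> _; exact: is_derive1_atan.
have h2 t : 0 <= t <= x -> `|(1 + t ^+ 2)^-1| <= 1.
  move=> _; have h : 1 <= 1 + t ^+ 2 by rewrite lerDl sqr_ge0.
  by rewrite ger0_norm ?invr_ge0 ?invf_le1 ?(le_trans ler01 h)// (lt_le_trans ltr01 h).
by have := derive_lipschitz x0 h1 h2; rewrite atan0 !subr0 mul1r (ger0_norm x0).
Qed.

Lemma dilog_arg_bound phi t : 0 < t < 1 -> `|dilog_arg phi t / t| <= 4.
Proof.
move=> /andP[t0 t1]; have h : 0 < 1 - t * cos phi by apply: dilog_den_gt0; rewrite ltW.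
rewrite normrM normfV (gtr0_norm t0) ler_pdivrMr//.
have [t2|t2] := leP t (1 / 2).
  apply: le_trans (atan_le _) _; rewrite !normrM normfV (gtr0_norm t0) (gtr0_norm h).
  have s1 : `|sin phi| <= 1 by exact: sin_max.
  have c1 := cos_le1 phi.
  have : t * cos phi <= t * 1 by rewrite ler_wpM2l// ltW.
  rewrite mulr1 => tc.
  rewrite ler_pdivrMr//.
  apply: (@le_trans _ _ (t * 1)); first by rewrite ler_wpM2l// ltW.
  rewrite mulr1; have : t * (1 / 2) <= t * (1 - t * cos phi) by apply: ler_wpM2l; [exact: ltW|lra].
  lra.
have := atan_ltpi2 (t * sin phi / (1 - t * cos phi)); have := atan_gtNpi2 (t * sin phi / (1 - t * cos phi)).
have p4 := pi_lt4 R; rewrite -/(dilog_arg phi t) ler_norml => ? ?; apply/andP; split; lra.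
Qed.

Lemma measurable_dilog_arg phi : measurable_fun B (fun t => dilog_arg phi t / t).
Proof.
apply: open_continuous_measurable_fun; first exact: interval_open.
move=> t; rewrite inE /= in_itv /= => /andP[t0 t1].
have hn : 1 - t * cos phi != 0 by rewrite gt_eqF// dilog_den_gt0// ltW.
have tn : t != 0 by rewrite gt_eqF.
have ds := is_derive1_mul (is_derive1_id t) (is_derive1_cst (sin phi) t).
have dc := is_derive1_add (is_derive1_cst 1 t) (is_derive1_opp (is_derive1_mul (is_derive1_id t) (is_derive1_cst (cos phi) t))).
have d := is_derive1_mul (is_derive1_atan_comp (is_derive1_mul ds (is_derive1_inv dc hn))) (is_derive1_inv (is_derive1_id t) tn).
exact: is_derive1_continuous d.
Qed.

Let mB : measurable B. Proof. exact: measurable_itv. Qed.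

Let int_cst (c : R) : mu.-integrable B (EFin \o (fun=> c)).
Proof.
apply: measurable_bounded_integrable => //; last exact: bounded_cst.
by rewrite /= lebesgue_measure_itv /=; case: ifP => _; rewrite ?ltry// -EFinB ltry.
Qed.

Lemma integrable_dilog_arg phi : mu.-integrable B (EFin \o (fun t => dilog_arg phi t / t)).
Proof.
apply: le_integrable (int_cst 4) => //.
  by apply/measurable_EFinP; exact: measurable_dilog_arg.
move=> t /=; rewrite in_itv /= => ht; rewrite lee_fin (ger0_norm (x := 4))//.
exact: dilog_arg_bound.
Qed.

Definition dilog_im phi : R := \int[mu]_(t in B) (dilog_arg phi t / t).

Lemma continuous_dilog_im phi : {for phi, continuous dilog_im}.
Proof.
have hphi : phi \in (`]phi - 1, phi + 1[%classic : set R).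
  by rewrite inE /= in_itv /=; apply/andP; split; lra.
apply: (@continuity_under_integral R _ (measurableTypeR R) mu (fun p t => dilog_arg p t / t) B mB (phi - 1) (phi + 1)
  _ _ (fun=> 4) (int_cst 4) _ phi hphi).
- by move=> x _; exact: integrable_dilog_arg.
- apply: aeW => t /=; rewrite in_itv /= => ht x _.
  exact: is_derive1_continuous (is_derive_dilog_arg x ht).
- by move=> x _; apply: aeW => t /=; rewrite in_itv /= => ht; exact: dilog_arg_bound.
Qed.


(** The quadratic is [|1 - t e^(i phi)|^2]. This bound, uniform in [t], dominates [dilog_slope] when
    [phi] stays away from the multiples of [2 pi]. *)
Lemma dilog_quad_ge phi t (k : R) : cos phi <= 1 - k -> 0 <= t ->
  Num.min (1 / 4) k <= 1 - 2 * t * cos phi + t ^+ 2.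
Proof.
move=> ck t0; have c1 := cos_le1 phi.
have -> : 1 - 2 * t * cos phi + t ^+ 2 = (1 - t) ^+ 2 + 2 * t * (1 - cos phi) by ring.
have h : 0 <= 2 * t * (1 - cos phi) by rewrite !mulr_ge0// subr_ge0.
rewrite ge_min; have [t2|t2] := leP t (1 / 2); apply/orP; [left|right].
  apply: (@le_trans _ _ ((1 - t) ^+ 2)); last by rewrite lerDl.
  have : (1 / 2) * (1 / 2) <= (1 - t) * (1 - t) by apply: ler_pM; lra.
  by rewrite expr2; lra.
apply: (@le_trans _ _ (2 * t * (1 - cos phi))); last by rewrite lerDr sqr_ge0.
have : 1 * (1 - cos phi) <= 2 * t * (1 - cos phi) by apply: ler_wpM2r; lra.
lra.
Qed.

Lemma dilog_slope_le phi t (k : R) : 0 < k -> cos phi <= 1 - k -> 0 < t < 1 ->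
  `|dilog_slope phi t| <= 2 / Num.min (1 / 4) k.
Proof.
move=> k0 ck /andP[t0 t1]; have m0 : 0 < Num.min (1 / 4) k by rewrite lt_min k0 andbT; lra.
have q := dilog_quad_ge ck (ltW t0); have q0 := lt_le_trans m0 q.
rewrite normrM normfV (gtr0_norm q0); apply: ler_pM => //.
- by rewrite invr_ge0 ltW.
- have := cos_le1 phi; have := cos_geN1 phi => ? ?; rewrite ler_norml; apply/andP; split; lra.
- by rewrite lef_pV2 ?posrE.
Qed.

Lemma cos_lt1 x : 0 < x < 2 * pi -> cos x < 1.
Proof.
move=> /andP[x0 x1]; have s : 0 < sin (x / 2) by apply: sin_gt0_pi; apply/andP; split; lra.
have -> : x = x / 2 + x / 2 by field.
rewrite cosD -!expr2 cos2sin2; have : 0 < sin (x / 2) ^+ 2 by rewrite exprn_gt0.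
lra.
Qed.

Lemma integral_dilog_slope phi : cos phi < 1 ->
  \int[mu]_(t in B) dilog_slope phi t = - (ln (2 - 2 * cos phi) / 2).
Proof.
move=> c1; have k0 : 0 < 1 - cos phi by rewrite subr_gt0.
pose Q t : R := 1 - 2 * t * cos phi + t ^+ 2.
have Q0 t : 0 <= t -> 0 < Q t.
  move=> t0; apply: lt_le_trans (@dilog_quad_ge phi t (1 - cos phi) _ t0); last by lra.
  by rewrite lt_min k0 andbT; lra.
have dQ t : is_derive t 1 Q (2 * t - 2 * cos phi).
  by eapply is_derive1_eq; [rewrite /Q; der|rewrite /= expr1; ring].
pose F t : R := - (ln (Q t) / 2).
have dF t : 0 <= t -> is_derive t 1 F (dilog_slope phi t).
  move=> t0.
  apply: is_derive1_eq (is_derive1_opp (is_derive1_mul (is_derive1_lnc (dQ t) (Q0 t t0)) (is_derive1_cst 2^-1 t))) _.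
  by rewrite /dilog_slope -/(Q t); field; rewrite gt_eqF// Q0.
have cs t : 0 <= t -> {for t, continuous (dilog_slope phi)}.
  move=> t0; have qn : Q t != 0 by rewrite gt_eqF// Q0.
  exact: is_derive1_continuous (is_derive1_mul (is_derive1_add (is_derive1_cst (cos phi) t) (is_derive1_opp (is_derive1_id t))) (is_derive1_inv (dQ t) qn)).
have mf : measurable_fun B (dilog_slope phi).
  apply: open_continuous_measurable_fun; first exact: interval_open.
  by move=> t; rewrite inE /= in_itv /= => /andP[t0 _]; exact: cs (ltW t0).
rewrite /Rintegral integral_itv_obnd_cbnd; last by apply/measurable_EFinP.
rewrite integral_itv_bndo_bndc; last first.
  by apply/measurable_EFinP/measurable_fun_itv_obnd_cbndP.
rewrite (continuous_FTC2 ltr01 (F := F)).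
- rewrite -EFinB /= /F /Q mulr0 mul0r subr0 expr0n addr0 ln1 mul0r oppr0 subr0.
  by congr (- (ln _ / 2)); ring.
- by apply: continuous_in_subspaceT => x; rewrite inE /= in_itv /= => /andP[x0 _]; exact: cs.
- split.
  + by move=> x; rewrite in_itv /= => /andP[x0 _]; have [] := dF x (ltW x0).
  + by apply: cvg_at_right_filter; exact: is_derive1_continuous (dF 0 (lexx 0)).
  + by apply: cvg_at_left_filter; exact: is_derive1_continuous (dF 1 ler01).
- by move=> x; rewrite in_itv /= => /andP[x0 _]; rewrite derive1E; have [_ ->] := dF x (ltW x0).
Qed.

Lemma is_derive_dilog_im phi : 0 < phi < 2 * pi ->
  is_derive phi 1 dilog_im (- ln (2 * sin (phi / 2))).
Proof.
move=> /andP[p0 p1]; pose u := phi / 2; pose v := (phi + 2 * pi) / 2.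
have uI : (`]u, v[%classic : set R) phi.
  by rewrite /= in_itv /= /u /v; apply/andP; split; lra.
have u1 : 0 < 1 - cos u by rewrite subr_gt0 cos_lt1// /u; apply/andP; split; lra.
have v1 : 0 < 1 - cos v by rewrite subr_gt0 cos_lt1// /v; apply/andP; split; lra.
pose k := Num.min (1 - cos u) (1 - cos v).
have k0 : 0 < k by rewrite lt_min u1.
have ck x : (`]u, v[%classic : set R) x -> cos x <= 1 - k.
  rewrite /= in_itv /= => /andP[ux xv]; rewrite lerBrDr -lerBrDl ge_min; apply/orP.
  have [xp|xp] := leP x pi; [left|right]; rewrite lerD2l lerN2.
    by apply: cos_antitone; rewrite // /u in ux *; lra.
  have e y : cos y = cos (2 * pi - y) :> R.
    by rewrite cosB (_ : 2 * pi = pi *+ 2) ?cos2pi ?sin2pi ?mul1r ?mul0r ?addr0// mulr_natl.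
  by rewrite (e x) (e v); apply: cos_antitone; rewrite /v in xv *; lra.
have pE x t : (`]u, v[%classic : set R) x -> B t -> partial1of2 (fun p t => dilog_arg p t / t) x t = dilog_slope x t.
  move=> _; rewrite /= in_itv /= => ht.
  by rewrite partial1of2E; have [_ ->] := is_derive_dilog_arg x ht.
have G0 : 0 <= 2 / Num.min (1 / 4) k.
  by rewrite divr_ge0// ltW// lt_min k0 andbT; lra.
have h1 := @derivable_under_integral R _ (measurableTypeR R) mu (fun p t => dilog_arg p t / t) B mB phi u v uI
  (fun x _ => integrable_dilog_arg x).
have h2 := @differentiation_under_integral R _ (measurableTypeR R) mu (fun p t => dilog_arg p t / t) B mB phi u v uI
  (fun x _ => integrable_dilog_arg x).
have dd x t : (`]u, v[%classic : set R) x -> B t -> derivable (fun p => dilog_arg p t / t) x 1.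
  by move=> _; rewrite /= in_itv /= => ht; have [] := is_derive_dilog_arg x ht.
have Gb x t : (`]u, v[%classic : set R) x -> B t -> `|partial1of2 (fun p t => dilog_arg p t / t) x t| <= 2 / Num.min (1 / 4) k.
  by move=> ux Bt; rewrite pE//; apply: (dilog_slope_le k0 (ck x ux)); move: Bt; rewrite /= in_itv.
have {}h1 := h1 dd (fun=> 2 / Num.min (1 / 4) k) (fun=> G0) (int_cst _) Gb.
have {}h2 := h2 dd (fun=> 2 / Num.min (1 / 4) k) (fun=> G0) (int_cst _) Gb.
split; first exact: h1.
rewrite -derive1E; apply: etrans h2 _.
rewrite (@eq_Rintegral _ _ _ mu B (dilog_slope phi)); last first.
  by move=> t; rewrite inE => Bt; exact: pE.
have c1 : cos phi < 1 by apply: cos_lt1; rewrite p0.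
rewrite integral_dilog_slope//; congr (- _).
have s0 : 0 < sin (phi / 2) by apply: sin_gt0_pi; apply/andP; split; lra.
have -> : 2 - 2 * cos phi = (2 * sin (phi / 2)) * (2 * sin (phi / 2)).
  have {1}-> : phi = phi / 2 + phi / 2 by field.
  by rewrite cosD -!expr2 cos2sin2; ring.
by rewrite lnM ?posrE ?mulr_gt0//; field.
Qed.

End dilogarithm.

(** * Imaginary part of the potential *)

Section potential_value.
Variable R : realType.
Local Notation mu := (@lebesgue_measure R).
Implicit Types (t x y phi a : R).
Local Notation B := (`]0, 1[%classic : set (measurableTypeR R)).

Lemma dilog_im0 : dilog_im (0 : R) = 0.
Proof.
rewrite /dilog_im (@eq_Rintegral _ _ _ mu B (fun=> 0)); first by rewrite /Rintegral integral0.
by move=> t _; rewrite /dilog_arg sin0 mulr0 mul0r atan0 mul0r.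
Qed.

(** Both sides have the same derivative on []0, 2 pi[]; the constant is fixed at [0], where only
    continuity is available. *)
Lemma dilog_imE phi : 0 <= phi < 2 * pi -> dilog_im phi = 2 * lobachevsky (phi / 2).
Proof.
move=> /andP[]; rewrite le_eqVlt => /predU1P[<- _|p0 p1].
  by rewrite dilog_im0 mul0r lobachevsky0 mulr0.
pose K x : R := dilog_im x - 2 * lobachevsky (x / 2).
have dK x : 0 < x <= phi -> is_derive x 1 K 0.
  move=> /andP[x0 xp]; have x2 : 0 < x < 2 * pi by rewrite x0 (le_lt_trans xp p1).
  have x3 : 0 < x / 2 < pi by apply/andP; split; lra.
  have d2 := is_derive1_mul (is_derive1_id x) (is_derive1_cst 2^-1 x).
  have d3 := is_derive1_mul (is_derive1_cst 2 x) (@is_derive1_lobachevsky _ (fun y => y / 2) _ _ x3 d2).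
  apply: is_derive1_eq (is_derive1_add (is_derive_dilog_im x2) (is_derive1_opp d3)) _.
  by field.
have := @derive_bound_at0 _ K (fun=> 0) 0 0 phi p0 dK (fun t _ => _).
rewrite normr0 mul0r subr0 => h; apply/eqP; rewrite -subr_eq0 -normr_le0; apply: h => // e e0.
have e2 : 0 < e / 2 by rewrite divr_gt0.
have e4 : 0 < e / 4 by rewrite divr_gt0.
have [h1 h10 H1] := lobachevsky_at0 e4.
have /cvgrPdist_le/(_ _ e2)[h2 /= h20 H2] := @continuous_dilog_im R 0.
exists (Num.min h1 h2); first by rewrite lt_min h10.
move=> t /andP[t0]; rewrite lt_min => /andP[t1 t2]; rewrite subr0.
have k1 := H1 (t / 2) ltac:(apply/andP; split; lra).
have k2 : `|dilog_im t| <= e / 2.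
  by have := H2 t; rewrite /= dilog_im0 !sub0r !normrN gtr0_norm//; apply.
rewrite /K; apply: le_trans (ler_normB _ _) _; rewrite normrM (gtr0_norm (x := 2))//; lra.
Qed.

Lemma carg_atan (z : R[i]) : 0 < Re z -> carg z = atan (Im z / Re z).
Proof.
case: z => x y /= x0.
have key b : 0 <= b -> acos (x / cmod (x +i* b)) = atan (b / x).
  move=> b0; have c1 : cos (atan (b / x)) = x / cmod (x +i* b).
    rewrite cos_atan cmodE /=.
    have -> : 1 + (b / x) ^+ 2 = (x ^+ 2 + b ^+ 2) / x ^+ 2 by field; rewrite gt_eqF.
    by rewrite sqrtrM ?addr_ge0 ?sqr_ge0// sqrtrV ?sqr_ge0// sqrtr_sqr gtr0_norm// invfM invrK mulrC.
  rewrite -c1 cosK// in_itv /=; apply/andP; split.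
    by rewrite -(atan0 R) le_atan// divr_ge0// ltW.
  have := atan_ltpi2 (b / x); have := pi_gt0 R; lra.
rewrite /carg /=; have [y0|y0] := leP 0 y; first by rewrite key.
have -> : cmod (x +i* y) = cmod (x +i* - y) by rewrite !cmodE /= sqrrN.
by rewrite key ?oppr_ge0 ?ltW// mulNr atanN opprK.
Qed.

Lemma Im_divC (z : R[i]) t : Im (z / t%:C) = Im z / t.
Proof.
have -> : (t%:C)^-1 = (t^-1)%:C :> R[i] by rewrite fmorphV.
by case: z => x y /=; rewrite mulr0 add0r.
Qed.

Lemma Im_dilog_unit phi : 0 <= phi < 2 * pi ->
  Im (dilog (cos phi +i* sin phi)) = 2 * lobachevsky (phi / 2).
Proof.
move=> hp; rewrite -dilog_imE//; set w := _ +i* _.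
have w0 : w != 0.
  rewrite eq_complex /=; apply/negP => /andP[/eqP c0 /eqP s0].
  by have := cos2Dsin2 phi; rewrite c0 s0 !expr0n addr0 => /eqP; rewrite eq_sym oner_eq0.
transitivity (- (\int[mu]_(t in B) Im (clog (1 - t%:C * w) / (t%:C * w) * w))); first by [].
have e t : 0 < t < 1 -> Im (clog (1 - t%:C * w) / (t%:C * w) * w) = -1 * (dilog_arg phi t / t).
  move=> /andP[t0 t1].
  have -> : clog (1 - t%:C * w) / (t%:C * w) * w = clog (1 - t%:C * w) / t%:C.
    by rewrite invfM mulrA -mulrA mulVf// mulr1.
  rewrite Im_divC mulrA; congr (_ / _); rewrite /clog [LHS]/=.
  have h : 0 < 1 - t * cos phi by apply: dilog_den_gt0; rewrite ltW.
  have -> : 1 - t%:C * w = (1 - t * cos phi) +i* - (t * sin phi).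
    by apply/eqP; rewrite eq_complex /= !mul0r subr0 addr0 sub0r !eqxx.
  rewrite carg_atan; last exact: h.
  by rewrite /= mulN1r /dilog_arg -atanN mulNr.
transitivity (- (\int[mu]_(t in B) (-1 * (dilog_arg phi t / t)))).
  congr (- _); apply: eq_Rintegral => t; rewrite inE => Bt; apply: e; move: Bt; by rewrite /= in_itv.
rewrite RintegralZl//; last exact: integrable_dilog_arg.
by rewrite mulN1r opprK.
Qed.

(** At [z = a / 2] the two dilogarithms are taken at [e^(2 i a)] and at [1], where the imaginary
    part is zero. *)
Lemma Im_potential a : 0 <= a < pi -> Im (potential a (a / 2)%:C) = - lobachevsky a.
Proof.
move=> /andP[a0 a1]; have p0 := pi_gt0 R.
have cisE phi (z : R[i]) : z = 0 +i* phi -> cexp z = cos phi +i* sin phi.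
  by move=> ->; rewrite /cexp /= expR0 !mul1r.
have e1 : cexp (2 * (0 +i* 1) * ((a / 2)%:C + (a / 2)%:C)) = cos (2 * a) +i* sin (2 * a).
  by apply: cisE; apply/eqP; rewrite eq_complex /=; apply/andP; split; apply/eqP; field.
have e2 : cexp (2 * (0 +i* 1) * ((a / 2)%:C - (a / 2)%:C)) = cos 0 +i* sin 0.
  by apply: cisE; rewrite subrr mulr0.
rewrite /potential e1 e2.
have p1 : 0 <= 2 * a < 2 * pi by apply/andP; split; lra.
have p2 : 0 <= (0 : R) < 2 * pi by apply/andP; split; lra.
have h1 := Im_dilog_unit p1; have h2 := Im_dilog_unit p2.
rewrite mul0r lobachevsky0 in h2; rewrite (_ : 2 * a / 2 = a) in h1; last by field.
move: h1 h2; move: (dilog (cos (2 * a) +i* _)) (dilog (cos 0 +i* _)) => [x1 y1] [x2 y2] /= h1 h2.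
by rewrite h1 h2; field.
Qed.

End potential_value.

(** * Riemann sums *)

Section riemann_sums.
Variable R : realType.
Implicit Types (h b u v : R).
Notation Lob := (@lobachevsky R).

Definition lsin u : R := ln (2 * sin u).

Lemma is_derive_lsin u : 0 < u < pi -> is_derive u 1 lsin (cos u / sin u).
Proof.
move=> hu; have s0 := sin_gt0_pi hu.
have s2 : 0 < 2 * sin u by rewrite mulr_gt0.
apply: is_derive1_eq (is_derive1_lnc (is_derive1_mul (is_derive1_cst 2 u) (is_derive_sin u)) s2) _.
by field; rewrite gt_eqF.
Qed.

(** [|cot x| <= C / x] on []0, b]]. Measuring variations by those of [ln] covers the singularity at
    [0] and lets the errors of the cells telescope. *)
Lemma lsin_log_lipschitz b : 0 < b < pi -> exists2 C : R, 0 <= C &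
  forall u v, 0 < u -> u <= v -> v <= b -> `|lsin v - lsin u| <= C * (ln v - ln u).
Proof.
move=> /andP[b0 b1]; have sb : 0 < sin b by apply: sin_gt0_pi; rewrite b0 b1.
exists (4 / sin b); first by rewrite divr_ge0// ltW.
move=> u v u0 uv vb; pose C := 4 / sin b.
have dl x : u <= x <= v -> is_derive x 1 (fun y => C * ln y) (C * x^-1).
  move=> /andP[x1 x2]; have x0 := lt_le_trans u0 x1.
  by apply: is_derive1_eq (is_derive1_mul (is_derive1_cst C x) (is_derive1_ln x0)) _; rewrite mul0r add0r.
have ds x : u <= x <= v -> is_derive x 1 lsin (cos x / sin x).
  move=> /andP[x1 x2]; apply: is_derive_lsin; rewrite (lt_le_trans u0 x1)/=.
  by apply: le_lt_trans b1; exact: le_trans vb.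
have key x : u <= x <= v -> `|cos x / sin x| <= C * x^-1.
  move=> /andP[x1 x2]; have x0 := lt_le_trans u0 x1; have xb := le_trans x2 vb.
  have h := sin_ge_linear b1 (introT andP (conj (ltW x0) xb)).
  have s0 : 0 < sin b / 4 * x by rewrite !mulr_gt0.
  have sx := lt_le_trans s0 h.
  rewrite normrM normfV (gtr0_norm sx) ler_pdivrMr//.
  apply: le_trans (cos_max x) _; have -> : 1 = C * x^-1 * (sin b / 4 * x).
    by rewrite /C; field; rewrite !gt_eqF.
  by rewrite ler_wpM2l// mulr_ge0 ?invr_ge0 ?(ltW x0)// divr_ge0// ltW.
have dN x : u <= x <= v -> is_derive x 1 (fun y => - lsin y) (- (cos x / sin x)).
  by move=> xuv; apply: is_derive1_opp; exact: ds.
have := derive_le uv ds dl (fun x xuv => le_trans (ler_norm _) (key x xuv)).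
have k2 x : u <= x <= v -> - (cos x / sin x) <= C * x^-1.
  by move=> xuv; apply: le_trans (key x xuv); rewrite -normrN; exact: ler_norm.
have := derive_le uv dN dl k2; rewrite -/C => h1 h2.
by rewrite ler_norml; apply/andP; split; lra.
Qed.

(** On the cell from [u] to [v] the mean value theorem gives [Lob v - Lob u = - h * lsin x], hence
    an error of at most [C h (ln v - ln u)], and these add up to a single logarithm. The first cell,
    which contains the singularity, is kept apart. *)
Lemma riemann_sum_bound b : 0 < b < pi -> exists2 C : R, 0 <= C &
  forall h n, 0 < h -> n.+1%:R * h <= b ->
  `|h * (\sum_(j < n.+1) lsin (j.+1%:R * h)) + Lob (n.+1%:R * h)| <=
    `|h * lsin h + Lob h| + C * h * (ln (n.+1%:R * h) - ln h).
Proof.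
move=> hb; have [b0 b1] := andP hb; have [C C0 HC] := lsin_log_lipschitz hb.
exists C => // h n h0; elim: n => [|n IH] nb.
  by rewrite big_ord1 !mul1r subrr mulr0 addr0.
rewrite big_ord_recr /=; set u := n.+1%:R * h in IH; set v := n.+2%:R * h in nb *.
have u0 : 0 < u by rewrite mulr_gt0// ltr0n.
have vE : v = u + h by rewrite /v /u -natr1; ring.
have uv : u < v by rewrite vE ltrDl.
have {}IH := IH (le_trans (ltW uv) nb).
set S := \sum_(i < n.+1) _ in IH *.
have dL x : u <= x <= v -> is_derive x 1 Lob (- lsin x).
  move=> /andP[x1 x2]; apply: is_derive_lobachevsky; rewrite (lt_le_trans u0 x1)/=.
  by apply: le_lt_trans b1; exact: le_trans nb.
have [x /andP[ux xv] e] := mvt uv dL.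
have vu : v - u = h by rewrite vE; ring.
rewrite vu in e.
have -> : h * (S + lsin v) + Lob v = (h * S + Lob u) + h * (lsin v - lsin x).
  have -> : Lob v = Lob u + (Lob v - Lob u) by ring.
  by rewrite e; ring.
apply: le_trans (ler_normD _ _) _.
rewrite normrM (gtr0_norm h0).
have k1 : `|lsin v - lsin x| <= C * (ln v - ln u).
  apply: le_trans (HC x v (lt_trans u0 ux) (ltW xv) nb) _.
  rewrite ler_wpM2l// lerD2l lerN2 ler_ln ?posrE//; [exact: ltW|exact: lt_trans ux].
have := ler_wpM2l (ltW h0) k1; lra.
Qed.

Lemma lsin_at0 (h : nat -> R) : (forall n, 0 < h n) -> h @ \oo --> (0 : R) ->
  (fun n => h n * lsin (h n) + Lob (h n)) @ \oo --> (0 : R).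
Proof.
move=> h0 hc; apply/cvgrPdist_le => e e0; have e4 : 0 < e / 4 by rewrite divr_gt0.
have [h1 h10 H1] := lobachevsky_at0 e4.
have [h2 h20 H2] := @xlnx_small R _ e4.
pose h3 := Num.min (1 : R) (Num.min h1 h2).
have h30 : 0 < h3 by rewrite !lt_min ltr01 h10.
near=> n.
have hn : h n < h3.
  near: n; exact: (cvgr_lt _ hc).
move: hn; rewrite /h3 !lt_min => /and3P[k1 k2 k3].
have hn0 := h0 n; rewrite sub0r normrN.
have H1n := H1 _ (introT andP (conj hn0 k2)).
have H2n := H2 _ (introT andP (conj hn0 k3)).
have H3n : `|h n / 2 * ln (2 * (h n / 2))| <= e / 4 by apply: H2; apply/andP; split; lra.
have s1 := sin_le (ltW hn0).
have s2 : h n / 2 <= sin (h n).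
  apply: le_trans (sin_ge_cubic (ltW hn0)).
  have : h n * (h n * h n) <= h n * (1 * 1) by rewrite ler_wpM2l ?ltW// ltr_pM// ltW.
  by rewrite !exprS expr0; lra.
have s0 : 0 < sin (h n) by apply: lt_le_trans s2; rewrite divr_gt0.
have hi : lsin (h n) <= ln (2 * h n) by rewrite /lsin ler_ln ?posrE ?mulr_gt0// ler_pM2l.
have lo : ln (2 * (h n / 2)) <= lsin (h n) by rewrite /lsin ler_ln ?posrE ?mulr_gt0 ?divr_gt0// ler_pM2l.
have k4 : `|h n * lsin (h n)| <= e / 4 + e / 4.
  move: H2n H3n; rewrite !ler_norml => /andP[a1 a2] /andP[a3 a4].
  have := ler_wpM2l (ltW hn0) hi; have := ler_wpM2l (ltW hn0) lo => b1 b2.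
  apply/andP; split; lra.
apply: le_trans (ler_normD _ _) _; lra.
Unshelve. all: by end_near. Qed.


Lemma ln_le_sub1 u : 0 < u -> ln u <= u - 1.
Proof.
move=> u0; have := @le_ln1Dx R (u - 1).
by rewrite (_ : 1 + (u - 1) = u); [apply; lra|ring].
Qed.

Lemma riemann_sum_cvg (h : nat -> R) (n : nat -> nat) (phi : R) : 0 < phi < pi ->
  (forall k, 0 < h k) -> h @ \oo --> (0 : R) -> (fun k => (n k)%:R * h k) @ \oo --> phi ->
  (fun k => h k * (\sum_(j < n k) lsin (j.+1%:R * h k))) @ \oo --> - Lob phi.
Proof.
move=> hphi h0 hc nc; have [p0 p1] := andP hphi.
pose b := (phi + pi) / 2; have hb : 0 < b < pi by rewrite /b; apply/andP; split; lra.
have pb : phi < b by rewrite /b; lra.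
have [C C0 HC] := riemann_sum_bound hb.
have cL : (fun k => Lob ((n k)%:R * h k)) @ \oo --> Lob phi.
  apply: continuous_cvg; [exact: is_derive1_continuous (is_derive_lobachevsky hphi)|exact: nc].
suff key : (fun k => h k * (\sum_(j < n k) lsin (j.+1%:R * h k)) + Lob ((n k)%:R * h k)) @ \oo --> (0 : R).
  have E : (fun k => h k * (\sum_(j < n k) lsin (j.+1%:R * h k))) =
     (fun k => h k * (\sum_(j < n k) lsin (j.+1%:R * h k)) + Lob ((n k)%:R * h k) - Lob ((n k)%:R * h k)).
    by apply/funext => k; rewrite addrK.
  rewrite E -[- Lob phi]add0r; exact: cvgB key cL.
have sm := lsin_at0 h0 hc.
apply/cvgrPdist_le => e e0.
have e2 : 0 < e / 2 by rewrite divr_gt0.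
have C1 : 0 < 1 + C by rewrite ltr_pwDl.
have e4 : 0 < e / (1 + C) / 8 by rewrite !divr_gt0.
have [h1 h10 H1] := @xlnx_small R _ e4.
have hb2 : 0 < e / (1 + C) / 4 / (1 + b) by rewrite !divr_gt0//; case/andP: hb => ? _; lra.
near=> k.
have nh : (n k)%:R * h k < b by near: k; exact: (cvgr_lt _ nc).
have nh0 : 0 < (n k)%:R * h k by near: k; exact: (cvgr_gt _ nc).
have n0 : (0 < n k)%N by rewrite -(ltr0n R) -(pmulr_lgt0 _ (h0 k)).
have hk1 : h k < h1 by near: k; exact: (cvgr_lt _ hc).
have hk2 : h k < e / (1 + C) / 4 / (1 + b) by near: k; exact: (cvgr_lt _ hc).
have hk3 : `|h k * lsin (h k) + Lob (h k)| <= e / 2.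
  by near: k; move/cvgrPdist_le: sm => /(_ _ e2); apply: filterS => k; rewrite sub0r normrN.
have hk0 := h0 k.
rewrite sub0r normrN -(prednK n0).
apply: le_trans (HC (h k) (n k).-1 hk0 _) _; first by rewrite prednK// ltW.
rewrite prednK//.
have l1 : ln ((n k)%:R * h k) <= b.
  by have := ln_le_sub1 nh0; lra.
have l2 : `|h k / 2 * ln (2 * (h k / 2))| <= e / (1 + C) / 8 by apply: H1; apply/andP; split; lra.
have hh : 2 * (h k / 2) = h k by field.
rewrite hh in l2.
have l3 : h k * (ln ((n k)%:R * h k) - ln (h k)) <= e / (1 + C) / 2.
  move: l2; rewrite ler_norml => /andP[l2 _].
  have : h k * ln ((n k)%:R * h k) <= h k * (1 + b) by rewrite ler_wpM2l ?ltW//; lra.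
  have : h k * (1 + b) <= e / (1 + C) / 4.
    by rewrite -ler_pdivlMr ?ltW//; case/andP: hb => ? _; lra.
  lra.
have l4 : C * h k * (ln ((n k)%:R * h k) - ln (h k)) <= e / 2.
  rewrite -mulrA; apply: le_trans (ler_wpM2l C0 l3) _.
  have -> : C * (e / (1 + C) / 2) = (C / (1 + C)) * (e / 2) by field; rewrite gt_eqF.
  by rewrite ler_piMl ?ltW// ltr_pdivrMr// mul1r ltrDr.
lra.
Unshelve. all: by end_near. Qed.

End riemann_sums.

(** * The invariant as a sum of products of sines *)

Section sine_product.
Variable R : realType.
Variable n : nat.
Hypothesis n0 : (0 < n)%N.
Local Notation r := (2 * n + 1)%N.
Let h : R := 2 * pi / r%:R.
Implicit Types k : nat.

Let r0 : 0 < r%:R :> R. Proof. by rewrite ltr0n addn1. Qed.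

Let rh : r%:R * h = 2 * pi. Proof. by rewrite /h mulrC divfK// gt_eqF. Qed.

(** [2 k / r] is not an integer because [r] is odd; the cases are [k <= n], with angle in []0, pi[],
    and [k > n], with angle in []pi, 2 pi[]. *)
Lemma sin_step_neq0 k : (0 < k < r)%N -> sin (k%:R * h) != 0.
Proof.
move=> /andP[k0 kr]; have p0 := pi_gt0 R.
have h0 : 0 < h by rewrite divr_gt0// mulr_gt0.
have k0' : 0 < k%:R * h by rewrite mulr_gt0// ltr0n.
have k1 : k%:R * h < 2 * pi by rewrite -rh ltr_pM2r// ltr_nat.
have [k2|k2] := leqP k n.
  have : k%:R * h < pi.
    have : (2 * k)%:R * h < r%:R * h by rewrite ltr_pM2r// ltr_nat addn1 ltnS leq_mul2l k2 orbT.
    by rewrite rh natrM; lra.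
  by move=> k3; rewrite gt_eqF// sin_gt0_pi// k0'.
have k3 : pi < k%:R * h.
  have : r%:R * h < (2 * k)%:R * h.
    rewrite ltr_pM2r// ltr_nat; clear -k2; lia.
  by rewrite rh natrM; lra.
have -> : k%:R * h = (k%:R * h - pi) + pi by ring.
rewrite sinDpi oppr_eq0 gt_eqF// sin_gt0_pi//; apply/andP; split; lra.
Qed.

Lemma cmod_sub_cis (x : R) : cmod (1 - cis (x + x)) = `|2 * sin x|.
Proof.
have -> : 1 - cis (x + x) = - (cis x * (cis x - cis (- x))).
  by rewrite mulrBr -!cisD subrr cis0 opprB.
rewrite cmodN cmodM cmod_cis mul1r cis_subN cmodE /= expr0n add0r.
by rewrite sqrtr_sqr.
Qed.

Lemma cisX (x : R) k : cis x ^+ k = cis (k%:R * x).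
Proof. by elim: k => [|k IH]; rewrite ?expr0 ?mul0r ?cis0// exprS IH -cisD -[k.+1%:R]natr1; congr cis; ring. Qed.

(** The cyclotomic identity: [(X^r - 1) / (X - 1)] at [1], factored with the primitive root
    [e^(4 pi i / r)]. *)
Lemma prod_sine : \prod_(1 <= k < r) `|2 * sin (k%:R * h)| = r%:R.
Proof.
pose z : R[i] := cis (h + h).
have zX k : z ^+ k = cis (k%:R * h + k%:R * h) by rewrite cisX mulrDr.
have zr : z ^+ r = 1.
  by rewrite zX rh cisD /cis (_ : 2 * pi = pi *+ 2) ?cos2pi ?sin2pi ?mulr1// mulr_natl.
have zk k : (0 < k < r)%N -> z ^+ k != 1.
  move=> kr; rewrite eq_sym -subr_eq0 -cmod_eq0 zX cmod_sub_cis normr_eq0 mulf_neq0//.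
  exact: sin_step_neq0.
have pz : r.-primitive_root z.
  apply/andP; split; first by rewrite addn1.
  apply/forallP => i; rewrite unity_rootE; apply/eqP.
  have [->|ir] := eqVneq i.+1 r; first by rewrite zr eqxx.
  by apply/negbTE/zk; rewrite /= ltn_neqAle ir ltn_ord.
have rpos : (0 < r)%N by rewrite addn1.
have := factor_Xn_sub_1 pz; rewrite (big_ltn rpos) expr0 subrX1.
have X1 : 'X - 1%:P != 0 :> {poly R[i]} by rewrite polyXsubC_eq0.
move=> /(mulfI X1) /(congr1 (fun p => cmod p.[1])).
rewrite horner_prod horner_sum (big_morph _ (@cmodM R) (@cmod1 R)).
under [X in X = _ -> _]eq_bigr => i _ do rewrite hornerXsubC zX cmod_sub_cis.
under [X in _ = cmod X -> _]eq_bigr => i _ do rewrite hornerXn expr1n.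
by rewrite sumr_const card_ord -(rmorph_nat (real_complex R)) cmod_real normr_nat.
Qed.

Lemma jones_rootX (m : int) : jones_root R r ^ m = cis (m%:~R * h).
Proof.
have jE : jones_root R r = cis h by rewrite /jones_root /cexp /= expR0 !mul1r.
case: m => m; rewrite jE; first by rewrite -exprnP cisX.
rewrite -[LHS]/((cis h ^+ m.+1)^-1) NegzE; apply: (mulfI (x := cis h ^+ m.+1)).
  by rewrite -cmod_eq0 cmodX cmod_cis expr1n oner_eq0.
rewrite mulfV; last by rewrite -cmod_eq0 cmodX cmod_cis expr1n oner_eq0.
by rewrite cisX -cisD mulrNz mulNr subrr cis0.
Qed.

Lemma braceE (m : int) : brace R r m = 0 +i* (2 * sin (m%:~R * h)).
Proof. by rewrite /brace !jones_rootX mulrNz mulNr cis_subN. Qed.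

Lemma brace_neq0 k : (0 < k < r)%N -> brace R r k != 0.
Proof.
move=> kr; rewrite braceE -cmod_eq0 cmodE /= expr0n add0r sqrtr_sqr normr_eq0.
by rewrite mulf_neq0//; exact: sin_step_neq0.
Qed.

Lemma cmod_brace k : cmod (brace R r k) = `|2 * sin (k%:R * h)|.
Proof. by rewrite braceE cmodE /= expr0n add0r sqrtr_sqr. Qed.

Lemma brace_factS k : brace_fact R r k.+1 = brace R r k.+1 * brace_fact R r k.
Proof.
rewrite /brace_fact /brace_fall big_nat_recl// subr0; congr (_ * _).
apply: eq_big_nat => i ik; congr (brace R r _).
by rewrite -[in k.+1%:Z]addn1 -[in i.+1%:Z]addn1 !PoszD; ring.
Qed.

Lemma brace_fact_neq0 k : (k < r)%N -> brace_fact R r k != 0.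
Proof.
elim: k => [|k IH] kr; first by rewrite /brace_fact /brace_fall big_geq// oner_eq0.
by rewrite brace_factS mulf_neq0 ?brace_neq0//; apply: IH; exact: ltnW.
Qed.

Variable N : nat.
Hypothesis N0 : (0 < N < r)%N.
Let Y : R := 2 * cos (N%:R * (2 * h)).

Definition jones_prod k : R := \prod_(0 <= i < k) (Y - 2 * cos (i.+1%:R * (2 * h))).

Lemma brace_factor k : (k < N)%N ->
  brace R r (N + k) * brace R r (N - k)%N = (Y - 2 * cos (k%:R * (2 * h)))%:C.
Proof.
move=> kN; rewrite !braceE.
have -> : ((N + k)%N : int)%:~R * h = N%:R * h + k%:R * h.
  by rewrite PoszD rmorphD /= mulrDl.
have -> : ((N - k)%N : int)%:~R * h = N%:R * h - k%:R * h.
  by rewrite -pmulrn natrB 1?ltnW// mulrBl.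
rewrite /Y -mulrBr cos_sub.
have -> : (N%:R * (2 * h) + k%:R * (2 * h)) / 2 = N%:R * h + k%:R * h by field.
have -> : (k%:R * (2 * h) - N%:R * (2 * h)) / 2 = - (N%:R * h - k%:R * h) by field.
rewrite sinN; apply/eqP; rewrite eq_complex /=; apply/andP; split; apply/eqP; ring.
Qed.

Lemma jones_prodS k : jones_prod k.+1 = (Y - 2 * cos (k.+1%:R * (2 * h))) * jones_prod k.
Proof. by rewrite /jones_prod big_nat_recr//= mulrC. Qed.

Lemma brace_fact_ratio k : (k < N)%N -> (N + k < r)%N ->
  brace_fact R r (N + k) / brace_fact R r (N.-1 - k) = brace R r N * (jones_prod k)%:C.
Proof.
have /andP[N1 N2] := N0.
elim: k => [|k IH] kN kr.
  rewrite addn0 subn0 /jones_prod big_geq// mulr1 -{1}(prednK N1) brace_factS prednK// mulfK//.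
  by rewrite brace_fact_neq0// (leq_trans _ N2)// ltnS leq_pred.
have kr' : (N + k < r)%N by apply: leq_trans kr; rewrite addnS.
have {}IH := IH (ltnW kN) kr'.
rewrite jones_prodS rmorphM /= -brace_factor// mulrCA -IH.
rewrite [brace_fact R r (N + k.+1)](_ : _ = brace R r (N + k.+1)%N * brace_fact R r (N + k)); last by rewrite (addnS N k) brace_factS.
have e : (N.-1 - k = (N.-1 - k.+1).+1)%N by clear -kN; lia.
have e2 : (N - k.+1 = N.-1 - k)%N by clear -kN; lia.
rewrite e2 [in RHS]e brace_factS -e.
have b1 : brace R r (N.-1 - k)%N != 0 by apply: brace_neq0; clear -kN N2; lia.
rewrite invfM; field.
by rewrite b1 brace_fact_neq0//; clear -kN N2; lia.
Qed.

Lemma colored_jones_fig8E : colored_jones_fig8 R r N.-1 =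
  brace R r N / brace R r 1 * (\sum_(0 <= k < minn N (r - N)) jones_prod k)%:C.
Proof.
have /andP[N1 N2] := N0.
rewrite /colored_jones_fig8.
have -> : (minn N.-1 (r - (N.-1 + 1) - 1)).+1 = minn N (r - N) by clear -N1 N2; lia.
rewrite rmorph_sum mulr_sumr; apply: eq_big_nat => k /andP[_ kk].
have -> : (N.-1 + 1 + k = N + k)%N by clear -N1; lia.
rewrite brace_fact_ratio; [|clear -kk; lia..].
by field; exact: (@brace_neq0 1 ltac:(clear -n0; lia)).
Qed.

(** In the full product [prod_sine], the indices from [N - l] to [N + l] make up [|{N}| |P_l|]. The
    indices below remain as they are and those above are reflected by [k -> r - k]. This turns
    [ln |P_l|] into sums of [lsin]. *)
Lemma prod_sine_split l : (l < minn N (r - N))%N ->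
  `|2 * sin (N%:R * h)| * `|jones_prod l| *
    ((\prod_(1 <= k < N - l) `|2 * sin (k%:R * h)|) *
     (\prod_(1 <= k < r - N - l) `|2 * sin (k%:R * h)|)) = r%:R.
Proof.
have /andP[N1 N2] := N0.
have sr k : (k <= r)%N -> `|2 * sin ((r - k)%:R * h)| = `|2 * sin (k%:R * h)|.
  move=> kr; rewrite natrB// mulrBl rh sinB.
  rewrite (_ : 2 * pi = pi *+ 2) ?cos2pi ?sin2pi; last by rewrite mulr_natl.
  by rewrite mul0r mul1r sub0r mulrN normrN.
have fE k : (k < N)%N -> (N + k <= r)%N ->
    `|Y - 2 * cos (k%:R * (2 * h))| = `|2 * sin ((N - k)%:R * h)| * `|2 * sin ((r - N - k)%:R * h)|.
  move=> kN kr; rewrite -subnDA sr// -!cmod_brace -cmod_real -brace_factor// cmodM.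
  by rewrite mulrC.
elim: l => [|l IH] lk.
  rewrite !subn0 /jones_prod big_geq// normr1 mulr1 -prod_sine.
  rewrite (@big_cat_nat _ _ _ N 1 r)//=; last exact: ltnW.
  rewrite (@big_ltn _ _ _ N r)//= mulrCA; congr (_ * (_ * _)).
  rewrite -[N.+1]add1n big_addn big_nat_rev /=; apply: eq_big_nat => i /andP[i1 i2].
  rewrite -sr; last by clear -i2 N2; lia.
  by congr (`|2 * sin (_%:R * h)|); clear -i1 i2 N2; lia.
have lN : (l.+1 < N)%N by clear -lk; lia.
have lr : (l.+1 < r - N)%N by clear -lk; lia.
have {}IH := IH (ltnW lk); rewrite -IH jones_prodS [`|_ * jones_prod l|]normrM fE//; last by clear -lr; lia.
have e1 : (N - l = (N - l.+1).+1)%N by clear -lN; lia.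
have e2 : (r - N - l = (r - N - l.+1).+1)%N by clear -lr; lia.
rewrite e1 e2 [in RHS]big_nat_recr/=; last by clear -lN; lia.
rewrite [X in _ = _ * (_ * X)]big_nat_recr/=; last by clear -lr; lia.
ring.
Qed.

End sine_product.

(** * The main block dominates *)

Section factor_estimates.
Variable R : realType.
Implicit Types (x u d : R).

Lemma expR_3_5 : 20 / 11 <= expR (3 / 5) :> R.
Proof.
apply: le_trans (exp_sum_le 5 _); last by lra.
by rewrite /exp_sum !big_ord_recr big_ord0 /= !factS fact0 !expr2; lra.
Qed.

(* [ln u <= (11/20) u - 2/5]: the tangent line at [u = exp (3/5)], slightly tilted. *)
Lemma le_expR_tangent u : 0 <= u -> u <= expR (11 / 20 * u - 2 / 5).
Proof.
move=> u0; have -> : 11 / 20 * u - 2 / 5 = 3 / 5 + (11 / 20 * u - 1) by field.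
rewrite expRD; have h := expR_ge1Dx (11 / 20 * u - 1).
have h2 : 11 / 20 * u <= expR (11 / 20 * u - 1) by lra.
have := ler_pM (ltac:(lra) : 0 <= 20 / 11 :> R) (ltac:(lra) : 0 <= 11 / 20 * u) expR_3_5 h2.
by apply: le_trans; lra.
Qed.

(* Multiplied by [1 / d], bounds [ln `|P_k|] for [x = k d] before the main block. *)
Definition log_bound x : R := 11 / 10 * sin x - 9 / 50 * x.

Lemma log_bound_step x d : 0 <= x -> 0 < d -> x + d <= pi ->
  (11 / 10 * cos (x + d) - 9 / 50) * d <= log_bound (x + d) - log_bound x.
Proof.
move=> x0 d0 xp; have h : x < x + d by rewrite ltrDl.
have [c /andP[c1 c2] e] := mvt h (fun t _ => is_derive_sin t).
have k : cos (x + d) <= cos c by apply: cos_antitone; [exact: le_trans (ltW c1)|exact: ltW|].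
have e2 : sin (x + d) - sin x = cos c * d by rewrite e; ring.
have := ler_wpM2r (ltW d0) k; rewrite /log_bound => k2.
lra.
Qed.

Lemma log_bound_le x : 0 <= x <= pi -> log_bound x <= 21 / 25.
Proof.
move=> /andP[x0 xp]; have p3 := pi_gt_314 R; have p4 := pi_lt4 R.
pose y := pi / 2 - x.
have xE : x = pi / 2 - y by rewrite /y; ring.
have -> : log_bound x = 11 / 10 * cos y - 9 / 50 * (pi / 2 - y).
  by rewrite /log_bound xE sinB sin_pihalf cos_pihalf mul1r mul0r subr0.
have h := cos_le_quartic y.
have y2 : y ^+ 2 <= 4.
  have : y * y <= 2 * 2.
    have y1 : `|y| <= 2 by rewrite ler_norml /y; apply/andP; split; lra.
    by apply: le_trans (ler_norm _) _; rewrite normrM ler_pM.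
  by rewrite expr2; lra.
have y4 : y ^+ 4 <= 4 * y ^+ 2.
  by rewrite (_ : y ^+ 4 = y ^+ 2 * y ^+ 2) ?ler_wpM2r ?sqr_ge0//; ring.
have := sqr_ge0 (y - 1 / 4); have := sqr_ge0 y; rewrite !expr2 in h y2 y4 *.
nra.
Qed.

Lemma expRN_ge4 x (q : R) : 0 <= x ->
  q * (1 + x + x ^+ 2 / 2 + x ^+ 3 / 6) <= 1 - x ^+ 4 / 24 -> q <= expR (- x).
Proof.
move=> x0 h; have := exp_sum_ge 3 x0.
have -> : exp_sum 4 x = 1 + x + x ^+ 2 / 2 + x ^+ 3 / 6.
  by rewrite /exp_sum !big_ord_recr big_ord0 /= !factS fact0 expr0 expr1; field.
have -> : (4`!)%:R = 24 :> R by [].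
have s0 : 0 < 1 + x + x ^+ 2 / 2 + x ^+ 3 / 6.
  have := exprn_ge0 2 x0; have := exprn_ge0 3 x0; lra.
move=> k; rewrite -(ler_pM2r s0); apply: le_trans h _.
by rewrite [leRHS]mulrC.
Qed.

Lemma expR_31_20 : 1 / 5 <= expR (- (31 / 20)) :> R.
Proof.
have -> : expR (- (31 / 20)) = expR (- (31 / 80)) ^+ 4 :> R by rewrite -expRM_natr; congr expR; field.
apply: (@le_trans _ _ ((27 / 40) ^+ 4)); first by lra.
have h : 27 / 40 <= expR (- (31 / 80)) :> R by apply: expRN_ge4; lra.
by rewrite lerXn2r ?nnegrE ?expR_ge0//; lra.
Qed.

Lemma expR_13_25 : 10 / 17 <= expR (- (13 / 25)) :> R.
Proof.
have -> : expR (- (13 / 25)) = expR (- (13 / 100)) ^+ 4 :> R by rewrite -expRM_natr; congr expR; field.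
apply: (@le_trans _ _ ((79 / 90) ^+ 4)); first by lra.
have h : 79 / 90 <= expR (- (13 / 100)) :> R by apply: expRN_ge4; lra.
by rewrite lerXn2r ?nnegrE ?expR_ge0//; lra.
Qed.

Lemma expR_1_5 : expR (1 / 5) <= 5 / 4 :> R.
Proof.
apply: le_trans (expR_le_inv _) _; first by lra.
by rewrite (_ : 1 - 1 / 5 = 4 / 5) ?invf_div//; field.
Qed.

(** [exp (c / d)] is at least the power [p + 1] of [c / ((p + 1) d)], which beats
    [r^p <= (13 / d)^p] by an order of [1 / d]. The bound [13] is meant for [r d = 4 pi]. *)
Lemma poly_exp_small (C c : R) (p : nat) : 0 <= C -> 0 < c ->
  exists2 d0, 0 < d0 & forall d r, 0 < d < d0 -> 0 <= r -> r * d <= 13 -> C * r ^+ p * expR (- (c / d)) <= 1.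
Proof.
move=> C0 c0; pose K := C * 13 ^+ p * (p.+1%:R / c) ^+ p.+1.
have K0 : 0 <= K by rewrite !mulr_ge0 ?exprn_ge0// divr_ge0// ltW.
exists (1 / (1 + K)); first by rewrite divr_gt0// ltr_pwDl.
move=> d r /andP[d0 dd] r0 rd.
have Kd : K * d <= 1.
  have : d * (1 + K) <= 1 by rewrite -ler_pdivlMr ?ltW// ltr_pwDl.
  lra.
apply: le_trans Kd.
have z0 : 0 < c / p.+1%:R / d by rewrite !divr_gt0// ltr0n.
have e1 : expR (- (c / d)) <= ((c / p.+1%:R / d) ^+ p.+1)^-1.
  rewrite expRN lef_pV2 ?posrE ?expR_gt0 ?exprn_gt0//.
  have -> : expR (c / d) = expR (c / p.+1%:R / d) ^+ p.+1.
    by rewrite -expRM_natr; congr expR; field; rewrite ?gt_eqF//= ?nat1r ?pnatr_eq0.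
  have zz : c / p.+1%:R / d <= expR (c / p.+1%:R / d).
    have := expR_ge1Dx (c / p.+1%:R / d); move: (c / p.+1%:R / d) (expR _) => z w; lra.
  by rewrite lerXn2r// nnegrE ?expR_ge0 ?ltW.
have rd' : r <= 13 / d by rewrite ler_pdivlMr.
have r1 : r ^+ p <= (13 / d) ^+ p by rewrite lerXn2r ?nnegrE// divr_ge0// ltW.
have Cr : 0 <= C * r ^+ p by rewrite mulr_ge0 ?exprn_ge0.
apply: le_trans (ler_wpM2l Cr e1) _.
have i0 : 0 <= ((c / p.+1%:R / d) ^+ p.+1)^-1 by rewrite invr_ge0 exprn_ge0// ltW.
apply: le_trans (ler_wpM2r i0 (ler_wpM2l C0 r1)) _.
pose u := p.+1%:R / c; have -> : c / p.+1%:R / d = (u * d)^-1 by rewrite /u invfM invf_div.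
rewrite /K -/u; clearbody u; rewrite exprVn invrK !exprMn [d ^+ p.+1]exprS.
have -> : C * (13 ^+ p * d^-1 ^+ p) * (u ^+ p.+1 * (d * d ^+ p)) =
  C * 13 ^+ p * u ^+ p.+1 * d * (d^-1 ^+ p * d ^+ p) by ring.
by rewrite -exprMn mulVf ?gt_eqF// expr1n mulr1.
Qed.

End factor_estimates.

Lemma half_bounds n : (n <= 2 * n./2 + 1)%N /\ (2 * n./2 <= n)%N.
Proof. split; lia. Qed.

Lemma half_le n : (n./2 <= 2 * n + 1)%N.
Proof. lia. Qed.

(** * Comparison of the two blocks at a fixed order *)

Section dominant.
Variables (R : realType) (d Y al : R) (P : nat -> R) (n k2 : nat).
Local Notation r := (2 * n + 1)%N.
Hypothesis PE : forall k, P k.+1 = (Y - 2 * cos (k.+1%:R * d)) * P k.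
Hypothesis P0 : P 0 = 1.
Hypothesis d0 : 0 < d.
Hypothesis d1 : d <= 1 / 100.
Hypothesis rd : r%:R * d = 4 * pi.
Hypothesis al0 : 0 <= al.
Hypothesis al1 : al <= 177 / 100.
Hypothesis YE : Y = 2 * cos al.
Hypothesis k2E : k2%:R * d = 2 * pi - al.
Hypothesis k2r : (k2 <= r)%N.

Let be := 2 * theta_fig8 al.
Let f k := Y - 2 * cos (k%:R * d).

Let p3 := pi_gt_314 R.
Let p4 := pi_lt_315 R.

Let al2 : 0 <= al < 2 * pi / 3.
Proof. by rewrite al0/=; have := p3; have := al1; move: pi => q; lra. Qed.

Let beE : cos be = cos al - 1 / 2. Proof. exact: cos_theta_fig8. Qed.

Let be_bounds : al < be < pi.
Proof. by have [/andP[h1 h2] _] := theta_fig8_bounds al2; rewrite /be; apply/andP; split; lra. Qed.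

Let be_ge1 : 1 <= be.
Proof. by have [_ h] := theta_fig8_bounds al2; have := pi_gt3 R; rewrite /be; lra. Qed.

Let cos_al : - (1 / 5) <= cos al.
Proof.
have h : cos (177 / 100 : R) <= cos al by apply: cos_antitone => //; have := pi_gt3 R; lra.
apply: le_trans h; pose y : R := 177 / 100 - pi / 2.
have -> : (177 / 100 : R) = pi / 2 + y by rewrite /y; ring.
have -> : cos (pi / 2 + y) = - sin y by rewrite cosD cos_pihalf sin_pihalf; ring.
rewrite lerN2.
have h3 := p3; have h4 := p4.
have y0 : 0 <= y by rewrite /y; lra.
by apply: le_trans (sin_le y0) _; rewrite /y; lra.
Qed.

Let be_le : be <= 12 / 5.
Proof.
have /andP[_ bp] := be_bounds; have h3 := p3; have h4 := p4; rewrite leNgt; apply/negP => h.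
have : cos be < cos (12 / 5 : R).
  by rewrite ltr_cos ?in_itv//=; apply/andP; split; have := be_ge1; have := pi_gt3 R; lra.
rewrite beE; have -> : (12 / 5 : R) = pi - (pi - 12 / 5) by ring.
rewrite cosB cospi sinpi mul0r addr0 mulN1r.
have := cos_ge_quadratic (pi - 12 / 5 : R).
have : (pi - 12 / 5 : R) ^+ 2 <= 9 / 16.
  by rewrite expr2 (_ : 9 / 16 = 3 / 4 * (3 / 4)); [apply: ler_pM; lra|field].
have := cos_al; lra.
Qed.

(** [71/100] is just below [sqrt (1 - (7/10)^2)], where [|cos be| <= 7/10]. It makes the weight at
    [l] at least [(1 + 71/100 - 1/100) / 2 = 85/100]. *)
Let sin_be : 71 / 100 <= sin be.
Proof.
have /andP[b1 b2] := be_bounds.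
have s0 : 0 < sin be by apply: sin_gt0_pi; rewrite b2 andbT; have := be_ge1; lra.
rewrite leNgt; apply/negP => h.
have h2 : sin be * sin be < 71 / 100 * (71 / 100) by apply: ltr_pM => //; exact: ltW.
have := cos2Dsin2 be; rewrite beE !expr2.
have : (cos al - 1 / 2) * (cos al - 1 / 2) <= 7 / 10 * (7 / 10).
  have : `|cos al - 1 / 2| <= 7 / 10.
    by rewrite ler_norml; have := cos_al; have := cos_le1 al => ? ?; apply/andP; split; lra.
  by move=> hh; apply: le_trans (ler_norm _) _; rewrite normrM ler_pM.
lra.
Qed.

Let fE k : f k = 1 + 2 * (cos be - cos (k%:R * d)).
Proof. by rewrite /f YE beE; field. Qed.

Let xk_ge0 k : 0 <= k%:R * d. Proof. by rewrite mulr_ge0// ltW. Qed.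

Let cos_refl x : cos (2 * pi - x) = cos x :> R.
Proof. by rewrite cosB (_ : 2 * pi = pi *+ 2) ?cos2pi ?sin2pi ?mul1r ?mul0r ?addr0// mulr_natl. Qed.

Let f_ge1 k : be <= k%:R * d <= 2 * pi - be -> 1 <= f k.
Proof.
move=> /andP[h1 h2]; rewrite fE; have /andP[b1 b2] := be_bounds; have b3 := be_ge1.
suff : cos (k%:R * d) <= cos be by lra.
have [h|h] := leP (k%:R * d) pi; first by apply: cos_antitone => //; lra.
by rewrite -cos_refl; apply: cos_antitone; lra.
Qed.

Let f_le1 k : 0 <= k%:R * d <= be -> f k <= 1.
Proof.
move=> /andP[h1 h2]; rewrite fE; have /andP[b1 b2] := be_bounds.
have : cos be <= cos (k%:R * d) by apply: cos_antitone => //; lra.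
lra.
Qed.

Let f_le1' k : 2 * pi - be <= k%:R * d <= 2 * pi -> f k <= 1.
Proof.
move=> /andP[h1 h2]; rewrite fE; have /andP[b1 b2] := be_bounds.
have : cos be <= cos (k%:R * d) by rewrite -(cos_refl (k%:R * d)); apply: cos_antitone; lra.
lra.
Qed.

Let f_ge0 k : al <= k%:R * d <= 2 * pi - al -> 0 <= f k.
Proof.
move=> /andP[h1 h2]; rewrite /f YE; have /andP[b1 b2] := be_bounds.
suff : cos (k%:R * d) <= cos al by lra.
have [h|h] := leP (k%:R * d) pi; first by apply: cos_antitone.
by rewrite -cos_refl; apply: cos_antitone => //; lra.
Qed.

Let f_le0 k : 0 <= k%:R * d <= al -> f k <= 0.
Proof.
move=> /andP[h1 h2]; rewrite /f YE; have /andP[b1 b2] := be_bounds.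
have : cos al <= cos (k%:R * d) by apply: cos_antitone => //; lra.
lra.
Qed.

(** Since [Y >= - 2/5], the exponent of [le_expR_tangent] at [2 cos x - Y] is at most
    [11/10 cos x + 11/50 - 2/5], which is the derivative of [log_bound]. *)
Let f_bound k : f k <= 0 -> `|f k| <= expR (11 / 10 * cos (k%:R * d) - 9 / 50).
Proof.
move=> f0; rewrite ler0_norm//; apply: le_trans (le_expR_tangent _) _; first by rewrite oppr_ge0.
by rewrite ler_expR /f YE; have := cos_al; lra.
Qed.

(** Serves when [al] is small and the factor has already become positive; it is then at most [9/16],
    while the right-hand side exceeds [1]. *)
Let f_bound_small k : k%:R * d <= 3 / 4 -> `|f k| <= expR (11 / 10 * cos (k%:R * d) - 9 / 50).
Proof.
move=> h; have [|f0] := leP (f k) 0; first exact: f_bound.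
have c := cos_ge_quadratic (k%:R * d).
have x2 : (k%:R * d) ^+ 2 <= 9 / 16.
  by rewrite expr2 (_ : 9 / 16 = 3 / 4 * (3 / 4)); [apply: ler_pM|field].
have e1 := expR_ge1Dx (11 / 10 * cos (k%:R * d) - 9 / 50).
rewrite gtr0_norm// /f YE; have := cos_le1 al; lra.
Qed.

Let P_bound k : (forall i, (0 < i <= k)%N -> `|f i| <= expR (11 / 10 * cos (i%:R * d) - 9 / 50)) ->
  k%:R * d <= pi -> `|P k| <= expR (log_bound (k%:R * d) / d).
Proof.
elim: k => [|k IH] H kp.
  by rewrite P0 normr1 mul0r /log_bound sin0 !mulr0 subrr mul0r expR0.
have kE : k.+1%:R * d = k%:R * d + d by rewrite -natr1; ring.
have kp' : k%:R * d <= pi by apply: le_trans kp; rewrite kE lerDl ltW.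
have {}IH := IH (fun i hi => H i ltac:(move: hi; clear; lia)) kp'.
rewrite PE -/(f k.+1) normrM.
apply: le_trans (ler_pM (normr_ge0 _) (normr_ge0 _) (H k.+1 ltac:(clear; lia)) IH) _.
rewrite -expRD ler_expR.
have := log_bound_step (xk_ge0 k) d0 ltac:(by rewrite -kE); rewrite -kE => h.
rewrite -(ler_pM2r d0) mulrDl !divfK ?gt_eqF//; lra.
Qed.

Let P_small k : k%:R * d <= 3 / 4 -> `|P k| <= expR (log_bound (k%:R * d) / d).
Proof.
move=> h; apply: P_bound; last by have := pi_gt3 R; lra.
move=> i /andP[_ ik]; apply: f_bound_small; apply: le_trans h.
by apply: ler_wpM2r; [exact: ltW|rewrite ler_nat].
Qed.

(** Up to the angle [al] this is the maximum of [log_bound]; from [al] to [be] the factors lie in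
    [[0, 1]] and [|P|] no longer increases. *)
Let P_T k : k%:R * d <= be -> `|P k| <= expR (21 / 25 / d).
Proof.
have /andP[b1 b2] := be_bounds.
elim: k => [|k IH] kb; first by rewrite P0 normr1 -expR0 ler_expR divr_ge0// ltW.
have kE : k.+1%:R * d = k%:R * d + d by rewrite -natr1; ring.
have [ka|ka] := leP (k.+1%:R * d) al.
  have kp : k.+1%:R * d <= pi by lra.
  apply: le_trans (P_bound _ kp) _.
    move=> i /andP[_ ik]; apply: f_bound; apply: f_le0; rewrite xk_ge0/=; apply: le_trans ka.
    by apply: ler_wpM2r; [exact: ltW|rewrite ler_nat].
  by rewrite ler_expR ler_pM2r ?invr_gt0// log_bound_le// xk_ge0.
rewrite PE -/(f k.+1) normrM.
have f0 : 0 <= f k.+1 by apply: f_ge0; rewrite (ltW ka)/=; lra.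
have f1 : f k.+1 <= 1 by apply: f_le1; rewrite xk_ge0.
have kb' : k%:R * d <= be by have dd := d0; lra.
apply: le_trans (IH kb').
by rewrite ger0_norm// ler_piMl.
Qed.


(** [k1] is the first index whose angle exceeds [be], and [l] the last one whose angle is at most
    [2 pi - be], so that [P l] is the largest term of the main block in absolute value. [m] is the
    power of the weight, chosen so that [m d] is close to [2/5]. *)
Let k1 : nat := (Num.truncn (be / d)).+1.
Let l : nat := Num.truncn ((2 * pi - be) / d).
Let m : nat := Num.truncn (2 / 5 / d).

Let truncn_bounds (x : R) : 0 <= x -> (Num.truncn (x / d))%:R * d <= x < (Num.truncn (x / d)).+1%:R * d.
Proof.
move=> x0; have h : 0 <= x / d by rewrite divr_ge0// ltW.
by have /andP[h1 h2] := truncn_itv h; rewrite -ler_pdivlMr// h1 -ltr_pdivrMr.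
Qed.

Let k1_bounds : be < k1%:R * d <= be + d.
Proof.
have /andP[h1 h2] := truncn_bounds (le_trans ler01 be_ge1); rewrite /k1 h2/=.
by rewrite -natr1 mulrDl mul1r lerD2r.
Qed.

Let l_bounds : l%:R * d <= 2 * pi - be < l.+1%:R * d.
Proof. by apply: truncn_bounds; have /andP[_ b2] := be_bounds; have := pi_gt3 R; lra. Qed.

Let m_bounds : 39 / 100 <= m%:R * d <= 2 / 5.
Proof.
have /andP[h1 h2] := truncn_bounds (ltac:(lra) : 0 <= 2 / 5 :> R); rewrite -/m in h1 h2 *; rewrite h1 andbT.
by move: h2; rewrite -natr1 mulrDl mul1r; have := d1; lra.
Qed.

Let ltn_scale i j : (i < j)%N = (i%:R * d < j%:R * d).
Proof. by rewrite ltr_pM2r// ltr_nat. Qed.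

Let leq_scale i j : (i <= j)%N = (i%:R * d <= j%:R * d).
Proof. by rewrite ler_pM2r// ler_nat. Qed.

Let k1l : (k1 <= l)%N.
Proof.
rewrite -ltnS ltn_scale; have /andP[_ h1] := l_bounds; have /andP[_ h2] := k1_bounds.
by have := be_le; have := p3; have := d1; lra.
Qed.

Let lk2 : (l < k2)%N.
Proof.
rewrite ltn_scale k2E; have /andP[h1 _] := l_bounds; have /andP[b1 _] := be_bounds; lra.
Qed.

Let below_k1 k : (k < k1)%N -> k%:R * d <= be.
Proof.
rewrite ltnS leq_scale => h; apply: le_trans h _.
by have /andP[h1 _] := truncn_bounds (le_trans ler01 be_ge1).
Qed.

(** The last factor vanishes, hence the main block has no boundary term at its end. *)
Let P_k2 : P k2 = 0.
Proof.
have k20 : (0 < k2)%N by exact: leq_ltn_trans lk2.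
by rewrite -(prednK k20) PE prednK// k2E cos_refl YE subrr mul0r.
Qed.

Let P_mono i j : (i <= j)%N -> (forall k, (i <= k < j)%N -> 1 <= f k.+1) -> `|P i| <= `|P j|.
Proof.
elim: j => [|j IH]; first by rewrite leqn0 => /eqP ->.
rewrite leq_eqVlt => /predU1P[->//|]; rewrite ltnS => ij H.
have h : 1 <= f j.+1 by apply: H; rewrite ij ltnSn.
apply: le_trans (IH ij _) _; first by move=> k /andP[ik kj]; apply: H; rewrite ik ltnW.
rewrite PE -/(f j.+1) normrM ger0_norm ?(le_trans ler01 h)//.
by rewrite ler_peMl.
Qed.

Let f_main k : (k1 <= k.+1)%N -> (k.+1 <= l)%N -> 1 <= f k.+1.
Proof.
rewrite !leq_scale => h1 h2; apply: f_ge1.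
have /andP[a1 _] := k1_bounds; have /andP[a2 _] := l_bounds.
by rewrite (le_trans (ltW a1) h1) (le_trans h2 a2).
Qed.

Let P_main k : (k1 <= k < k2)%N -> `|P k| <= `|P l|.
Proof.
move=> /andP[kk1 kk2]; have [kl|lk] := leqP k l.
  apply: P_mono => // i /andP[h1 h2]; apply: f_main => //.
  by apply: leq_trans kk1 _; exact: leq_trans h1 _.
elim: k lk kk2 {kk1} => [//|k IH] lk kk2.
rewrite PE -/(f k.+1) normrM.
have /andP[b1 b2] := be_bounds; have /andP[_ a2] := l_bounds.
have x1 : 2 * pi - be <= k.+1%:R * d.
  by apply: (le_trans (ltW a2)); rewrite -leq_scale.
have x2 : k.+1%:R * d <= 2 * pi - al by rewrite -k2E -leq_scale ltnW.
have f0 : 0 <= f k.+1.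
  apply: f_ge0; rewrite x2 andbT; apply: le_trans x1; have := be_le; have := p3; have := al1; lra.
have f1 : f k.+1 <= 1 by apply: f_le1'; rewrite x1/=; have := al0; lra.
have : `|P k| <= `|P l|.
  move: lk; rewrite ltnS leq_eqVlt => /predU1P[->//|lk]; apply: IH => //; exact: ltnW.
by apply: le_trans; rewrite ger0_norm// ler_piMl.
Qed.

Let f_block k : 264 / 100 <= k%:R * d <= 365 / 100 -> 13 / 10 <= f k.
Proof.
move=> /andP[h1 h2]; rewrite fE.
have e : cos (k%:R * d) = - cos (k%:R * d - pi).
  have {1}-> : k%:R * d = (k%:R * d - pi) + pi by ring.
  by rewrite cosDpi.
have c := cos_ge_quadratic (k%:R * d - pi).
have c2 : (k%:R * d - pi) ^+ 2 <= 51 / 100 * (51 / 100).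
  have : `|k%:R * d - pi| <= 51 / 100.
    by rewrite ler_norml; have := p3; have := p4 => ? ?; apply/andP; split; lra.
  by move=> hh; apply: le_trans (ler_norm _) _; rewrite normrX expr2 ler_pM.
have := beE; have := cos_al; rewrite e; lra.
Qed.

(** [P k1] is the boundary term common to both recurrences and must be exponentially smaller than
    the main term. Around [pi], over an angle of length [1], the factors are at least
    [13/10 >= exp (1/5)]; the [5/4] covers the rounding of [1 / d] to an integer. *)
Let P_k1 : `|P k1| <= 5 / 4 * expR (- (1 / 5 / d)) * `|P l|.
Proof.
pose a := (Num.truncn (264 / 100 / d)).+1; pose b := Num.truncn (1 / d).
have /andP[a1 a2] := truncn_bounds (ltac:(lra) : 0 <= 264 / 100 :> R).
have /andP[b1 b2] := truncn_bounds (ler01 : 0 <= 1 :> R).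
rewrite -/a in a2; rewrite -/b in b1 b2.
have a3 : a%:R * d <= 265 / 100 by rewrite /a -natr1 mulrDl mul1r; have := d1; lra.
have /andP[bb1 bb2] := be_bounds; have /andP[q1 q2] := k1_bounds; have /andP[q3 q4] := l_bounds.
have abd : (a + b)%:R * d <= 365 / 100 by rewrite natrD mulrDl; lra.
have k1a : (k1 <= a)%N by rewrite leq_scale; have := be_le; have := d1; lra.
have abl : (a + b <= l)%N by rewrite -ltnS ltn_scale; have := be_le; have := p3; lra.
have s1 : `|P k1| <= `|P a|.
  apply: P_mono => // k /andP[h1 h2]; apply: f_main; first exact: leqW.
  by apply: leq_trans h2 _; apply: leq_trans abl; exact: leq_addr.
have s2 : `|P (a + b)%N| <= `|P l|.
  apply: P_mono => // k /andP[h1 h2]; apply: f_main => //.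
  by apply: leq_trans k1a _; apply: leqW; apply: leq_trans h1; exact: leq_addr.
have s3 j : (j <= b)%N -> (13 / 10) ^+ j * `|P a| <= `|P (a + j)%N|.
  elim: j => [|j IH] jb; first by rewrite expr0 mul1r addn0.
  rewrite addnS PE -/(f (a + j).+1) normrM exprS -mulrA.
  have h : 13 / 10 <= f (a + j).+1.
    apply: f_block; apply/andP; split.
      by apply: (le_trans (ltW a2)); rewrite -leq_scale -addnS leq_addr.
    by apply: le_trans abd; rewrite -leq_scale -addnS leq_add2l.
  have h0 : 0 <= 13 / 10 :> R by lra.
  apply: ler_pM; [exact: h0|by rewrite mulr_ge0// exprn_ge0| |exact: IH (ltnW jb)].
  by rewrite ger0_norm// (le_trans h0 h).
have s4 : expR (1 / 5 / d) * (4 / 5) <= (13 / 10) ^+ b.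
  apply: (@le_trans _ _ (expR (1 / 5) ^+ b)).
    rewrite -expRM_natr; have h : 4 / 5 <= expR (- (1 / 5)) :> R.
      by have := expR_ge1Dx (- (1 / 5) : R); lra.
    apply: (@le_trans _ _ (expR (1 / 5 / d) * expR (- (1 / 5)))).
      by rewrite ler_wpM2l ?expR_ge0.
    rewrite -expRD ler_expR.
    have : 1 / d <= b.+1%:R by rewrite ler_pdivrMr// ltW.
    rewrite -natr1; have -> : 1 / 5 / d = 1 / 5 * (1 / d) by field; rewrite gt_eqF.
    lra.
  by rewrite lerXn2r ?nnegrE ?expR_ge0//; have := expR_1_5 R; lra.
have s5 := le_trans (s3 b (leqnn b)) s2.
have s6 := le_trans (ler_wpM2r (normr_ge0 (P a)) s4) s5.
apply: le_trans s1 _; have E0 := expR_gt0 (1 / 5 / d); rewrite expRN.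
have -> : 5 / 4 * (expR (1 / 5 / d))^-1 * `|P l| = `|P l| / (expR (1 / 5 / d) * (4 / 5)).
  by field; rewrite gt_eqF.
rewrite ler_pdivlMr ?mulr_gt0//; lra.
Qed.


Let sg := Num.sg (P k1).

Let sgP_ge0 k : (k1 <= k <= k2)%N -> 0 <= sg * P k.
Proof.
elim: k => [/andP[]//|k IH] /andP[]; rewrite leq_eqVlt => /predU1P[<- _|].
  by rewrite -normrEsg normr_ge0.
rewrite ltnS => h1 h2; rewrite PE mulrCA mulr_ge0//; last by apply: IH; rewrite h1 ltnW.
rewrite -/(f k.+1); apply: f_ge0; rewrite -k2E -leq_scale h2 andbT.
have /andP[a1 _] := k1_bounds; have /andP[b1 _] := be_bounds.
apply: le_trans (ltW b1) _; apply: le_trans (ltW a1) _; rewrite -leq_scale; exact: leqW.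
Qed.

Let weight_bounds k : 0 <= weight d k <= 1.
Proof.
have := sin_le1 (k.+1%:R * d); have := sin_geN1 (k.+1%:R * d).
by rewrite /weight => h1 h2; apply/andP; split; lra.
Qed.

Let weight_l : 85 / 100 <= weight d l.
Proof.
rewrite /weight; have /andP[h1 h2] := l_bounds.
have /andP[b1 b2] := be_bounds.
have e : sin (2 * pi - be) = - sin be.
  by rewrite sinB (_ : 2 * pi = pi *+ 2) ?cos2pi ?sin2pi ?mul0r ?mul1r ?sub0r// mulr_natl.
have := sin_lipschitz (l.+1%:R * d) (2 * pi - be).
rewrite e opprK [X in _ <= X]ger0_norm; last by lra.
have h3 : l.+1%:R * d - (2 * pi - be) <= 1 / 100.
  by have := d1; move: h1; rewrite -natr1 mulrDl mul1r; lra.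
have := sin_be; have := ler_norm (sin (l.+1%:R * d) + sin be); lra.
Qed.

Let sin_next k : sin (k%:R * d) - 1 / 100 <= sin (k.+1%:R * d).
Proof.
have := sin_lipschitz (k%:R * d) (k.+1%:R * d).
have -> : k%:R * d - k.+1%:R * d = - d by rewrite -natr1; ring.
rewrite normrN (gtr0_norm d0) => h; have := ler_norm (sin (k%:R * d) - sin (k.+1%:R * d)).
have := d1; lra.
Qed.

Let m_ge : 39 / 100 / d <= m%:R.
Proof. by rewrite ler_pdivrMr//; have /andP[] := m_bounds. Qed.

(* The weights are small where [P] is large. *)
Let T_term k : (k < k1)%N ->
  `|P k| * weight d k ^+ m <= (85 / 100) ^+ m * expR (6 / 25 / d).
Proof.
move=> kk1; have xb := below_k1 kk1; have /andP[b1 b2] := be_bounds.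
have /andP[w0 w1] := weight_bounds k.
have w85 : 0 <= (85 / 100) ^+ m :> R by rewrite exprn_ge0//; lra.
have sn := sin_next k.
have dd := d1; have d00 := d0; have mg := m_ge; have xk := xk_ge0 k.
(* Up to [3/4] both [P] and the weight are bounded in terms of [sin x]: the exponent is [(11/10 -
   39/100) sin x - 9/50 x - 39/100 * 51/100], less than [6/25] since [sin x <= x]. Beyond [3/4],
   [sin x] is bounded below and the uniform bound [P_T] suffices. *)
have [x34|x34] := leP (k%:R * d) (3 / 4).
  have sx0 : 0 <= sin (k%:R * d) by apply: sin_ge0_pi; rewrite xk/=; lra.
  have sx1 := sin_le xk.
  (* [1/2 = 85/100 * 10/17] and [10/17 <= exp (- 13/25)]; a hundredth of [13/25] pays for the
     passage from [(k+1) d] to [k d]. *)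
  have hw : weight d k <= 85 / 100 * expR (- (51 / 100 + sin (k%:R * d))).
    have e1 : 1 - sin (k.+1%:R * d) <= expR (- sin (k.+1%:R * d)).
      by have := expR_ge1Dx (- sin (k.+1%:R * d)); lra.
    apply: (@le_trans _ _ (85 / 100 * (expR (- (13 / 25)) * expR (- sin (k.+1%:R * d))))).
      rewrite /weight; have e2 := ler_pM (ltac:(lra) : 0 <= 10 / 17 :> R) (ltac:(have := sin_le1 (k.+1%:R * d); lra) : 0 <= 1 - sin (k.+1%:R * d)) (expR_13_25 R) e1.
      have := ler_wpM2l (ltac:(lra) : 0 <= 85 / 100 :> R) e2; lra.
    by apply: ler_wpM2l; [lra|rewrite -expRD ler_expR; lra].
  have hm : weight d k ^+ m <= (85 / 100) ^+ m * expR (- (51 / 100 + sin (k%:R * d)) * m%:R).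
    rewrite expRM_natr -exprMn lerXn2r// nnegrE mulr_ge0 ?expR_ge0//; lra.
  apply: le_trans (ler_pM (normr_ge0 _) (exprn_ge0 _ w0) (P_small x34) hm) _.
  rewrite mulrCA ler_wpM2l// -expRD ler_expR.
  have : (51 / 100 + sin (k%:R * d)) * (39 / 100 / d) <= (51 / 100 + sin (k%:R * d)) * m%:R.
    by rewrite ler_wpM2l//; lra.
  have : log_bound (k%:R * d) / d <= (6 / 25 + (51 / 100 + sin (k%:R * d)) * (39 / 100)) / d.
    by rewrite ler_pM2r ?invr_gt0// /log_bound; lra.
  rewrite mulrDl mulrA; lra.
have sx : 67 / 100 <= sin (k%:R * d).
  have [xp|xp] := leP (k%:R * d) (pi / 2).
    have h1 : sin (3 / 4 : R) <= sin (k%:R * d).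
      rewrite -!cosBpihalf -[leLHS]cosN -[leRHS]cosN.
      by apply: cos_antitone; have := p3; lra.
    have h2 := @sin_ge_cubic R (3 / 4) ltac:(lra).
    apply: le_trans h1; apply: le_trans h2; rewrite !exprS expr0; lra.
  have h1 : sin be <= sin (k%:R * d).
    by rewrite -!cosBpihalf; apply: cos_antitone; have := p3; lra.
  have := sin_be; lra.
(* [(1 - 66/100) / 2] is [85/100 * 1/5], and [21/25 - 31/20 * 39/100 < 6/25]. *)
have hw : weight d k <= 85 / 100 * expR (- (31 / 20)).
  by have := expR_31_20 R; rewrite /weight; lra.
have hm : weight d k ^+ m <= (85 / 100) ^+ m * expR (- (31 / 20) * m%:R).
  by rewrite expRM_natr -exprMn lerXn2r// nnegrE mulr_ge0 ?expR_ge0//; lra.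
apply: le_trans (ler_pM (normr_ge0 _) (exprn_ge0 _ w0) (P_T xb) hm) _.
rewrite mulrCA ler_wpM2l// -expRD ler_expR.
have di : 0 < d^-1 by rewrite invr_gt0.
have : 31 / 20 * (39 / 100 / d) <= 31 / 20 * m%:R by rewrite ler_wpM2l//; lra.
lra.
Qed.


(** The largest index with [L d < pi]: the sines in the recurrence stay positive, and the flux grows
    over the longest possible range. *)
Let L : nat := n./2.

Let L_d : pi - 3 / 4 * d <= L%:R * d <= pi - d / 4.
Proof.
have := rd; rewrite addn1 -natr1 natrM mulrDl mul1r => e.
have nE : n%:R * d = 2 * pi - d / 2 by lra.
have [e1 e2] := half_bounds n; rewrite -/L in e1 e2.
move: e1 e2; rewrite !leq_scale addn1 -[_.+1%:R]natr1 natrM => e1 e2.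
apply/andP; split; lra.
Qed.

Let sin_L k : (k < L)%N -> r%:R^-1 <= sin (k.+1%:R * d).
Proof.
move=> kL; have /andP[h1 h2] := L_d.
have kE : k.+1%:R * d = k%:R * d + d by rewrite -[k.+1%:R]natr1; ring.
have x1 : d / 4 <= k.+1%:R * d by rewrite kE; have := xk_ge0 k; have := d0; lra.
have x2 : k.+1%:R * d <= pi - d / 4 by apply: le_trans h2; rewrite -leq_scale.
have rpos : 0 < r%:R :> R by rewrite ltr0n addn1.
have rE : r%:R^-1 = d / (4 * pi) by rewrite -rd invfM mulrC divfK// gt_eqF.
have s4 : r%:R^-1 <= sin (d / 4).
  apply: le_trans (sin_ge_cubic _); last by rewrite divr_ge0// ltW.
  have d2 : (d / 4) ^+ 3 <= d / 4 * (1 / 100).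
    have q1 : d / 4 * (d / 4) <= 1 * (1 / 100).
      by apply: ler_pM; have := d1; lra.
    by rewrite !exprS expr0 mulr1 ler_wpM2l//; lra.
  have : d / (4 * pi) <= d / 12.
    by rewrite ler_pM2l// lef_pV2 ?posrE ?mulr_gt0 ?pi_gt0//; have := pi_gt3 R; lra.
  rewrite rE; have := d0; lra.
apply: le_trans s4 _.
have [xp|xp] := leP (k.+1%:R * d) (pi / 2).
  rewrite -!cosBpihalf -[leLHS]cosN -[leRHS]cosN.
  by apply: cos_antitone; have := d0; have := d1; have := p3; lra.
have -> : sin (d / 4) = sin (pi - d / 4) by rewrite sinB sinpi cospi; ring.
by rewrite -!cosBpihalf; apply: cos_antitone; have := d0; have := d1; have := p3; lra.
Qed.

Let m_L : (0 < m <= L)%N.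
Proof.
have /andP[h1 h2] := m_bounds; have /andP[h3 h4] := L_d.
have dd := d1; have pp := p3; apply/andP; split.
  by rewrite ltn_scale mul0r; lra.
by rewrite leq_scale; lra.
Qed.

(** [17/40 * (92/100 + 98/100)] exceeds [4/5], and [16] bounds [exp (17/40 * 5)]. *)
Let kappa_le : r%:R * expR (- (17 / 40) * ((cos (m%:R * d) - cos (L%:R * d)) / d - 5))
  <= 16 * r%:R * expR (- (4 / 5 / d)).
Proof.
have r0 : 0 <= r%:R :> R by [].
have -> : 16 * r%:R * expR (- (4 / 5 / d)) = r%:R * (16 * expR (- (4 / 5 / d))) by ring.
apply: ler_wpM2l => //.
have c1 : 92 / 100 <= cos (m%:R * d).
  have /andP[_ h] := m_bounds; have c := cos_ge_quadratic (m%:R * d).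
  have : (m%:R * d) ^+ 2 <= 2 / 5 * (2 / 5) by rewrite expr2 ler_pM.
  lra.
have c2 : cos (L%:R * d) <= - (98 / 100).
  have /andP[h1 h2] := L_d; have dd := d1.
  have -> : cos (L%:R * d) = - cos (pi - L%:R * d) by rewrite cosB cospi sinpi; ring.
  have c := cos_ge_quadratic (pi - L%:R * d).
  have : (pi - L%:R * d) ^+ 2 <= 1 / 100 * (1 / 100).
    by rewrite expr2; apply: ler_pM; have := d0; lra.
  lra.
have e16 : expR (17 / 8) <= 16 :> R.
  have -> : expR (17 / 8) = expR (17 / 32) ^+ 4 :> R by rewrite -expRM_natr; congr expR; field.
  apply: (@le_trans _ _ (2 ^+ 4)); last by rewrite !exprS expr0; lra.
  rewrite lerXn2r ?nnegrE ?expR_ge0//.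
  have h : 1 / 2 <= expR (- (17 / 32)) :> R by apply: expRN_ge4; lra.
  by move: h; rewrite expRN mul1r lef_pV2 ?posrE ?expR_gt0.
apply: le_trans (_ : expR (17 / 8) * expR (- (4 / 5 / d)) <= _); last by rewrite ler_wpM2r ?expR_ge0.
rewrite -expRD ler_expR.
have : (19 / 10) / d <= (cos (m%:R * d) - cos (L%:R * d)) / d.
  by rewrite ler_pM2r ?invr_gt0//; lra.
have di : 0 < d^-1 by rewrite invr_gt0.
lra.
Qed.


Hypothesis small : 200 * r%:R ^+ 4 * expR (- (1 / 100 / d)) <= 1.
Hypothesis P_l : expR (1 / 4 / d) <= `|P l|.

Let Q k := sg * P k.

Let P_k1_neq0 : P k1 != 0.
Proof.
apply/eqP => h; have hz k : (k1 <= k)%N -> P k = 0.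
  elim: k => [//|k IH]; rewrite leq_eqVlt => /predU1P[<-//|kk].
  by rewrite PE IH ?mulr0.
by have := P_l; rewrite hz// normr0 leNgt expR_gt0.
Qed.

Let normQ k : `|Q k| = `|P k|.
Proof. by rewrite normrM normr_sg P_k1_neq0 mul1r. Qed.

Let QE k : Q k.+1 = (Y - 2 * cos (k.+1%:R * d)) * Q k.
Proof. by rewrite /Q PE mulrCA. Qed.

Let S0 := \sum_(0 <= k < k1) Q k.
Let S1 := \sum_(k1 <= k < k2) Q k.
Let Tm := \sum_(0 <= k < k1) Q k * weight d k ^+ m.
Let Mm := \sum_(k1 <= k < k2) Q k * weight d k ^+ m.
Let kap := r%:R * expR (- (17 / 40) * ((cos (m%:R * d) - cos (L%:R * d)) / d - 5)).
Let p := `|P l|.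

Let rpos : 1 <= r%:R :> R. Proof. by rewrite ler1n addn1. Qed.

Let k12 : (k1 <= k2)%N. Proof. exact: leq_trans k1l (ltnW lk2). Qed.
Let Lr : L%:R <= r%:R :> R.
Proof. by rewrite ler_nat; exact: half_le. Qed.

Let cancel : `|S0| * Mm <= `|S1| * `|Tm| +
  L%:R * (`|S1| * ((\sum_(0 <= k < k1) `|Q k|) * kap + (`|Q 0| + `|Q k1|) * L%:R * r%:R)
  + `|S0| * ((\sum_(k1 <= k < k2) `|Q k|) * kap + (`|Q k1| + `|Q k2|) * L%:R * r%:R)).
Proof.
have Lpi : L%:R * d < pi by have /andP[_ h] := L_d; apply: le_lt_trans h _; have := d0; lra.
have r0 : 0 < r%:R :> R by exact: lt_le_trans rpos.
have := alternating_cancellation QE d0 Lpi r0 sin_L m_L k12.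
under [\sum_(0 <= k < k1) _ * _ ^+ 0]eq_bigr => k _ do rewrite expr0 mulr1.
by under [\sum_(k1 <= k < k2) _ * _ ^+ 0]eq_bigr => k _ do rewrite expr0 mulr1.
Qed.

Let sum_le (i j : nat) (F : nat -> R) (C : R) : (i <= j)%N -> (j <= r)%N -> 0 <= C ->
  (forall k, (i <= k < j)%N -> F k <= C) -> \sum_(i <= k < j) F k <= r%:R * C.
Proof.
move=> ij jr C0 H; apply: (@le_trans _ _ (\sum_(i <= k < j) C)).
  by rewrite big_nat [leRHS]big_nat; apply: ler_sum => k; exact: H.
by rewrite sumr_const_nat -[C *+ _]mulr_natl ler_wpM2r// ler_nat (leq_trans (leq_subr _ _)).
Qed.

Let W := (85 / 100 : R) ^+ m.
Let W0 : 0 < W. Proof. by rewrite exprn_gt0//; lra. Qed.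

Let S1_ge : p <= S1.
Proof.
have ge0 k : (k1 <= k < k2)%N -> 0 <= Q k by move=> /andP[h1 h2]; apply: sgP_ge0; rewrite h1 ltnW.
rewrite /S1 (bigD1_seq l) /= ?mem_index_iota ?k1l ?lk2 ?iota_uniq//.
rewrite -[leLHS]addr0; apply: lerD.
  by rewrite /p -normQ ger0_norm// ge0// k1l lk2.
rewrite big_seq_cond; apply: sumr_ge0 => k; rewrite mem_index_iota => /andP[h _]; exact: ge0.
Qed.

Let sumM_le : \sum_(k1 <= k < k2) `|Q k| <= r%:R * p.
Proof. by apply: (sum_le k12 k2r (normr_ge0 _)) => k hk; rewrite normQ; exact: P_main. Qed.

Let S1_le : `|S1| <= r%:R * p.
Proof. exact: le_trans (ler_norm_sum _ _ _) sumM_le. Qed.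

Let Mm_ge : p * W <= Mm.
Proof.
have ge0 k : (k1 <= k < k2)%N -> 0 <= Q k by move=> /andP[h1 h2]; apply: sgP_ge0; rewrite h1 ltnW.
rewrite /Mm (bigD1_seq l) /= ?mem_index_iota ?k1l ?lk2 ?iota_uniq//.
rewrite -[leLHS]addr0; apply: lerD.
  have -> : Q l = p by rewrite /p -normQ ger0_norm// ge0// k1l lk2.
  apply: ler_wpM2l; first exact: normr_ge0.
  have /andP[w0 w1] := weight_bounds l; have h85 : 0 <= 85 / 100 :> R by lra.
  rewrite /W; apply: lerXn2r; rewrite ?nnegrE//; exact: weight_l.
rewrite big_seq_cond; apply: sumr_ge0 => k; rewrite mem_index_iota => /andP[h _].
by rewrite mulr_ge0 ?ge0// exprn_ge0//; have /andP[] := weight_bounds k.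
Qed.

Let Tm_le : `|Tm| <= r%:R * (W * expR (6 / 25 / d)).
Proof.
apply: le_trans (ler_norm_sum _ _ _) _.
apply: (sum_le (leq0n _) (leq_trans k12 k2r)); first by rewrite mulr_ge0 ?expR_ge0// ltW.
move=> k /andP[_ hk]; rewrite normrM normQ [X in _ * X <= _]ger0_norm; first exact: T_term.
by rewrite exprn_ge0//; have /andP[] := weight_bounds k.
Qed.

Let sumT_le : \sum_(0 <= k < k1) `|Q k| <= r%:R * expR (21 / 25 / d).
Proof.
apply: (sum_le (leq0n _) (leq_trans k12 k2r) (expR_ge0 _)).
by move=> k /andP[_ hk]; rewrite normQ; exact: P_T (below_k1 hk).
Qed.

Let W_inv : W^-1 <= expR (7 / 100 / d).
Proof.
have h : (85 / 100)^-1 <= expR (17 / 100) :> R.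
  have -> : expR (17 / 100) = expR (17 / 200) ^+ 2 :> R by rewrite -expRM_natr; congr expR; field.
  apply: (@le_trans _ _ ((217 / 200) ^+ 2)); first by rewrite expr2; lra.
  by have := expR_ge1Dx (17 / 200 : R) => h; rewrite lerXn2r ?nnegrE ?expR_ge0//; lra.
rewrite /W -exprVn; apply: (@le_trans _ _ (expR (17 / 100) ^+ m)).
  by rewrite lerXn2r ?nnegrE ?expR_ge0// invr_ge0; lra.
rewrite -expRM_natr ler_expR ler_pdivlMr// -mulrA.
have /andP[_ h2] := m_bounds; lra.
Qed.


Let sum_split : \sum_(0 <= k < k2) Q k = S0 + S1.
Proof. by rewrite (big_cat_nat (n := k1)). Qed.

Let S0_le : `|S0| <= p / 2.
Proof.
pose X : R := r%:R ^+ 4; pose s := expR (- (1 / 100 / d)).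
have X1 : 1 <= X by rewrite exprn_ege1.
have s0 : 0 < s := expR_gt0 _.
have di : 0 < d^-1 by rewrite invr_gt0.
have p0 : 0 < p by apply: lt_le_trans P_l; exact: expR_gt0.
have rX k : (k <= 4)%N -> r%:R ^+ k <= X by move=> k4; rewrite /X ler_weXn2l.
(* Every error is brought to an exponent [c / d] with [c <= 24/100] and compared with [p * s], the
   main term less a hundredth in the exponent; [small] then absorbs the powers of [r] and the
   constants. *)
have eps c : c <= 24 / 100 -> expR (c / d) <= p * s.
  move=> hc; apply: (@le_trans _ _ (expR (1 / 4 / d) * s)); last by rewrite ler_wpM2r ?(ltW s0).
  rewrite /s -expRD ler_expR -[X in _ + X]mulNr -mulrDl ler_pM2r//; lra.
have es c : c <= - (1 / 100) -> expR (c / d) <= s.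
  by move=> hc; rewrite /s ler_expR -mulNr ler_pM2r.
have r0 : 0 <= r%:R :> R by [].
have kap_le : kap <= 16 * r%:R * expR (- (4 / 5 / d)) by exact: kappa_le.
have kap0 : 0 <= kap by rewrite mulr_ge0 ?expR_ge0.
set c := 5 / 4 * expR (- (1 / 5 / d)).
have c0 : 0 <= c by rewrite mulr_ge0 ?expR_ge0.
have Pk1 : `|Q k1| <= c * p by rewrite normQ; exact: P_k1.
have Qk2 : `|Q k2| = 0 by rewrite normQ P_k2 normr0.
have Q0 : `|Q 0| = 1 by rewrite normQ P0 normr1.
have T0 : 0 <= `|S0| by [].
have W00 := W0.
have step1 : `|S0| * (p * W) <= r%:R * p * (r%:R * (W * expR (6 / 25 / d))) +
   r%:R * (r%:R * p * (r%:R * expR (21 / 25 / d) * (16 * r%:R * expR (- (4 / 5 / d))) + (1 + c * p) * r%:R * r%:R)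
     + `|S0| * (r%:R * p * (16 * r%:R * expR (- (4 / 5 / d))) + c * p * r%:R * r%:R)).
  apply: le_trans (ler_wpM2l T0 Mm_ge) _; apply: le_trans cancel _.
  have sumT0 : 0 <= \sum_(0 <= k < k1) `|Q k| by apply: sumr_ge0.
  have sumM0 : 0 <= \sum_(k1 <= k < k2) `|Q k| by apply: sumr_ge0.
  have L0 : 0 <= L%:R :> R by [].
  have Lr2 : L%:R * r%:R <= r%:R * r%:R :> R by rewrite ler_wpM2r// Lr.
  apply: lerD; first by apply: ler_pM.
  have a1 : (\sum_(0 <= k < k1) `|Q k|) * kap <= r%:R * expR (21 / 25 / d) * (16 * r%:R * expR (- (4 / 5 / d))).
    by apply: ler_pM => //; exact: sumT_le.
  have a2 : (\sum_(k1 <= k < k2) `|Q k|) * kap <= r%:R * p * (16 * r%:R * expR (- (4 / 5 / d))).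
    by apply: ler_pM => //; exact: sumM_le.
  have a3 : (`|Q 0| + `|Q k1|) * L%:R * r%:R <= (1 + c * p) * r%:R * r%:R.
    rewrite -[leLHS]mulrA -[leRHS]mulrA.
    by apply: ler_pM; [exact: addr_ge0|exact: mulr_ge0|rewrite Q0 lerD2l|exact: Lr2].
  have a4 : (`|Q k1| + `|Q k2|) * L%:R * r%:R <= c * p * r%:R * r%:R.
    rewrite Qk2 addr0 -[leLHS]mulrA -[leRHS]mulrA.
    by apply: ler_pM; [exact: normr_ge0|exact: mulr_ge0|exact: Pk1|exact: Lr2].
  have n1 : 0 <= (\sum_(0 <= k < k1) `|Q k|) * kap + (`|Q 0| + `|Q k1|) * L%:R * r%:R.
    by rewrite addr_ge0// ?mulr_ge0// ?addr_ge0.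
  have n2 : 0 <= (\sum_(k1 <= k < k2) `|Q k|) * kap + (`|Q k1| + `|Q k2|) * L%:R * r%:R.
    by rewrite addr_ge0// ?mulr_ge0// ?addr_ge0.
  apply: ler_pM; [exact: L0|by rewrite addr_ge0// mulr_ge0|exact: Lr|].
  apply: lerD; last by apply: ler_wpM2l => //; exact: lerD.
  by apply: ler_pM; [exact: normr_ge0|exact: n1|exact: S1_le|exact: lerD].
set V := expR (7 / 100 / d) in (W_inv) *.
have V0 : 0 < V := expR_gt0 _.
(* Division by [W]: the first error loses its factor [W], while the others are multiplied by
   [W^-1 <= V]. *)
have step2 : `|S0| * p <= r%:R ^+ 2 * p * expR (6 / 25 / d) +
   V * (r%:R * (r%:R * p * (r%:R * expR (21 / 25 / d) * (16 * r%:R * expR (- (4 / 5 / d))) + (1 + c * p) * r%:R * r%:R)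
     + `|S0| * (r%:R * p * (16 * r%:R * expR (- (4 / 5 / d))) + c * p * r%:R * r%:R))).
  move: step1; set Z := r%:R * (_ + `|S0| * _) => step1.
  have Z0 : 0 <= Z.
    by rewrite !(mulr_ge0, addr_ge0, expR_ge0)// ltW.
  have := ler_wpM2r (ltW (ltac:(rewrite invr_gt0; exact: W00) : 0 < W^-1)) step1.
  rewrite mulrA mulfK ?gt_eqF// mulrDl => h; apply: le_trans h _; apply: lerD.
    by rewrite le_eqVlt; apply/orP; left; apply/eqP; field; rewrite gt_eqF.
  by rewrite [leRHS]mulrC; apply: ler_wpM2l => //; exact: W_inv.
have k1' : V * (expR (21 / 25 / d) * expR (- (4 / 5 / d))) <= p * s.
  have -> : V * (expR (21 / 25 / d) * expR (- (4 / 5 / d))) = expR (11 / 100 / d).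
    by rewrite /V -!expRD; congr expR; field; rewrite gt_eqF.
  by apply: eps; lra.
have k2' : V <= p * s by apply: eps; lra.
have k3' : V * expR (- (4 / 5 / d)) <= s.
  rewrite /V -expRD -mulNr -mulrDl; apply: es; lra.
have k4' : V * c <= 5 / 4 * s.
  rewrite /c mulrCA; apply: ler_wpM2l; first by lra.
  rewrite /V -expRD -mulNr -mulrDl; apply: es; lra.
have k5' : expR (6 / 25 / d) <= p * s by apply: eps; lra.
have X0 : 0 <= X by lra.
have r2 := rX 2%N isT; have r3 := rX 3%N isT.
have ps0 : 0 <= p * s by rewrite mulr_ge0 ?ltW.
have t1 : r%:R ^+ 2 * expR (6 / 25 / d) <= X * (p * s) by apply: ler_pM => //; rewrite ?exprn_ge0 ?expR_ge0.
have t2 : X * (V * (expR (21 / 25 / d) * expR (- (4 / 5 / d)))) <= X * (p * s) by rewrite ler_wpM2l.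
have t3 : X * V <= X * (p * s) by rewrite ler_wpM2l.
have t4 : X * (V * c) * p <= X * (5 / 4 * s) * p by apply: ler_wpM2r; [exact: ltW|apply: ler_wpM2l].
have t5 : r%:R ^+ 3 * (V * expR (- (4 / 5 / d))) <= X * s by apply: ler_pM => //; rewrite ?exprn_ge0 ?mulr_ge0 ?expR_ge0 ?ltW.
have t6 : r%:R ^+ 3 * (V * c) <= X * (5 / 4 * s) by apply: ler_pM => //; rewrite ?exprn_ge0 ?mulr_ge0 ?expR_ge0 ?ltW.
have t7 : `|S0| * (16 * (r%:R ^+ 3 * (V * expR (- (4 / 5 / d)))) + r%:R ^+ 3 * (V * c)) <= `|S0| * (16 * (X * s) + X * (5 / 4 * s)).
  by rewrite ler_wpM2l//; lra.
have fin : `|S0| <= X * (p * s) + 16 * (X * (p * s)) + X * (p * s) + X * (5 / 4 * s) * p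
    + `|S0| * (16 * (X * s) + X * (5 / 4 * s)).
  rewrite -(ler_pM2r p0); apply: le_trans step2 _.
  have -> : r%:R ^+ 2 * p * expR (6 / 25 / d) +
   V * (r%:R * (r%:R * p * (r%:R * expR (21 / 25 / d) * (16 * r%:R * expR (- (4 / 5 / d))) + (1 + c * p) * r%:R * r%:R)
     + `|S0| * (r%:R * p * (16 * r%:R * expR (- (4 / 5 / d))) + c * p * r%:R * r%:R))) =
   (r%:R ^+ 2 * expR (6 / 25 / d) + 16 * (X * (V * (expR (21 / 25 / d) * expR (- (4 / 5 / d))))) +
     X * V + X * (V * c) * p + `|S0| * (16 * (r%:R ^+ 3 * (V * expR (- (4 / 5 / d)))) + r%:R ^+ 3 * (V * c))) * p.
    by rewrite /X; ring.
  by rewrite ler_pM2r//; lra.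
have sm : 200 * (X * s) <= 1 by rewrite mulrA; exact: small.
have sp : 200 * (X * s) * p <= p by apply: ler_piMl; [exact: ltW|exact: sm].
have sS : 200 * (X * s) * `|S0| <= `|S0| by apply: ler_piMl.
move: fin; have -> : X * (p * s) = X * s * p by ring.
have -> : X * (5 / 4 * s) = 5 / 4 * (X * s) by ring.
move: (X * s) sp sS => y sp sS fin.
have : 0 <= p by exact: ltW.
move: T0 sp sS fin; move: `|S0| p => t q; lra.
Qed.

Lemma sum_dominated : p / 2 <= `|\sum_(0 <= k < k2) P k| <= 2 * r%:R * p.
Proof.
have e : `|\sum_(0 <= k < k2) P k| = `|S0 + S1|.
  rewrite -sum_split /Q -mulr_sumr normrM normr_sg P_k1_neq0 mul1r//.
have p0 : 0 < p by apply: lt_le_trans P_l; exact: expR_gt0.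
have h0 := S0_le; have h1 := S1_ge; have h2 := S1_le; have r1 := rpos.
have := ler_norm S1; have := ler_norm (S0 + S1); have := ler_normB (S0 + S1) S0.
rewrite e (_ : S0 + S1 - S0 = S1); last by ring.
have := ler_normD S0 S1; have : p <= r%:R * p by apply: ler_peMl; [exact: ltW|exact: rpos].
by move=> a1 a2 a3 a4 a5; apply/andP; split; lra.
Qed.

End dominant.

(** * The limit *)

Section growth.
Variable R : realType.
Notation Lob := (@lobachevsky R).
Definition lsin_sum (h : R) (n : nat) : R := \sum_(j < n) lsin (j.+1%:R * h).

Lemma ln_prod (F : nat -> R) (n : nat) : (forall j, (j < n)%N -> 0 < F j) ->
  0 < \prod_(j < n) F j /\ ln (\prod_(j < n) F j) = \sum_(j < n) ln (F j).
Proof.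
elim: n => [|n IH] H; first by rewrite !big_ord0 ln1.
have [h1 h2] := IH (fun j hj => H j (ltnW hj)).
rewrite !big_ord_recr /= mulr_gt0 ?H//; split => //.
by rewrite lnM ?posrE ?H// h2.
Qed.

Lemma ln_prod_sine (h : R) (n : nat) : 0 < h -> n.-1%:R * h < pi ->
  0 < \prod_(1 <= k < n) `|2 * sin (k%:R * h)| /\
  ln (\prod_(1 <= k < n) `|2 * sin (k%:R * h)|) = lsin_sum h n.-1.
Proof.
move=> h0 nh; have pos j : (j < n.-1)%N -> 0 < 2 * sin (j.+1%:R * h).
  move=> jn; rewrite mulr_gt0// sin_gt0_pi// mulr_gt0 ?ltr0n//=.
  by apply: le_lt_trans nh; rewrite ler_wpM2r ?(ltW h0)// ler_nat.
have e : \prod_(1 <= k < n) `|2 * sin (k%:R * h)| = \prod_(j < n.-1) (2 * sin (j.+1%:R * h)).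
  rewrite big_add1 big_mkord; apply: eq_bigr => j _.
  by rewrite gtr0_norm// pos.
by rewrite e; exact: (@ln_prod (fun j => 2 * sin (j.+1%:R * h)) n.-1 pos).
Qed.

Variables (n N : nat).
Hypothesis n0 : (0 < n)%N.
Local Notation r := (2 * n + 1)%N.
Hypothesis N0 : (0 < N < r)%N.
Let h : R := 2 * pi / r%:R.
Let al : R := `|N%:R * (2 * h) - 2 * pi|.
Let l : nat := Num.truncn ((2 * pi - 2 * theta_fig8 al) / (2 * h)).
Hypothesis h1 : 2 * h <= 1 / 100.
Hypothesis al1 : al <= 177 / 100.
Hypothesis small : 200 * r%:R ^+ 4 * expR (- (1 / 100 / (2 * h))) <= 1.
(** By [prod_sine_split], [A / h] is the logarithm of [|{N}| |P_l| / r]. *)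
Let A : R := - (h * lsin_sum h (N - l).-1) - h * lsin_sum h (r - N - l).-1.
Hypothesis h2 : (N - l).-1%:R * h < pi.
Hypothesis h3 : (r - N - l).-1%:R * h < pi.
Hypothesis A_ge : 1 / 4 <= 2 * A.

Let r0 : 0 < r%:R :> R. Proof. by rewrite ltr0n addn1. Qed.
Let h0 : 0 < h. Proof. by rewrite divr_gt0// mulr_gt0// pi_gt0. Qed.
Let rh : r%:R * h = 2 * pi. Proof. by rewrite /h mulrC divfK// gt_eqF. Qed.
Let k2 := minn N (r - N).

Let k2E : k2%:R * (2 * h) = 2 * pi - al.
Proof.
have /andP[N1 N2] := N0.
have e : (r - N)%:R * (2 * h) = 4 * pi - N%:R * (2 * h) by rewrite natrB 1?ltnW// mulrBl; have := rh; lra.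
rewrite /k2 /al; have [Nr|Nr] := leqP N (r - N).
  have : N%:R * (2 * h) <= (r - N)%:R * (2 * h) by rewrite ler_wpM2r ?ler_nat// mulr_ge0// ltW.
  by rewrite e => k; rewrite ler0_norm; lra.
have : (r - N)%:R * (2 * h) <= N%:R * (2 * h) by rewrite ler_wpM2r ?ler_nat 1?ltnW// mulr_ge0// ltW.
by rewrite e => k; rewrite ger0_norm; lra.
Qed.

Let lk2 : (l < k2)%N.
Proof.
have d0 : 0 < 2 * h by rewrite mulr_gt0.
have al2 : 0 <= al < 2 * pi / 3 by rewrite /al normr_ge0/= -/al; have := al1; have := pi_gt_314 R; lra.
have [/andP[b1 b2] _] := theta_fig8_bounds al2.
have x0 : 0 <= (2 * pi - 2 * theta_fig8 al) / (2 * h).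
  by rewrite divr_ge0 ?(ltW d0)//; have := pi_gt0 R; lra.
have /andP[c1 _] := truncn_itv x0.
rewrite -(ltr_nat R) -(ltr_pM2r d0) k2E -/l in c1 *.
by rewrite ler_pdivlMr// in c1; lra.
Qed.

Let p := `|jones_prod R n N l|.
Let sN := `|2 * sin (N%:R * h)|.

Let sN0 : 0 < sN.
Proof. by rewrite normr_gt0 mulf_neq0//; exact: sin_step_neq0. Qed.

Let p0ln : 0 < p /\ ln sN + ln p = ln r%:R + A / h.
Proof.
have [a1 a2] := ln_prod_sine h0 h2; have [b1 b2] := ln_prod_sine h0 h3.
have e := @prod_sine_split R n N N0 l lk2; rewrite -/h -/sN -/p in e.
have ab := mulr_gt0 a1 b1.
have p0 : 0 < p.
  rewrite lt_neqAle normr_ge0 andbT; apply/eqP => pz; move: e; rewrite -pz mulr0 mul0r => /eqP.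
  by rewrite eq_sym gt_eqF.
split => //; rewrite -lnM ?posrE//.
have -> : sN * p = r%:R / ((\prod_(1 <= k < N - l) `|2 * sin (k%:R * h)|) * (\prod_(1 <= k < r - N - l) `|2 * sin (k%:R * h)|)).
  by rewrite -e mulfK// gt_eqF.
rewrite ln_div ?posrE// lnM ?posrE// a2 b2 /A.
by field; rewrite gt_eqF.
Qed.

Let lnr0 : 0 <= ln r%:R :> R. Proof. by rewrite ln_ge0// ler1n addn1. Qed.
Let ln2_le : ln 2 <= 1 :> R. Proof. by have := @ln_le_sub1 R 2 ltac:(lra); lra. Qed.

Let sN_le : ln sN <= ln r%:R.
Proof.
rewrite ler_ln ?posrE//; apply: (@le_trans _ _ 2).
  rewrite /sN normrM (gtr0_norm (x := 2))//.
  by have : `|sin (N%:R * h)| <= 1 := sin_max _; lra.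
rewrite ler_nat; apply: leq_trans (leq_addr 1 _); exact: leq_pmulr.
Qed.

Let p_ge : expR (1 / 4 / (2 * h)) <= p.
Proof.
have [p0 e] := p0ln; rewrite -[p]lnK ?posrE// ler_expR.
apply: (@le_trans _ _ (A / h)); last by have := sN_le; lra.
have -> : 1 / 4 / (2 * h) = (1 / 8) / h by field; rewrite gt_eqF.
by rewrite ler_pM2r ?invr_gt0//; have := A_ge; lra.
Qed.

(** [ln sN + ln p] equals [ln r + A / h]. What remains, [s1] and the quotient of the sum by [p],
    lies between constant multiples of powers of [r]. *)
Lemma ln_colored_jones_bound :
  `|2 * h * ln (cmod (colored_jones_fig8 R r N.-1)) - 2 * A| <= 2 * h * (3 * ln r%:R + 2).
Proof.
have [p0 e] := p0ln; have /andP[N1 N2] := N0.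
have d0 : 0 < 2 * h by rewrite mulr_gt0.
have YE : 2 * cos (N%:R * (2 * h)) = 2 * cos al.
  have ca : cos (N%:R * (2 * h) - 2 * pi) = cos (N%:R * (2 * h)).
    by rewrite cosB (_ : 2 * pi = pi *+ 2) ?cos2pi ?sin2pi ?mulr1 ?mulr0 ?addr0// mulr_natl.
  by rewrite /al; have [x0|x0] := leP 0 (N%:R * (2 * h) - 2 * pi);
    [rewrite ger0_norm|rewrite ltr0_norm// cosN]; rewrite ?ca.
have rd : r%:R * (2 * h) = 4 * pi by have := rh; lra.
have P00 : jones_prod R n N 0 = 1 by rewrite /jones_prod big_geq.
have k2r : (k2 <= r)%N by rewrite /k2 (leq_trans (geq_minl _ _))// ltnW.
have := @sum_dominated R (2 * h) _ al (jones_prod R n N) n k2 (@jones_prodS R n N)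
  P00 d0 h1 rd (normr_ge0 _) al1 YE k2E k2r small p_ge.
set S := `|\sum_(0 <= k < k2) _|; rewrite -/l -/p => /andP[S1 S2].
have S0 : 0 < S by apply: lt_le_trans S1; rewrite divr_gt0.
pose s1 := `|2 * sin (1 * h)|.
have s1E : s1 = 2 * sin h.
  rewrite /s1 mul1r ger0_norm// mulr_ge0// sin_ge0_pi// (ltW h0)/=; have := pi_gt3 R; have := h1; lra.
have hs := sin_le (ltW h0).
have hs2 : h / 2 <= sin h.
  apply: le_trans (sin_ge_cubic (ltW h0)).
  have : h * (h * h) <= h * (1 * 1) by rewrite ler_wpM2l ?(ltW h0)// ler_pM ?(ltW h0)//; have := h1; lra.
  by rewrite !exprS expr0; have := h0; lra.
have s10 : 0 < s1 by rewrite s1E; have := h0; lra.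
have ls1 : - ln r%:R <= ln s1 <= 1.
  apply/andP; split; last by have := ln_le_sub1 s10; rewrite s1E; have := h1; lra.
  rewrite -lnV ?posrE// ler_ln ?posrE ?invr_gt0// s1E.
  have : r%:R^-1 <= h by rewrite /h -[leLHS]mul1r ler_wpM2r ?invr_ge0 ?(ltW r0)//; have := pi_gt3 R; lra.
  lra.
have cV : cmod (colored_jones_fig8 R r N.-1) = sN / s1 * S.
  by rewrite (colored_jones_fig8E R n0 N0) !cmodM cmodV !cmod_brace cmod_real.
have lnV' : ln (cmod (colored_jones_fig8 R r N.-1)) = ln sN - ln s1 + ln S.
  by rewrite cV lnM ?posrE ?divr_gt0// ln_div ?posrE.
have lS1 : ln p - 1 <= ln S.
  apply: (@le_trans _ _ (ln (p / 2))); first by rewrite ln_div ?posrE//; have := ln2_le; lra.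
  by rewrite ler_ln ?posrE ?divr_gt0.
have lS2 : ln S <= 1 + ln r%:R + ln p.
  apply: (@le_trans _ _ (ln (2 * r%:R * p))).
    by rewrite ler_ln ?posrE ?mulr_gt0.
  by rewrite lnM ?posrE ?mulr_gt0// lnM ?posrE//; have := ln2_le; lra.
have AE : 2 * A = 2 * h * (A / h) by field; rewrite gt_eqF.
rewrite AE -mulrBr normrM (gtr0_norm d0) ler_wpM2l ?(ltW d0)// lnV' ler_norml.
move/andP: ls1 => [q1 q2]; have q3 := lnr0; apply/andP; split; lra.
Qed.

End growth.

(** * Passage to the limit *)

Section growth_limit.
Variable R : realType.
Notation Lob := (@lobachevsky R).
Implicit Type n : nat.

Definition step n : R := 2 * pi / (2 * n + 1)%:R.

Lemma step_gt0 n : 0 < step n.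
Proof. by rewrite divr_gt0 ?ltr0n ?addn1// mulr_gt0// pi_gt0. Qed.

Lemma inv_odd_cvg0 (e : R) : 0 < e -> \forall n \near \oo, (2 * n + 1)%:R^-1 < e.
Proof.
move=> e0; near=> n; rewrite invf_plt ?posrE ?ltr0n ?addn1//.
apply: (@lt_trans _ _ n%:R); last by rewrite ltr_nat ltnS leq_pmull.
by near: n; exact: nbhs_infty_gtr.
Unshelve. all: by end_near. Qed.

Lemma step_cvg0 : step @ \oo --> (0 : R).
Proof.
apply/cvgrPdist_lt => e e0; have e1 : 0 < e / (2 * pi) by rewrite divr_gt0// mulr_gt0// pi_gt0.
near=> n; rewrite sub0r normrN gtr0_norm ?step_gt0// /step.
have : (2 * n + 1)%:R^-1 < e / (2 * pi) by near: n; exact: inv_odd_cvg0.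
by rewrite ltr_pdivlMr ?mulr_gt0 ?pi_gt0// mulrC.
Unshelve. all: by end_near. Qed.

Lemma step_ln_cvg0 (e : R) : 0 < e ->
  \forall n \near \oo, 2 * step n * (3 * ln (2 * n + 1)%:R + 2) <= e.
Proof.
move=> e0; have e1 : 0 < e / 200 by rewrite divr_gt0.
have [h h0 H] := @xlnx_small R _ e1.
have e2 : 0 < e / 64 by rewrite divr_gt0.
near=> n.
have r1 : (2 * n + 1)%:R^-1 < h by near: n; exact: inv_odd_cvg0.
have r2 : (2 * n + 1)%:R^-1 < e / 64 by near: n; exact: inv_odd_cvg0.
have r0 : 0 < (2 * n + 1)%:R :> R by rewrite ltr0n addn1.
have l0 : 0 <= ln (2 * n + 1)%:R :> R by rewrite ln_ge0// ler1n addn1.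
rewrite /step; move: r1 r2 r0 l0; set r : R := (2 * n + 1)%:R => r1 r2 r0 l0.
have ri : 0 < r^-1 by rewrite invr_gt0.
have k := H (r^-1 / 2) ltac:(apply/andP; split; lra).
have hr : 2 * (r^-1 / 2) = r^-1 by field; rewrite gt_eqF.
rewrite hr lnV ?posrE// in k.
have k2 : r^-1 / 2 * ln r <= e / 200.
  by apply: le_trans (ler_norm _) _; rewrite -normrN -mulrN.
have p0 := pi_gt0 R; have p4 := pi_lt4 R.
have -> : 2 * (2 * pi / r) * (3 * ln r + 2) = pi * (24 * (r^-1 / 2 * ln r) + 8 * r^-1).
  by field; rewrite gt_eqF.
apply: (@le_trans _ _ (4 * (24 * (r^-1 / 2 * ln r) + 8 * r^-1))); last by lra.
apply: ler_wpM2r; last exact: ltW.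
by rewrite addr_ge0// !mulr_ge0// ltW.
Unshelve. all: by end_near. Qed.

Lemma continuous_theta_fig8 (a : R) : 0 <= a < 2 * pi / 3 -> {for a, continuous (@theta_fig8 R)}.
Proof.
move=> ha; have c1 := cos_gt_half ha; have c2 := cos_le1 a.
have c3 : -1 < cos a - 1 / 2 < 1 by apply/andP; split; lra.
have d1 := is_derive1_add (is_derive_cos a) (is_derive1_cst (- (1 / 2)) a).
have d2 := is_derive1_comp_cst (is_derive1_acos c3 : is_derive ((fun x => cos x - 1 / 2) a) 1 acos _) d1.
exact: is_derive1_continuous (is_derive1_mul d2 (is_derive1_cst 2^-1 a)).
Qed.

Variables (N : nat -> nat) (w : R).
Hypothesis N0 : forall n, (0 < n)%N -> (0 < N n < 2 * n + 1)%N.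
Hypothesis Nw : (fun n => (N n)%:R * (2 * step n)) @ \oo --> w.
Let a : R := `|w - 2 * pi|.
Hypothesis a1 : a < 177 / 100.
Hypothesis vol_a : 1 / 4 < cone_vol a.

Let a_dom : 0 <= a < 2 * pi / 3.
Proof. by rewrite normr_ge0 /=; have := a1; have := pi_gt_314 R; lra. Qed.

Let al n : R := `|(N n)%:R * (2 * step n) - 2 * pi|.

Let al_cvg : al @ \oo --> a.
Proof. by apply: cvg_norm; apply: cvgB => //; exact: cvg_cst. Qed.

Let th := theta_fig8 a.
Let th_cvg : (fun n => theta_fig8 (al n)) @ \oo --> th.
Proof. by apply: continuous_cvg; [exact: continuous_theta_fig8|exact: al_cvg]. Qed.

Let l n : nat := Num.truncn ((2 * pi - 2 * theta_fig8 (al n)) / (2 * step n)).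

Let al_small : \forall n \near \oo, al n <= 177 / 100.
Proof. by near=> n; apply: ltW; near: n; exact: (cvgr_lt _ al_cvg). Unshelve. all: by end_near. Qed.

Let l_cvg : (fun n => (l n)%:R * (2 * step n)) @ \oo --> 2 * pi - 2 * th.
Proof.
have c1 : (fun n => 2 * pi - 2 * theta_fig8 (al n)) @ \oo --> 2 * pi - 2 * th.
  by apply: cvgB; [exact: cvg_cst|apply: cvgM => //; exact: cvg_cst].
have c2 : (fun n => 2 * pi - 2 * theta_fig8 (al n) - 2 * step n) @ \oo --> 2 * pi - 2 * th.
  rewrite -[X in _ --> X]subr0; apply: cvgB => //; rewrite -(mulr0 2).
  by apply: cvgM; [exact: cvg_cst|exact: step_cvg0].
apply: (squeeze_cvgr _ c2 c1); near=> n.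
have s0 := step_gt0 n; have d0 : 0 < 2 * step n by rewrite mulr_gt0.
have al1 : al n <= 177 / 100 by near: n; exact: al_small.
have al2 : 0 <= al n < 2 * pi / 3 by rewrite normr_ge0/= -/(al n); have := pi_gt_314 R; lra.
have [/andP[_ b2] _] := theta_fig8_bounds al2.
have x0 : 0 <= (2 * pi - 2 * theta_fig8 (al n)) / (2 * step n).
  by rewrite divr_ge0 ?(ltW d0)//; have := pi_gt0 R; lra.
have /andP[h1 h2] := truncn_itv x0; rewrite -/(l n) in h1 h2.
rewrite ler_pdivlMr// in h1; rewrite ltr_pdivrMr// in h2.
rewrite -[(l n).+1%:R]natr1 mulrDl mul1r in h2; apply/andP; split; lra.
Unshelve. all: by end_near. Qed.

(** Signed half of the limiting angle: the two products of sines reach the angles [th + e] and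
    [th - e], and their sum in [cone_sum] is the same for both signs of [e]. *)
Let e : R := (w - 2 * pi) / 2.

Let ae : `|e| = a / 2.
Proof. by rewrite /e /a normrM [`|2^-1|]gtr0_norm ?invr_gt0. Qed.

Let e_bounds : 0 < th - `|e| /\ th + `|e| < pi.
Proof.
have [/andP[b1 b2] _] := theta_fig8_bounds a_dom; rewrite ae /th.
by have := a1; have := pi_gt_314 R; split; lra.
Qed.

Let phi_dom s : `|s| = `|e| -> 0 < th + s < pi.
Proof.
have [h1 h2] := e_bounds; move=> es; have := ler_norm s; have := ler_norm (- s).
by rewrite normrN es => k1 k2; apply/andP; split; lra.
Qed.

Let m1 n := (N n - l n).-1.
Let m2 n := (2 * n + 1 - N n - l n).-1.

Let m1_cvg : (fun n => (m1 n)%:R * step n) @ \oo --> th + e.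
Proof.
have c : (fun n => ((N n)%:R * (2 * step n) - (l n)%:R * (2 * step n)) / 2 - step n) @ \oo --> th + e.
  rewrite (_ : th + e = (w - (2 * pi - 2 * th)) / 2 - 0); last by rewrite /e; field.
  apply: cvgB; last exact: step_cvg0.
  by apply: cvgM; [exact: cvgB|exact: cvg_cst].
apply: cvg_trans c; apply: near_eq_cvg; near=> n.
have h : 0 < ((N n)%:R * (2 * step n) - (l n)%:R * (2 * step n)).
  near: n; apply: (cvgr_gt _ (cvgB Nw l_cvg)).
  have /andP[h1 _] := phi_dom (erefl `|e|); move: h1; rewrite /e; lra.
have lN : (l n < N n)%N.
  have d0 : 0 < 2 * step n by rewrite mulr_gt0 ?step_gt0.
  by move: h; rewrite subr_gt0 (ltr_pM2r d0) ltr_nat.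
rewrite /m1; have -> : ((N n - l n).-1)%:R = (N n)%:R - (l n)%:R - 1 :> R.
  by rewrite -natrB 1?ltnW// -[in RHS](prednK (n := N n - l n)) ?subn_gt0// -natr1 addrK.
by field.
Unshelve. all: by end_near. Qed.

Let m2_cvg : (fun n => (m2 n)%:R * step n) @ \oo --> th - e.
Proof.
have c : (fun n => (4 * pi - (N n)%:R * (2 * step n) - (l n)%:R * (2 * step n)) / 2 - step n) @ \oo --> th - e.
  rewrite (_ : th - e = (4 * pi - w - (2 * pi - 2 * th)) / 2 - 0); last by rewrite /e; field.
  apply: cvgB; last exact: step_cvg0.
  apply: cvgM; last exact: cvg_cst.
  by apply: cvgB => //; apply: cvgB => //; exact: cvg_cst.
have c4 : (fun n => 4 * pi - (N n)%:R * (2 * step n)) @ \oo --> 4 * pi - w.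
  by apply: cvgB => //; exact: cvg_cst.
apply: cvg_trans c; apply: near_eq_cvg; near=> n.
have h : 0 < (4 * pi - (N n)%:R * (2 * step n)) - (l n)%:R * (2 * step n).
  near: n; apply: (cvgr_gt _ (cvgB c4 l_cvg)).
  have /andP[h1 _] := phi_dom (normrN e); move: h1; rewrite /e; lra.
have n0 : (0 < n)%N by near: n; exact: nbhs_infty_gt.
have /andP[N1 N2] := N0 n0.
have rE : (2 * n + 1)%:R * (2 * step n) = 4 * pi.
  by rewrite /step; field; rewrite -natr1 gt_eqF// addn1 ltr0n.
have lN : (l n < 2 * n + 1 - N n)%N.
  have d0 : 0 < 2 * step n by rewrite mulr_gt0 ?step_gt0.
  have rN : (2 * n + 1 - N n)%:R * (2 * step n) = 4 * pi - (N n)%:R * (2 * step n).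
    by rewrite natrB 1?ltnW// mulrBl rE.
  by move: h; rewrite subr_gt0 -rN (ltr_pM2r d0) ltr_nat.
rewrite /m2; have -> : ((2 * n + 1 - N n - l n).-1)%:R = (2 * n + 1)%:R - (N n)%:R - (l n)%:R - 1 :> R.
  rewrite -natrB 1?ltnW// -natrB 1?ltnW//.
  by rewrite -[in RHS](prednK (n := 2 * n + 1 - N n - l n)) ?subn_gt0// -natr1 addrK.
by rewrite -rE; field.
Unshelve. all: by end_near. Qed.

Let A n : R := - (step n * lsin_sum (step n) (m1 n)) - step n * lsin_sum (step n) (m2 n).

Let A_cvg : (fun n => 2 * A n) @ \oo --> cone_vol a.
Proof.
have c1 := riemann_sum_cvg (phi_dom (erefl `|e|)) step_gt0 step_cvg0 m1_cvg.
have c2 := riemann_sum_cvg (phi_dom (normrN e)) step_gt0 step_cvg0 m2_cvg.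
have -> : cone_vol a = 2 * (- - Lob (th + e) - - Lob (th - e)).
  rewrite /cone_vol /cone_sum -ae -/th !opprK; have [e0|e0] := leP 0 e.
    by rewrite ger0_norm.
  by rewrite ltr0_norm// opprK addrC.
apply: cvgM; first exact: cvg_cst.
by apply: cvgB => //; apply: cvgN.
Qed.

Lemma ln_colored_jones_cvg :
  (fun n => 2 * step n * ln (cmod (colored_jones_fig8 R (2 * n + 1) (N n).-1))) @ \oo --> cone_vol a.
Proof.
set F := fun n => _.
have D : (fun n => F n - 2 * A n) @ \oo --> (0 : R).
  apply/cvgrPdist_le => x x0.
  have [d0 d00 H] := @poly_exp_small R 200 (1 / 100) 4 (ltac:(lra)) (ltac:(lra)).
  have c2 : (fun n => 2 * step n) @ \oo --> (0 : R).
    by rewrite -(mulr0 2); apply: cvgM; [exact: cvg_cst|exact: step_cvg0].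
  near=> n.
  have n0 : (0 < n)%N by near: n; exact: nbhs_infty_gt.
  have h1 : 2 * step n <= 1 / 100.
    by apply: ltW; near: n; apply: (cvgr_lt _ c2); lra.
  have h2 : 2 * step n < d0 by near: n; exact: (cvgr_lt _ c2).
  have al1 : al n <= 177 / 100 by near: n; exact: al_small.
  have p1 : (m1 n)%:R * step n < pi.
    by near: n; apply: (cvgr_lt _ m1_cvg); have /andP[] := phi_dom (erefl `|e|).
  have p2 : (m2 n)%:R * step n < pi.
    by near: n; apply: (cvgr_lt _ m2_cvg); have /andP[] := phi_dom (normrN e).
  have Age : 1 / 4 <= 2 * A n.
    by apply: ltW; near: n; exact: (cvgr_gt _ A_cvg).
  have sm : 200 * (2 * n + 1)%:R ^+ 4 * expR (- (1 / 100 / (2 * step n))) <= 1.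
    apply: H => //; first by rewrite mulr_gt0 ?step_gt0.
    have -> : (2 * n + 1)%:R * (2 * step n) = 4 * pi.
      by rewrite /step; field; rewrite -natr1 gt_eqF// addn1 ltr0n.
    by have := pi_lt_315 R; lra.
  rewrite sub0r normrN.
  apply: le_trans (@ln_colored_jones_bound R n (N n) n0 (N0 n0) h1 al1 sm p1 p2 Age) _.
  by near: n; exact: step_ln_cvg0.
have -> : F = (fun n => (F n - 2 * A n) + 2 * A n) by apply/funext => n; rewrite subrK.
by rewrite -[cone_vol a]add0r; exact: cvgD D A_cvg.
Unshelve. all: by end_near. Qed.

End growth_limit.

Lemma val_d_le (R : realType) : dec12 R val_d <= 177 / 100.
Proof.
have h : (val_d <= BinInt.Z.of_nat 177 * zpow 10 10)%binz by vm_compute.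
by have := dec12_le R h; rewrite dec12_pow// (_ : 10 ^+ (12 - 10) = 100)//; ring.
Qed.

Theorem theorem1p2 (R : realType)
  (Abrosimov_Mednykh : forall a : R, 0 <= a < 2 * pi / 3 ->
     vol_fig8_cone a =
       2 * (lobachevsky (theta_fig8 a + a / 2) +
            lobachevsky (theta_fig8 a - a / 2))) :
  (* alpha0 = 1.764 782 617 4... *)
  0 <= alpha0 R - (1 + 764 / 10 ^+ 3 + 782 / 10 ^+ 6 + 617 / 10 ^+ 9
                   + 4 / 10 ^+ 10) < 1 / 10 ^+ 10 /\
  forall (a : R) (twoj : nat -> nat),
    0 <= a < alpha0 R ->
    (forall n, (1 <= n)%N -> (twoj n <= 2 * n + 1 - 2)%N) ->
    let u := fun n => (twoj n)%:R / 2 / (2 * n + 1)%:R : R in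
    cvgn u ->
    `|8 * pi * limn u - 2 * pi| = a ->
    (fun n => 4 * pi / (2 * n + 1)%:R *
       ln (cmod (colored_jones_fig8 R (2 * n + 1) (twoj n)))) @ \oo
      --> vol_fig8_cone a.
Proof.
have p3 := pi_gt3 R; have p4 : 177 / 100 < 2 * pi / 3 :> R by have := pi_gt_314 R; lra.
have volE (a : R) : 0 <= a < 2 * pi / 3 -> vol_fig8_cone a = cone_vol a.
  exact: Abrosimov_Mednykh.
have potE (a : R) : 0 <= a < 2 * pi / 3 -> Im (potential a (a / 2)%:C) = - lobachevsky a.
  by move=> /andP[a0 a1]; apply: Im_potential; rewrite a0/=; lra.
have alphaE : alpha0 R = sup [set a : R | 0 <= a < 2 * pi / 3 /\ 2 * (- lobachevsky a) < cone_vol a].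
  congr sup; apply/seteqP; split => a [ha h]; split => //.
    by rewrite -potE// -volE.
  by rewrite potE// volE.
have := sup_bounds R; rewrite -alphaE => /andP[c1 c2].
have dE := val_dE R; have cE := val_cE R; have d2 := val_d_le R.
split.
  rewrite -cE; rewrite dE in c2; move: c1 c2; move: (dec12 R val_c) (alpha0 R) => c al c1 c2.
  have e9 : 9 / 10 ^+ 11 < 1 / 10 ^+ 10 :> R.
    by rewrite [10 ^+ 11]exprS invfM mulrA ltr_pM2r ?invr_gt0 ?exprn_gt0//; clear; lra.
  by clear -c1 c2 e9; apply/andP; split; lra.
move=> a twoj /andP[a0 aal] tj u cu ua.
have ad : a <= dec12 R val_d by exact: le_trans (ltW aal) c2.
have a177 : a < 177 / 100 by apply: lt_le_trans aal _; exact: le_trans c2 d2.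
have dpi : dec12 R val_d < 2 * pi / 3 := le_lt_trans d2 p4.
clear dE cE c1.
have adom : 0 <= a < 2 * pi / 3 by rewrite a0 (le_lt_trans ad dpi).
(* The volume decreases with the angle and is at least [26/100] at [val_d]. Exceeding [1/4] is what
   makes [|P_l|] at least [exp ((1/4) / d)] for large [n]. *)
have va : 1 / 4 < cone_vol a.
  apply: (@lt_le_trans _ _ (26 / 100)); first by clear; lra.
  apply: le_trans (cone_vol_val_d R) _; apply: cone_vol_antitone => //.
  by rewrite a0.
rewrite volE//.
(* [N d] is [4 pi (2j + 1) / r]: the part [2j] yields [8 pi] times [j / r], and the part [1]
   vanishes in the limit. *)
pose N n := (twoj n).+1; pose w := 8 * pi * limn u.
have N0 n : (0 < n)%N -> (0 < N n < 2 * n + 1)%N.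
  by move=> n0; have := tj n n0; rewrite /N; clear -n0; lia.
have Nw : (fun n => (N n)%:R * (2 * step R n)) @ \oo --> w.
  have -> : (fun n => (N n)%:R * (2 * step R n)) = (fun n => 8 * pi * u n + 2 * step R n).
    apply/funext => n; rewrite /N /u /step -[(twoj n).+1%:R]natr1.
    by field; rewrite gt_eqF// ltr0n addn1.
  rewrite -[w]addr0; apply: cvgD.
    by apply: cvgM; [exact: cvg_cst|exact: cu].
  by rewrite -(mulr0 2); apply: cvgM; [exact: cvg_cst|exact: step_cvg0].
have := @ln_colored_jones_cvg R N w N0 Nw; rewrite ua => /(_ a177 va).
have -> // : (fun n => 2 * step R n * ln (cmod (colored_jones_fig8 R (2 * n + 1) (N n).-1))) =
  (fun n => 4 * pi / (2 * n + 1)%:R * ln (cmod (colored_jones_fig8 R (2 * n + 1) (twoj n)))).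
apply/funext => n; congr (_ * _); rewrite /step.
by field; rewrite gt_eqF// ltr0n addn1.
Qed.
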